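(* Let $\Lambda\in P^+$, and let $\beta=\sum_{j=1}^pk_j\alpha_{i_j}\in Q_n^+$ with $i_1,\dots,i_p\in I$ pairwise distinct. Let $\widetilde\nu=(\underbrace{i_1,\dots,i_1}_{k_1\text{ copies}},\dots,\underbrace{i_p,\dots,i_p}_{k_p\text{ copies}})\in I^\beta$ and let $\nu\in I^\beta$. For each $1\le k\le n$, let $N_k$ denote the degree of the leading term of the $x_k$-expansion of the polynomial $g^\Lambda_{\nu,k}\in\mathbf{k}[x_1,\dots,x_k]$ defined in the context. Then the canonical image of the set $$\{\tau_wx^{\underline a}e(\nu)\mid w\in\mathfrak{S}(\nu,\widetilde\nu),\ \underline a=(a_1,\dots,a_n)\in\mathbb{N}^n,\ a_k<N_k\ \ \forall\,1\le k\le n\}$$ forms a $\mathbf{k}$-basis of $e(\widetilde\nu)\mathscr{R}_\beta^\Lambda e(\nu)$.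
   Context: **Cartan datum.** $I$ is an index set and $A=(a_{ij})_{i,j\in I}$ is a symmetrizable generalized Cartan matrix (integral; $a_{ii}=2$; $a_{ij}\le 0$ for $i\ne j$; $a_{ij}=0\Leftrightarrow a_{ji}=0$; there are $d_i\in\mathbb{Z}_{>0}$ with $(d_ia_{ij})$ symmetric). $P$ is a free abelian group of finite rank, $P^\vee=\mathrm{Hom}(P,\mathbb{Z})$ with pairing $\langle\cdot,\cdot\rangle$; linearly independent simple roots $\alpha_i\in P$ and simple coroots $\alpha_i^\vee\in P^\vee$ satisfy $\langle\alpha_i^\vee,\alpha_j\rangle=a_{ij}$, and there are fundamental weights $\Lambda_i\in P$ with $\langle\alpha_j^\vee,\Lambda_i\rangle=\delta_{ij}$. $P^+=\{\lambda\in P:\langle\alpha_i^\vee,\lambda\rangle\ge0\ \forall i\}$, $Q_n^+=\{\sum_ik_i\alpha_i:k_i\in\mathbb{Z}_{\ge0},\sum_ik_i=n\}$ ($n\ge1$ here), $(\alpha_i,\alpha_j)=d_ia_{ij}$. $\mathfrak{S}_n$ acts on $I^n$ by $w.\nu=(\nu_{w^{-1}(1)},\dots,\nu_{w^{-1}(n)})$; $I^\beta=\{\nu\in I^n:\sum_k\alpha_{\nu_k}=\beta\}$; $s_k=(k,k+1)$; $\mathfrak{S}(\nu,\nu')=\{w\in\mathfrak{S}_n:w.\nu=\nu'\}$. $\mathbb{N}$ contains $0$. **KLR algebra.** $\mathbf{k}=\bigoplus_{m\ge0}\mathbf{k}_m$ is a graded commutative integral domain (not assumed Noetherian or a field). Fix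 $Q_{i,j}\in\mathbf{k}[u,v]$ with $Q_{i,i}=0$, $Q_{i,j}(u,v)=Q_{j,i}(v,u)$, and for $i\ne j$, $Q_{i,j}(u,v)=\sum_{p,q\ge0}c_{i,j,p,q}u^pv^q$ with $c_{i,j,p,q}\in\mathbf{k}_{-2(\alpha_i,\alpha_j)-(\alpha_i,\alpha_i)p-(\alpha_j,\alpha_j)q}$ (so zero when this degree is negative) and $c_{i,j,-a_{ij},0}\in\mathbf{k}_0^\times$. $\mathscr{R}_\beta$ is the associative $\mathbf{k}$-algebra generated by $e(\nu)$ ($\nu\in I^\beta$), $x_1,\dots,x_n$, $\tau_1,\dots,\tau_{n-1}$ with relations: $e(\nu)e(\nu')=\delta_{\nu\nu'}e(\nu)$, $\sum_\nu e(\nu)=1$, $x_kx_l=x_lx_k$, $x_ke(\nu)=e(\nu)x_k$, $\tau_le(\nu)=e(s_l.\nu)\tau_l$, $\tau_k\tau_l=\tau_l\tau_k$ if $|k-l|>1$, $\tau_k^2e(\nu)=Q_{\nu_k,\nu_{k+1}}(x_k,x_{k+1})e(\nu)$; $(\tau_kx_l-x_{s_k(l)}\tau_k)e(\nu)=-e(\nu)$ if $l=k,\nu_k=\nu_{k+1}$, $=e(\nu)$ if $l=k+1,\nu_k=\nu_{k+1}$, $=0$ otherwise; $(\tau_{k+1}\tau_k\tau_{k+1}-\tau_k\tau_{k+1}\tau_k)e(\nu)=\frac{Q_{\nu_k,\nu_{k+1}}(x_k,x_{k+1})-Q_{\nu_{k+2},\nu_{k+1}}(x_{k+2},x_{k+1})}{x_k-x_{k+2}}e(\nu)$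 if $\nu_k=\nu_{k+2}$, $=0$ otherwise. For each $w\in\mathfrak{S}_n$ fix a reduced expression $w=s_{j_1}\cdots s_{j_r}$ and put $\tau_w=\tau_{j_1}\cdots\tau_{j_r}$; $\mathscr{R}_\beta$ is known to be free over $\mathbf{k}$ with basis $\{\tau_wx^{\underline a}e(\nu)\}$, $x^{\underline a}=x_1^{a_1}\cdots x_n^{a_n}$. For the special $\widetilde\nu$ of the claim, $e(\widetilde\nu)\tau_w$ does not depend on the choice of reduced expression. **Cyclotomic quotient.** For each $i\in I$ fix a monic polynomial $a_i^\Lambda(u)=\sum_{k=0}^{\langle\alpha_i^\vee,\Lambda\rangle}c_{i;k}u^{\langle\alpha_i^\vee,\Lambda\rangle-k}$ with $c_{i;0}=1$, $c_{i;k}\in\mathbf{k}_{k(\alpha_i,\alpha_i)}$. $I_{\Lambda,\beta}$ is the two-sided ideal of $\mathscr{R}_\beta$ generated by $\sum_{\nu\in I^\beta}a^\Lambda_{\nu_1}(x_1)e(\nu)$, and $\mathscr{R}_\beta^\Lambda=\mathscr{R}_\beta/I_{\Lambda,\beta}$. **The polynomials $g^\Lambda_{\nu,k}$.** Order $\{i_1,\dots,i_p\}$ by $i_s\prec i_t\Leftrightarrow s<t$. $s_k$ acts on $\mathbf{k}[x_1,\dots,x_n]$ by exchanging $x_k,x_{k+1}$, and $\partial_k(f)=\frac{f-s_k(f)}{x_{k+1}-x_k}$. For all $\nu\in I^\beta$: $g^\Lambda_{\nu,1}=a^\Lambda_{\nu_1}(x_1)$, and for $1\le k<n$, $g^\Lambda_{\nu,k+1}=\partial_k(g^\Lambda_{\nu,k})$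 if $\nu_k=\nu_{k+1}$; $=s_k(g^\Lambda_{s_k.\nu,k})$ if $\nu_k\succ\nu_{k+1}$; $=s_k(g^\Lambda_{s_k.\nu,k})\cdot Q_{\nu_k,\nu_{k+1}}(x_k,x_{k+1})$ if $\nu_k\prec\nu_{k+1}$. *)

(* Defs.v *)
From HB Require Import structures.
From mathcomp Require Import all_boot all_order all_algebra all_fingroup.
From mathcomp Require monalg.
From mathcomp Require Import mpoly boolp classical_sets.

Set Implicit Arguments.
Unset Strict Implicit.
Unset Printing Implicit Defensive.

Import Order.TTheory GRing.Theory Num.Theory.

Local Open Scope ring_scope.

(* The structure [algType] of MathComp excludes the zero ring, whereas a
  cyclotomic quotient may vanish; hence the following type of K-algebras: rings
  with a central morphism from K, possibly zero. *)

Record algebra (K : comNzRingType) := Algebra {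
  algebra_ring : pzRingType;
  algebra_map : {rmorphism K -> algebra_ring};
  algebra_mapC : forall c x, algebra_map c * x = x * algebra_map c
}.

Definition algebra_sort (K : comNzRingType) (A : algebra K) : Type :=
  algebra_ring A.
Coercion algebra_sort : algebra >-> Sortclass.

Section AlgebraTheory.
Variables (K : comNzRingType) (A : algebra K).

HB.instance Definition _ := GRing.PzRing.on (algebra_sort A).

Definition algebra_scale (c : K) (x : A) : A := algebra_map A c * x.

Fact algebra_scaleA a b x :
  algebra_scale a (algebra_scale b x) = algebra_scale (a * b) x.
Proof. by rewrite /algebra_scale mulrA rmorphM. Qed.
Fact algebra_scale1 : left_id 1 algebra_scale.
Proof. by move=> x; rewrite /algebra_scale rmorph1 mul1r. Qed.
Fact algebra_scaleDr : right_distributive algebra_scale +%R.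
Proof. by move=> a x y; rewrite /algebra_scale mulrDr. Qed.
Fact algebra_scaleDl x : {morph algebra_scale^~ x : a b / a + b}.
Proof. by move=> a b; rewrite /algebra_scale rmorphD mulrDl. Qed.

HB.instance Definition _ := GRing.Zmodule_isLmodule.Build K (algebra_sort A)
  algebra_scaleA algebra_scale1 algebra_scaleDr algebra_scaleDl.

Lemma algebra_scaleE (c : K) (x : A) : c *: x = algebra_map A c * x.
Proof. by []. Qed.

End AlgebraTheory.

Section FreeAlgebra.
Import monalg.
Variables (K : comNzRingType) (G : choiceType).

Fact free_algebra_mapC (c : K) (z : {malg K[{fmonom G}]}) :
  malgC c * z = z * malgC c.
Proof.
rewrite !malgM_def fgmulUg fgmulgU.
by apply: eq_bigr => w _; rewrite mulrC mul1m mulm1.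
Qed.

Definition free_algebra : algebra K :=
  @Algebra K {malg K[{fmonom G}]} (@malgC {fmonom G} K) free_algebra_mapC.

Definition free_gen (g : G) : free_algebra := (<< fmu g >> : {malg K[_]}).

End FreeAlgebra.

Section QuotientRing.
Variable A : pzRingType.

Inductive two_sided_ideal (S : A -> Prop) : A -> Prop :=
| Ideal0 : two_sided_ideal S 0
| IdealD x y :
    two_sided_ideal S x -> two_sided_ideal S y -> two_sided_ideal S (x + y)
| IdealM a s b : S s -> two_sided_ideal S (a * s * b).

Variable S : A -> Prop.
Lemma idealMl a x : two_sided_ideal S x -> two_sided_ideal S (a * x).
Proof.
elim=> [|y z _ Iy _ Iz|b s c Ss]; rewrite ?mulr0 ?mulrDr.
- exact: Ideal0.
- exact: IdealD.
- by rewrite !mulrA; apply: IdealM.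
Qed.

Lemma idealMr a x : two_sided_ideal S x -> two_sided_ideal S (x * a).
Proof.
elim=> [|y z _ Iy _ Iz|b s c Ss]; rewrite ?mul0r ?mulrDl.
- exact: Ideal0.
- exact: IdealD.
- by rewrite -!mulrA mulrA; apply: IdealM.
Qed.

Definition ideal_pred : A -> bool := fun x => `[< two_sided_ideal S x >].

Fact ideal_zmod_closed : zmod_closed ideal_pred.
Proof.
split=> [|x y /asboolP Ix /asboolP Iy]; apply/asboolP; first exact: Ideal0.
by apply: IdealD => //; rewrite -mulN1r; apply: idealMl.
Qed.

HB.instance Definition _ :=
  GRing.isZmodClosed.Build A ideal_pred ideal_zmod_closed.

Definition quotient_ring :=
  Quotient.quot (GRing.ZmodClosed.clone A ideal_pred _).

HB.instance Definition _ := GRing.Zmodule.on quotient_ring.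

Definition quot_pi (x : A) : quotient_ring := (\pi_quotient_ring x)%qT.

Definition quot_repr (u : quotient_ring) : A := generic_quotient.repr u.

Lemma quot_repr_pi (u : quotient_ring) : quot_pi (quot_repr u) = u.
Proof. exact: reprK. Qed.

Lemma quot_pi_eq x y : quot_pi x = quot_pi y <-> two_sided_ideal S (x - y).
Proof.
rewrite /quot_pi; split=> [/eqP|Ixy].
  by rewrite -Quotient.idealrBE => /asboolP.
by apply/eqP; rewrite -Quotient.idealrBE; apply/asboolP.
Qed.

Lemma quot_pi_surj (u : quotient_ring) : exists x, quot_pi x = u.
Proof. by exists (quot_repr u); exact: quot_repr_pi. Qed.

Lemma quot_pi_repr (x : A) : two_sided_ideal S (quot_repr (quot_pi x) - x).
Proof. by apply/quot_pi_eq/quot_repr_pi. Qed.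

Fact quot_pi_additive : zmod_morphism quot_pi.
Proof. exact: pi_is_zmod_morphism. Qed.
HB.instance Definition _ :=
  GRing.isZmodMorphism.Build A quotient_ring quot_pi quot_pi_additive.

Definition quot_mul (u v : quotient_ring) := quot_pi (quot_repr u * quot_repr v).

Fact quot_mulE x y : quot_mul (quot_pi x) (quot_pi y) = quot_pi (x * y).
Proof.
apply/quot_pi_eq; set x' := quot_repr _; set y' := quot_repr _.
have ->: x' * y' - x * y = (x' - x) * y' + x * (y' - y).
  by rewrite mulrBl mulrBr addrA subrK.
by apply: IdealD; [apply: idealMr|apply: idealMl]; apply: quot_pi_repr.
Qed.

Local Ltac lift1 x := let y := fresh in
  have [y <-] := quot_pi_surj x => {x}; move: y => x.

Fact quot_mulA : associative quot_mul.
Proof.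
by move=> x y z; lift1 x; lift1 y; lift1 z; rewrite !quot_mulE mulrA.
Qed.
Fact quot_mul1l : left_id (quot_pi 1) quot_mul.
Proof. by move=> x; lift1 x; rewrite quot_mulE mul1r. Qed.
Fact quot_mul1r : right_id (quot_pi 1) quot_mul.
Proof. by move=> x; lift1 x; rewrite quot_mulE mulr1. Qed.
Fact quot_mulDl : left_distributive quot_mul +%R.
Proof.
move=> x y z; lift1 x; lift1 y; lift1 z.
by rewrite !quot_mulE -!raddfD quot_mulE mulrDl.
Qed.
Fact quot_mulDr : right_distributive quot_mul +%R.
Proof.
move=> x y z; lift1 x; lift1 y; lift1 z.
by rewrite !quot_mulE -!raddfD quot_mulE mulrDr.
Qed.

HB.instance Definition _ := GRing.Zmodule_isPzRing.Build quotient_ring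
  quot_mulA quot_mul1l quot_mul1r quot_mulDl quot_mulDr.

Fact quot_pi_monoid : monoid_morphism quot_pi.
Proof. by split=> // x y; rewrite -quot_mulE. Qed.
HB.instance Definition _ :=
  GRing.isMonoidMorphism.Build A quotient_ring quot_pi quot_pi_monoid.

End QuotientRing.

Section QuotientAlgebra.
Variables (K : comNzRingType) (A : algebra K) (S : A -> Prop).

Definition quot_algebra_map : {rmorphism K -> quotient_ring S} :=
  @quot_pi _ S \o algebra_map A.

Fact quot_algebra_mapC c (u : quotient_ring S) :
  quot_algebra_map c * u = u * quot_algebra_map c.
Proof.
by have [x <-] := quot_pi_surj u; rewrite /= -!rmorphM /= algebra_mapC.
Qed.

Definition quotient_algebra : algebra K := Algebra quot_algebra_mapC.

Definition canonical_image (x : A) : quotient_algebra := quot_pi S x.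

End QuotientAlgebra.

Section Presentation.
Variables (K : comNzRingType) (G : choiceType).
Variable rel : free_algebra K G -> free_algebra K G -> Prop.

Definition presented_algebra : algebra K :=
  quotient_algebra (fun z => exists x y, rel x y /\ z = x - y).

Definition presented_gen (g : G) : presented_algebra :=
  canonical_image _ (free_gen K g).

End Presentation.

Definition is_basis (K : comNzRingType) (V : lmodType K) (J : eqType)
    (D : J -> Prop) (b : J -> V) (U : V -> Prop) : Prop :=
  [/\ forall j, D j -> U (b j),
      forall (s : seq J) (c : J -> K), uniq s -> (forall j, j \in s -> D j) ->
        \sum_(j <- s) c j *: b j = 0 -> forall j, j \in s -> c j = 0
    & forall v, U v -> exists (s : seq J) (c : J -> K),
        (forall j, j \in s -> D j) /\ v = \sum_(j <- s) c j *: b j].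

(* The quotient f / g when g divides f, for g a nonzero element of an
   integral domain; 0 when g does not divide f. *)
Definition exquo (R : idomainType) (f g : R) : R := xget 0 [set h | h * g = f].

Lemma exquoP (R : idomainType) (f g h : R) :
  g != 0 -> h * g = f -> exquo f g = h.
Proof.
move=> g0 hg; rewrite /exquo; case: xgetP => [h' _ /= h'g|/(_ h) //].
by apply: (mulIf g0); rewrite h'g hg.
Qed.

Section Polynomials.
Variables (K : idomainType) (n : nat).

(* Q(x_i, x_j), for Q = Q(u, v). *)
Definition subst2 (Q : {mpoly K[2]}) (i j : 'I_n) : {mpoly K[n]} :=
  Q \mPo [tuple 'X_i; 'X_j].

Definition mpoly_eval (A : algebra K) (x : 'I_n -> A) (f : {mpoly K[n]}) : A :=
  \sum_(m <- msupp f) f@_m *: \prod_(i < n) x i ^+ m i.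

Definition poly_eval (A : algebra K) (x : A) (f : {poly K}) : A :=
  \sum_(j < size f) f`_j *: x ^+ j.

Definition degree_in (i : 'I_n) (f : {mpoly K[n]}) : nat :=
  \max_(m <- msupp f) m i.

End Polynomials.

Record grading (K : comNzRingType) := Grading {
  graded_piece :> nat -> K -> Prop;
  grading0 : forall m, graded_piece m 0;
  gradingB : forall m x y,
    graded_piece m x -> graded_piece m y -> graded_piece m (x - y);
  grading1 : graded_piece 0 1;
  gradingM : forall m p x y,
    graded_piece m x -> graded_piece p y -> graded_piece (m + p) (x * y);
  grading_sum : forall x, exists (N : nat) (f : nat -> K),
    (forall m, graded_piece m (f m)) /\ x = \sum_(m < N) f m;
  grading_direct : forall (N : nat) (f : nat -> K),
    (forall m, graded_piece m (f m)) -> \sum_(m < N) f m = 0 ->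
    forall m, (m < N)%N -> f m = 0
}.

Definition homogeneous (K : comNzRingType) (gr : grading K) (d : int) (x : K) :
    Prop :=
  if d is Posz m then gr m x else x = 0.

Definition degree0_unit (K : comNzRingType) (gr : grading K) (x : K) : Prop :=
  gr 0 x /\ exists2 y, gr 0 y & x * y = 1.

Definition free_of_finite_rank (P : zmodType) : Prop :=
  exists (r : nat) (b : 'I_r -> P), forall x : P,
    exists! c : {ffun 'I_r -> int}, x = \sum_i b i *~ c i.

(* The index set is a finite type: an infinite family in P cannot be linearly
   independent. *)
Record cartan_datum (I : finType) (P : zmodType) := CartanDatum {
  cartan_matrix : I -> I -> int;
  symmetrizer : I -> nat;
  simple_root : I -> P;
  simple_coroot : I -> {additive P -> int};
  fundamental_weight : I -> P;
  cartan_diag : forall i, cartan_matrix i i = 2;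
  cartan_offdiag : forall i j, i != j -> cartan_matrix i j <= 0;
  cartan_eq0 : forall i j, cartan_matrix i j = 0 <-> cartan_matrix j i = 0;
  symmetrizer_gt0 : forall i, (0 < symmetrizer i)%N;
  cartan_symmetrizable : forall i j,
    (symmetrizer i)%:Z * cartan_matrix i j
    = (symmetrizer j)%:Z * cartan_matrix j i;
  weight_lattice_free : free_of_finite_rank P;
  simple_root_free : forall c : I -> int,
    \sum_i simple_root i *~ c i = 0 -> forall i, c i = 0;
  coroot_root : forall i j,
    simple_coroot i (simple_root j) = cartan_matrix i j;
  coroot_fundamental : forall i j,
    simple_coroot j (fundamental_weight i) = (i == j)%:Z
}.

Section CartanDatum.
Variables (I : finType) (P : zmodType) (C : cartan_datum I P).

(* (alpha_i, alpha_j) *)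
Definition root_form (i j : I) : int :=
  (symmetrizer C i)%:Z * cartan_matrix C i j.

Definition dominant (lam : P) : Prop := forall i, 0 <= simple_coroot C i lam.

(* The coefficients c_{i,j,p,q} of u^p v^q are the coefficients at the monomials
   of exponent (p, q), with u and v the variables of index 0 and 1. *)
Record klr_parameters (K : idomainType) (gr : grading K) := KLRParameters {
  klr_poly :> I -> I -> {mpoly K[2]};
  klr_poly_diag : forall i, klr_poly i i = 0;
  klr_poly_sym : forall i j,
    klr_poly i j = msym (tperm ord0 ord_max) (klr_poly j i);
  klr_poly_homogeneous : forall i j (m : 'X_{1..2}), i != j ->
    homogeneous gr (- 2 * root_form i j - root_form i i * (m ord0)%:Z
                    - root_form j j * (m ord_max)%:Z)
                (klr_poly i j)@_m;
  klr_poly_unit : forall i j, i != j ->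
    degree0_unit gr (klr_poly i j)@_(U_(ord0) *+ `|cartan_matrix C i j|)
}.

Record cyclotomic_parameters (K : idomainType) (gr : grading K) (Lam : P) :=
    CyclotomicParameters {
  cyclotomic_poly :> I -> {poly K};
  cyclotomic_monic : forall i, cyclotomic_poly i \is monic;
  cyclotomic_size : forall i,
    size (cyclotomic_poly i) = `|simple_coroot C i Lam|%N.+1;
  cyclotomic_homogeneous : forall i k,
    (k <= `|simple_coroot C i Lam|)%N ->
    homogeneous gr (k%:Z * root_form i i)
                (cyclotomic_poly i)`_(`|simple_coroot C i Lam| - k)
}.

Definition weight_word (n : nat) (beta : P) : finType :=
  {nu : n.-tuple I | \sum_(k < n) simple_root C (tnth nu k) == beta}.

Definition letter n beta (nu : weight_word n beta) (k : 'I_n) : I :=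
  tnth (val nu) k.

Definition perm_tuple n (w : 'S_n) (nu : n.-tuple I) : n.-tuple I :=
  [tuple tnth nu ((w^-1)%g k) | k < n].

Fact perm_tuple_weight n beta (w : 'S_n) (nu : weight_word n beta) :
  \sum_(k < n) simple_root C (tnth (perm_tuple w (val nu)) k) == beta.
Proof.
case: nu => nu /= /eqP <-; rewrite (reindex_inj (@perm_inj _ w)) /=.
by apply/eqP/eq_bigr => k _; rewrite tnth_mktuple permK.
Qed.

Definition perm_word n beta (w : 'S_n) (nu : weight_word n beta) :
    weight_word n beta :=
  exist _ (perm_tuple w (val nu)) (perm_tuple_weight w nu).

End CartanDatum.

(* From here on there are n.+1 strands, numbered from 0; strand [k] is
  [inord k] and [simple_transp k] exchanges strands [k] and [k.+1]. *)

Definition simple_transp (n k : nat) : 'S_n.+1 :=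
  tperm (inord k) (inord k.+1).

(* The composite s_{j_1} o ... o s_{j_r} of the word j_1 ... j_r; the product of
   permutations in MathComp composes from left to right. *)
Definition word_perm n (js : seq 'I_n) : 'S_n.+1 :=
  (\prod_(j <- rev js) simple_transp n j)%g.

Definition reduced_expression n (w : 'S_n.+1) (js : seq 'I_n) : Prop :=
  word_perm js = w /\
  forall js' : seq 'I_n, word_perm js' = w -> (size js <= size js')%N.

Section KLR.
Variables (I : finType) (P : zmodType) (C : cartan_datum I P).
Variables (K : idomainType) (gr : grading K) (Q : klr_parameters C gr).
Variables (n : nat) (beta : P).

Local Notation Ibeta := (weight_word C n.+1 beta).
Local Notation s_ k := (simple_transp n k).
Local Notation str k := (inord k : 'I_n.+1).

Inductive klr_relation (A : algebra K) (e : Ibeta -> A) (x : 'I_n.+1 -> A)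
    (tau : 'I_n -> A) : A -> A -> Prop :=
| KLR_ee nu nu' :
    klr_relation e x tau (e nu * e nu') (if nu == nu' then e nu else 0)
| KLR_sum_e :
    klr_relation e x tau (\sum_nu e nu) 1
| KLR_xx k l :
    klr_relation e x tau (x k * x l) (x l * x k)
| KLR_xe k nu :
    klr_relation e x tau (x k * e nu) (e nu * x k)
| KLR_te (l : 'I_n) nu :
    klr_relation e x tau (tau l * e nu) (e (perm_word (s_ l) nu) * tau l)
| KLR_tt (k l : 'I_n) :
    (k.+1 < l)%N \/ (l.+1 < k)%N ->
    klr_relation e x tau (tau k * tau l) (tau l * tau k)
| KLR_t2 (k : 'I_n) nu :
    klr_relation e x tau (tau k ^+ 2 * e nu)
      (mpoly_eval x (subst2 (Q (letter nu (str k)) (letter nu (str k.+1)))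
                            (str k) (str k.+1)) * e nu)
| KLR_tx (k : 'I_n) (l : 'I_n.+1) nu :
    klr_relation e x tau ((tau k * x l - x (s_ k l) * tau k) * e nu)
      (if letter nu (str k) == letter nu (str k.+1) then
         if l == str k then - e nu else if l == str k.+1 then e nu else 0
       else 0)
| KLR_braid (k l : 'I_n) nu :
    l = k.+1 :> nat ->
    klr_relation e x tau
      ((tau l * tau k * tau l - tau k * tau l * tau k) * e nu)
      (if letter nu (str k) == letter nu (str k.+2) then
         mpoly_eval x (exquo
           (subst2 (Q (letter nu (str k)) (letter nu (str k.+1)))
                   (str k) (str k.+1)
            - subst2 (Q (letter nu (str k.+2)) (letter nu (str k.+1)))
                     (str k.+2) (str k.+1))
           ('X_(str k) - 'X_(str k.+2))) * e nu
       else 0).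

Definition klr_generator : finType := (Ibeta + 'I_n.+1 + 'I_n)%type.

Definition klr_free_relation :
    free_algebra K klr_generator -> free_algebra K klr_generator -> Prop :=
  klr_relation (fun nu => free_gen K (inl (inl nu) : klr_generator))
               (fun k => free_gen K (inl (inr k) : klr_generator))
               (fun l => free_gen K (inr l : klr_generator)).

Definition klr_algebra : algebra K := presented_algebra klr_free_relation.

Definition klr_e (nu : Ibeta) : klr_algebra :=
  presented_gen klr_free_relation (inl (inl nu)).
Definition klr_x (k : 'I_n.+1) : klr_algebra :=
  presented_gen klr_free_relation (inl (inr k)).
Definition klr_tau (l : 'I_n) : klr_algebra :=
  presented_gen klr_free_relation (inr l).

Definition klr_tau_word (js : seq 'I_n) : klr_algebra :=
  \prod_(j <- js) klr_tau j.
Definition klr_xmon (a : 'X_{1..n.+1}) : klr_algebra :=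
  \prod_(k < n.+1) klr_x k ^+ a k.

Variables (Lam : P) (a : cyclotomic_parameters C gr Lam).

Definition cyclotomic_element : klr_algebra :=
  \sum_(nu : Ibeta) poly_eval (klr_x ord0) (a (letter nu ord0)) * klr_e nu.

Definition cyclotomic_klr_algebra : algebra K :=
  quotient_algebra (fun z : klr_algebra => z = cyclotomic_element).

Definition to_cyclotomic (z : klr_algebra) : cyclotomic_klr_algebra :=
  canonical_image _ z.

Definition divided_difference (k : nat) (f : {mpoly K[n.+1]}) :
    {mpoly K[n.+1]} :=
  exquo (f - msym (s_ k) f) ('X_(str k.+1) - 'X_(str k)).

(* As strands are numbered from 0, [g_poly prec k nu] is g_{nu,k+1}. *)
Fixpoint g_poly (prec : rel I) (k : nat) (nu : Ibeta) : {mpoly K[n.+1]} :=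
  if k is k'.+1 then
    let i := letter nu (str k') in
    let j := letter nu (str k'.+1) in
    if i == j then divided_difference k' (g_poly prec k' nu)
    else
      let f := msym (s_ k') (g_poly prec k' (perm_word (s_ k') nu)) in
      if prec j i then f else f * subst2 (Q i j) (str k') (str k'.+1)
  else (map_poly (@mpolyC n.+1 K) (a (letter nu ord0))).['X_ord0].

Definition leading_degree (prec : rel I) (nu : Ibeta) (k : 'I_n.+1) : nat :=
  degree_in k (g_poly prec k nu).

End KLR.

Definition listing_order (I : eqType) (p : nat) (i_ : 'I_p -> I) : rel I :=
  fun i j => [exists s : 'I_p, exists t : 'I_p, [&& (s < t)%N, i_ s == i & i_ t == j]].

Definition corner (A : pzRingType) (e f : A) : A -> Prop :=
  fun v => exists r, v = e * r * f.

(* Main.v *)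
Require Import Defs.
From HB Require Import structures.
From mathcomp Require Import all_boot all_order all_algebra all_fingroup.
From mathcomp Require monalg.
From mathcomp Require Import ssrcomplements mpoly boolp zify ring.

Set Implicit Arguments.
Unset Strict Implicit.
Unset Printing Implicit Defensive.

Import Order.TTheory GRing.Theory Num.Theory.

Local Open Scope ring_scope.

(** Write [e], [x], [tau] for the generators, [R] for the KLR algebra, [Pol] for
    the polynomials in the [x_k], and [g_k] for [g_(nu,k)]; here strands are
    numbered from 1.

    The words of reduced expressions span [R] over [Pol], whatever expressions
    are chosen ([klr_spanning]): two reduced words of a permutation differ by
    commutations and braid relations, which hold up to shorter words. One word for
    each permutation gives a family that is independent over [Pol]
    ([klr_independent]): on functions on the symmetric group with values in the
    fraction field of [Pol] there is a representation in which a reduced word of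
    [w] moves the indicator of the identity to [w] with nonzero coefficient. Hence
    [e(nut) R e(nu)] is free over [Pol] on the words of the permutations [w] with
    [w.nu = nut].

    The heart of the matter is that the cyclotomic ideal meets this corner exactly
    in the combinations whose coefficients lie in the ideal [(g_1, ..., g_n)] of
    [Pol] ([normal_in_ideal] and [cyclotomic_ideal_normal]). Both inclusions follow
    the recursion that defines the [g_k]. The word [nut] is sorted, and this is
    used as follows: if [nu] has a descent at [k], then every permutation with
    [w.nu = nut] has one there too, so that every element of [e(nut) R e(nu)] is a
    combination of elements that end with [tau_k e(nu)] ([corner_crossing]). This
    is what makes the recursion for [g] free of the factor [Q] at descents.
    Moreover, the elements [a(x_1) tau_1 ... tau_(k-1)] generate the cyclotomic
    ideal as a left ideal, because the letters [tau_j] with [j > 1] commute with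
    its generator; moving the polynomial to the right past [tau_j] turns
    one stage of the recursion into the next.

    Finally, [g_k] involves only [x_1, ..., x_k], and its leading coefficient with
    respect to [x_k] is a unit, unless an earlier [g_j] is itself a unit
    ([g_poly_lead]). Dividing successively by [g_n, ..., g_1] shows that the
    monomials with [a_k < N_k] form a basis of [Pol / (g_1, ..., g_n)]
    ([triangular_reduce] and [triangular_unique]). *)

(** * Permutations and reduced words *)

Section Permutations.
Variable n : nat.
Implicit Types (k i j : 'I_n) (w v : 'S_n.+1) (js : seq 'I_n).

Local Notation s_ k := (simple_transp n k).
Local Notation str k := (inord k : 'I_n.+1).

Lemma str_val k : str k = k :> nat.
Proof. by rewrite inordK // ltnW // ltnS. Qed.

Lemma strS_val k : str k.+1 = k.+1 :> nat.
Proof. by rewrite inordK // ltnS. Qed.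

Lemma str_neqS k : str k != str k.+1.
Proof. by rewrite -val_eqE /= str_val strS_val; lia. Qed.

Lemma transp_val k (a : 'I_n.+1) :
  s_ k a = (if a == k :> nat then k.+1 else if a == k.+1 :> nat then (k : nat)
            else a) :> nat.
Proof.
rewrite /simple_transp; case: tpermP => [->|->|/eqP + /eqP +].
- by rewrite str_val eqxx strS_val.
- by rewrite strS_val eqxx str_val; case: eqP => //; lia.
- by rewrite -!val_eqE /= str_val strS_val => /negbTE-> /negbTE->.
Qed.

Lemma transp_cases k (a : 'I_n.+1) :
  a = k :> nat /\ s_ k a = k.+1 :> nat \/
  a = k.+1 :> nat /\ s_ k a = k :> nat \/
  a <> k :> nat /\ a <> k.+1 :> nat /\ s_ k a = a :> nat.
Proof.
rewrite transp_val; case: eqP => [->|?]; first by left.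
by right; case: eqP => [->|?]; [left | right].
Qed.

Lemma transpK k (a : 'I_n.+1) : s_ k (s_ k a) = a.
Proof. exact: tpermK. Qed.

Lemma transpV k : ((s_ k)^-1 = s_ k)%g.
Proof. exact: tpermV. Qed.

Lemma transpM k : (s_ k * s_ k = 1)%g.
Proof. exact: tperm2. Qed.

Lemma transpl k : s_ k (str k) = str k.+1.
Proof. exact: tpermL. Qed.

Lemma transpr k : s_ k (str k.+1) = str k.
Proof. exact: tpermR. Qed.

Lemma word_perm_nil : word_perm [::] = 1%g :> 'S_n.+1.
Proof. by rewrite /word_perm big_nil. Qed.

Lemma word_perm_cons j js : (word_perm (j :: js) = word_perm js * s_ j)%g.
Proof. by rewrite /word_perm rev_cons -cats1 big_cat big_seq1. Qed.

Lemma word_perm_rcons j js : (word_perm (rcons js j) = s_ j * word_perm js)%g.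
Proof. by rewrite /word_perm rev_rcons big_cons. Qed.

Definition inversions w : {set 'I_n.+1 * 'I_n.+1} :=
  [set p : 'I_n.+1 * 'I_n.+1 | (p.1 < p.2)%N && (w p.2 < w p.1)%N].

Definition inv_num w : nat := #|inversions w|.

Lemma inv_num1 : inv_num 1%g = 0%N.
Proof.
by apply/eqP; rewrite cards_eq0; apply/eqP/setP=> p; rewrite !inE !permE; lia.
Qed.

Lemma inv_numV w : inv_num w^-1%g = inv_num w.
Proof.
rewrite /inv_num.
have inj: injective (fun p : 'I_n.+1 * 'I_n.+1 => (w p.2, w p.1)).
  by move=> [a b] [c d] /= [/perm_inj-> /perm_inj->].
rewrite -[RHS](card_imset _ inj); apply/eq_card=> -[a b]; rewrite inE /=.
apply/andP/imsetP=> [[ab ba]|[[c d]]].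
  by exists (w^-1 b, w^-1 a)%g; rewrite ?inE /= !permKV ?ba.
by rewrite inE /= => /andP[cd dc] [-> ->]; rewrite !permK.
Qed.

(** The transposition of two neighbours permutes the other pairs without
    changing their order, so only the pair of the neighbours counts. *)
Lemma inv_num_transp k w :
  (inv_num (s_ k * w) + (w (str k.+1) < w (str k))%N =
   inv_num w + (w (str k) < w (str k.+1))%N)%N.
Proof.
pose p0 := (str k, str k.+1).
pose phi (p : 'I_n.+1 * 'I_n.+1) := (s_ k p.1, s_ k p.2).
have phiK : involutive phi by move=> [a b]; rewrite /phi /= !transpK.
have E : #|inversions (s_ k * w)%g :\ p0| = #|inversions w :\ p0|.
  rewrite -(card_imset _ (inv_inj phiK)).
  suff ->: phi @: (inversions (s_ k * w)%g :\ p0) = inversions w :\ p0 by [].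
  apply/setP=> p; rewrite -{1}[p]phiK mem_imset; last exact: inv_inj phiK.
  case: p => a b; rewrite !inE /= !permM !transpK -!pair_eqE /= -!val_eqE /=.
  rewrite !transp_val str_val strS_val.
  case: (w b < w a)%N; rewrite ?andbF // !andbT; move: (nat_of_ord a) (nat_of_ord b) => {}a {}b.
  case: (a =P (k : nat)) => ?; case: (a =P k.+1) => ?;
    case: (b =P (k : nat)) => ?; case: (b =P k.+1) => ?; lia.
have := cardsD1 p0 (inversions (s_ k * w)%g).
have := cardsD1 p0 (inversions w).
rewrite -/(inv_num _) -/(inv_num _) E !inE /= !permM transpl transpr.
by rewrite str_val strS_val ltnSn /= => -> ->; rewrite addnC [X in (_ + X)%N]addnC addnA.
Qed.

Lemma perm_lt_or w (a b : 'I_n.+1) : a != b -> (w a < w b)%N || (w b < w a)%N.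
Proof.
move=> ab; case: (ssrnat.ltngtP (w a) (w b)) => //= /val_inj/perm_inj/eqP.
by rewrite (negbTE ab).
Qed.

Lemma inv_num_lower k w :
  (w (str k.+1) < w (str k))%N -> inv_num w = (inv_num (s_ k * w)%g).+1.
Proof. by move=> h; have := inv_num_transp k w; lia. Qed.

Lemma inv_num_raise k w :
  (w (str k) < w (str k.+1))%N -> inv_num (s_ k * w)%g = (inv_num w).+1.
Proof. by move=> h; have := inv_num_transp k w; lia. Qed.

Lemma inv_num_transp_le k w : (inv_num (s_ k * w)%g <= (inv_num w).+1)%N.
Proof. by have := inv_num_transp k w; lia. Qed.

Lemma inv_numL_eq k w : inv_num (w * s_ k)%g = inv_num (s_ k * w^-1)%g.
Proof. by rewrite -inv_numV invMg transpV. Qed.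

Lemma inv_numL_lower k w : (w^-1%g (str k.+1) < w^-1%g (str k))%N ->
  inv_num w = (inv_num (w * s_ k)%g).+1.
Proof. by rewrite inv_numL_eq -(inv_numV w); exact: inv_num_lower. Qed.

Lemma inv_numL_raise k w : (w^-1%g (str k) < w^-1%g (str k.+1))%N ->
  inv_num (w * s_ k)%g = (inv_num w).+1.
Proof. by rewrite inv_numL_eq -(inv_numV w); exact: inv_num_raise. Qed.

Lemma inv_numL_cases k w :
  ((w^-1%g (str k) < w^-1%g (str k.+1))%N /\ inv_num (w * s_ k)%g = (inv_num w).+1) \/
  ((w^-1%g (str k.+1) < w^-1%g (str k))%N /\ inv_num w = (inv_num (w * s_ k)%g).+1).
Proof.
have [h|h] := orP (perm_lt_or w^-1%g (str_neqS k)).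
  by left; split=> //; exact: inv_numL_raise.
by right; split=> //; exact: inv_numL_lower.
Qed.

Lemma inv_num_word js : (inv_num (word_perm js) <= size js)%N.
Proof.
elim: js => [|j js IH]; first by rewrite word_perm_nil inv_num1.
rewrite word_perm_cons inv_numL_eq /=; apply: leq_trans (inv_num_transp_le _ _) _.
by rewrite inv_numV.
Qed.

(** An increasing [w] satisfies [a <= w a] for all [a], and summing over [a]
    forces equality. *)
Lemma no_descent w :
  (forall k, (w (str k) < w (str k.+1))%N) -> w = 1%g.
Proof.
move=> up.
have le_w (a : 'I_n.+1) : (a <= w a)%N.
  case: a => a; elim: a => [|a IH] lt_a //=.
  have lta : (a < n)%N by [].
  have := up (Ordinal lta); rewrite /=.
  have -> : str a = Ordinal (ltnW lt_a) by apply/val_inj; rewrite /= inordK // ltnW.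
  have -> : str a.+1 = Ordinal lt_a by apply/val_inj; rewrite /= inordK.
  by apply: leq_ltn_trans; exact: IH.
apply/permP=> a; rewrite perm1; apply/val_inj/eqP; rewrite eq_sym.
have /leqif_sum : forall b : 'I_n.+1, true -> (b <= w b ?= iff (b == w b :> nat))%N.
  by move=> b _; split.
case=> _; rewrite (reindex_inj (@perm_inj _ w)) /= eqxx => /esym/forall_inP.
exact.
Qed.

(** Removing a descent lowers the number of inversions, so every permutation is
    reached from the identity by inserting descents. *)
Lemma descent_ind (Pw : 'S_n.+1 -> Prop) :
  Pw 1%g ->
  (forall w, w != 1%g ->
     (forall k, (w (str k.+1) < w (str k))%N -> Pw (s_ k * w)%g) -> Pw w) ->
  forall w, Pw w.
Proof.
move=> P1 PS w; have [m le_m] := ubnP (inv_num w); elim: m w le_m => // m IH w.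
rewrite ltnS => le_m; have [->//|w1] := eqVneq w 1%g.
by apply: PS => // k /inv_num_lower E; apply: IH; rewrite -E.
Qed.

Lemma descent_exists w : w != 1%g ->
  exists k, (w (str k.+1) < w (str k))%N.
Proof.
move=> w1; apply/existsP; apply: contraT; rewrite negb_exists => /forallP h.
case/eqP: w1; apply: no_descent => k.
by have /orP[//|wk] := perm_lt_or w (str_neqS k); case/negP: (h k).
Qed.

Lemma transpMw k w : (s_ k * (s_ k * w) = w)%g.
Proof. by rewrite mulgA transpM mul1g. Qed.

Lemma transpMwr k w : (w * s_ k * s_ k = w)%g.
Proof. by rewrite -mulgA transpM mulg1. Qed.

Definition reduced js := size js = inv_num (word_perm js).

Lemma reduced_rcons w k js :
  (w (str k.+1) < w (str k))%N -> word_perm js = (s_ k * w)%g -> reduced js ->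
  word_perm (rcons js k) = w /\ reduced (rcons js k).
Proof.
rewrite /reduced => wk E; rewrite word_perm_rcons size_rcons E transpMw => ->.
by split=> //; rewrite -inv_num_lower.
Qed.

Lemma reduced_exists w : exists js, word_perm js = w /\ reduced js.
Proof.
elim/descent_ind: w => [|w w1 IH].
  by exists [::]; rewrite /reduced word_perm_nil inv_num1.
have [k wk] := descent_exists w1; have [js [Ejs rjs]] := IH k wk.
by exists (rcons js k); apply: reduced_rcons Ejs rjs.
Qed.

(** Minimal length is traded for a number that each letter changes by one. *)
Lemma reduced_expressionP w js :
  reduced_expression w js <-> word_perm js = w /\ reduced js.
Proof.
split=> [[E min]|[E r]]; last first.
  by split=> // js' E'; rewrite r E -E' inv_num_word.
split=> //; have [js' [E' r']] := reduced_exists w.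
apply/eqP; rewrite eqn_leq inv_num_word andbT E -E' -r'; exact: min.
Qed.

Lemma reduced_exists_last w k : (w (str k.+1) < w (str k))%N ->
  exists js, word_perm (rcons js k) = w /\ reduced (rcons js k).
Proof.
move=> wk; have [js [E r]] := reduced_exists (s_ k * w)%g.
by exists js; apply: reduced_rcons E r.
Qed.

Lemma reduced_tail j js : reduced (j :: js) -> reduced js.
Proof.
rewrite /reduced /= word_perm_cons => r; apply/eqP; rewrite eqn_leq inv_num_word andbT.
by have := inv_num_transp_le j (word_perm js)^-1%g; rewrite -inv_numL_eq -r inv_numV.
Qed.

Lemma reduced_consP w j js : word_perm js = (w * s_ j)%g -> reduced js ->
  (w^-1%g (str j.+1) < w^-1%g (str j))%N ->
  word_perm (j :: js) = w /\ reduced (j :: js).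
Proof.
rewrite /reduced word_perm_cons => -> /= -> /inv_numL_lower E.
by rewrite transpMwr; split=> //; rewrite E.
Qed.

Lemma reduced_head j js (w := word_perm (j :: js)) : reduced (j :: js) ->
  (w^-1%g (str j.+1) < w^-1%g (str j))%N.
Proof.
move=> r; have := reduced_tail r; rewrite /reduced => rt.
have [[_ E]|[]//] := inv_numL_cases j w.
move: E r; rewrite /reduced /w word_perm_cons transpMwr /= -rt => E.
by rewrite E => h; exfalso; lia.
Qed.

Lemma not_reduced_cons j js (w := word_perm js) :
  reduced js -> ~ reduced (j :: js) ->
  (w^-1%g (str j.+1) < w^-1%g (str j))%N.
Proof.
rewrite /reduced /= word_perm_cons -/w => r nr.
by have [[_ E]|[]//] := inv_numL_cases j w; case: nr; rewrite r E.
Qed.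

Lemma transp_far (i j : 'I_n) : (i.+1 < j)%N \/ (j.+1 < i)%N ->
  s_ i (str j) = str j /\ s_ i (str j.+1) = str j.+1.
Proof.
move=> ij; split; apply/val_inj => /=.
  by have := transp_cases i (str j); rewrite str_val; lia.
by have := transp_cases i (str j.+1); rewrite strS_val; lia.
Qed.

Lemma transp_comm (i j : 'I_n) : (i.+1 < j)%N \/ (j.+1 < i)%N ->
  (s_ i * s_ j = s_ j * s_ i)%g.
Proof.
move=> ij; apply/permP=> a; rewrite !permM; apply/val_inj => /=.
have := transp_cases i a; have := transp_cases j a.
have := transp_cases i (s_ j a); have := transp_cases j (s_ i a).
lia.
Qed.

Lemma transp_braid (k l : 'I_n) : l = k.+1 :> nat ->
  (s_ k * s_ l * s_ k = s_ l * s_ k * s_ l)%g.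
Proof.
move=> kl; apply/permP=> a; rewrite !permM; apply/val_inj => /=.
have := transp_cases k a; have := transp_cases l a.
have := transp_cases k (s_ l a); have := transp_cases l (s_ k a).
have := transp_cases l (s_ k (s_ l a)); have := transp_cases k (s_ l (s_ k a)).
lia.
Qed.

Lemma strS_next (k l : 'I_n) : l = k.+1 :> nat -> str l = str k.+1.
Proof. by move=> ->. Qed.

Lemma transp_next1 (k l : 'I_n) : l = k.+1 :> nat -> s_ k (str l.+1) = str l.+1.
Proof.
move=> kl; apply/val_inj => /=.
by have := transp_cases k (str l.+1); rewrite strS_val; lia.
Qed.

Lemma transp_next2 (k l : 'I_n) : l = k.+1 :> nat -> s_ l (str k) = str k.
Proof.
move=> kl; apply/val_inj => /=.
by have := transp_cases l (str k); rewrite str_val; lia.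
Qed.

(** Two distinct descents of a permutation remain descents until the relation
    between the two transpositions is used up; this lemma and the next are the
    two cases of Matsumoto's theorem. *)
Lemma reduced_far i j w : (i.+1 < j)%N \/ (j.+1 < i)%N ->
  (w^-1%g (str i.+1) < w^-1%g (str i))%N -> (w^-1%g (str j.+1) < w^-1%g (str j))%N ->
  exists js, [/\ word_perm (i :: j :: js) = w, reduced (i :: j :: js),
                word_perm (j :: i :: js) = w & reduced (j :: i :: js)].
Proof.
move=> ij wi wj; have [js [E r]] := reduced_exists (w * s_ i * s_ j)%g.
have ji : (j.+1 < i)%N \/ (i.+1 < j)%N by case: ij; [right|left].
have [Ej rj] : word_perm (j :: js) = (w * s_ i)%g /\ reduced (j :: js).
  apply: reduced_consP => //; rewrite invMg transpV !permM.
  by have [-> ->] := transp_far ij.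
have [Ei ri] : word_perm (i :: js) = (w * s_ j)%g /\ reduced (i :: js).
  apply: reduced_consP => //; first by rewrite E -!mulgA transp_comm.
  rewrite invMg transpV !permM.
  by have [-> ->] := transp_far ji.
have [? ?] := reduced_consP Ej rj wi.
have [? ?] := reduced_consP Ei ri wj.
by exists js.
Qed.

Lemma reduced_braid (k l : 'I_n) w : l = k.+1 :> nat ->
  (w^-1%g (str k.+1) < w^-1%g (str k))%N -> (w^-1%g (str l.+1) < w^-1%g (str l))%N ->
  exists js, [/\ word_perm [:: k, l, k & js] = w, reduced [:: k, l, k & js],
                word_perm [:: l, k, l & js] = w & reduced [:: l, k, l & js]].
Proof.
move=> kl wk wl; have [js [E r]] := reduced_exists (w * s_ k * s_ l * s_ k)%g.
have E' : word_perm js = (w * s_ l * s_ k * s_ l)%g.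
  rewrite E -!mulgA; congr (w * _)%g; rewrite !mulgA; exact: transp_braid.
have lk := ltn_trans wl; rewrite (strS_next kl) in lk; have {}lk := lk _ wk.
have [E1 r1] : word_perm (k :: js) = (w * s_ k * s_ l)%g /\ reduced (k :: js).
  apply: reduced_consP => //; rewrite !invMg !transpV !permM.
  rewrite transp_next2 // -(strS_next kl) transpl transpl transp_next1 //.
  by move: wl; rewrite (strS_next kl).
have [E2 r2] : word_perm (l :: js) = (w * s_ l * s_ k)%g /\ reduced (l :: js).
  apply: reduced_consP => //; rewrite !invMg !transpV !permM.
  by rewrite transp_next1 // transpr (strS_next kl) transpr transp_next2.
have [E3 r3] : word_perm (l :: k :: js) = (w * s_ k)%g /\ reduced (l :: k :: js).
  apply: reduced_consP => //; rewrite !invMg !transpV !permM.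
  by rewrite transp_next1 // (strS_next kl) transpr.
have [E4 r4] : word_perm (k :: l :: js) = (w * s_ l)%g /\ reduced (k :: l :: js).
  apply: reduced_consP => //; rewrite !invMg !transpV !permM.
  by rewrite transp_next2 // -(strS_next kl) transpl.
have [? ?] := reduced_consP E3 r3 wk.
have [? ?] := reduced_consP E4 r4 wl.
by exists js.
Qed.

(** The word [0, ..., k-1], whose permutation brings strand [k] to the front: these
    represent the cosets of the stabiliser of strand [0]. *)
Definition first_letters (k : nat) : seq 'I_n := take k (enum 'I_n).

Lemma first_lettersS k : first_letters k.+1 = rcons (first_letters k) k.
Proof.
by rewrite /first_letters (take_nth k) ?size_enum_ord // nth_ord_enum.
Qed.

(** A descent that moves strand [w^-1 0] towards the front is removed as long as
    there is one; afterwards the first position belongs to no descent. *)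
Lemma reduced_coset w : exists js,
  [/\ forall j, j \in js -> (0 < j)%N,
     word_perm (js ++ first_letters (w^-1%g ord0)) = w
   & reduced (js ++ first_letters (w^-1%g ord0))].
Proof.
elim/descent_ind: w => [|w w1 IH].
  by exists [::]; rewrite invg1 perm1 /first_letters take0 /reduced word_perm_nil inv_num1.
case E : (nat_of_ord (w^-1%g ord0)) => [|k].
  have w0 : w ord0 = ord0.
    by rewrite -[LHS](congr1 w (_ : w^-1%g ord0 = ord0)) ?permKV //; apply/val_inj.
  have w0' : w^-1%g ord0 = ord0 by apply/val_inj.
  have [k wk] := descent_exists w1; have [js [jsP E' r]] := IH k wk.
  have k0 : (0 < k)%N.
    rewrite lt0n; apply/eqP=> k0; move: wk.
    suff -> : str k = ord0 by rewrite w0.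
    by apply/val_inj; rewrite /= str_val.
  have sk0 : s_ k ord0 = ord0.
    by apply/val_inj => /=; have /= := transp_cases k ord0; lia.
  rewrite invMg permM transpV w0' sk0 /first_letters take0 cats0 in E' r.
  exists (rcons js k); rewrite /first_letters take0 cats0.
  have [Er rr] := reduced_rcons wk E' r; split=> // j.
  by rewrite mem_rcons inE => /orP[/eqP->|/jsP].
have lek : (k < n)%N by rewrite -ltnS -E.
pose k' := Ordinal lek.
have E0 : w^-1%g ord0 = str k'.+1 by apply/val_inj; rewrite /= E (strS_val k').
have wk : (w (str k'.+1) < w (str k'))%N.
  rewrite -E0 permKV lt0n; apply/eqP=> w0.
  have /(congr1 (w^-1%g)) : w (str k') = ord0 by apply/val_inj.
  by rewrite permK E0 => /eqP; rewrite (negbTE (str_neqS _)).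
have [js [jsP E' r]] := IH k' wk.
rewrite invMg permM transpV E0 transpr str_val in E' r.
exists js; split=> //; rewrite (first_lettersS k') -rcons_cat;
  by have [] := reduced_rcons wk E' r.
Qed.

End Permutations.

(** * Spans, evaluation of polynomials and relations *)

Section AdditiveSpan.
Variable V : zmodType.

Inductive addspan (G : V -> Prop) : V -> Prop :=
| Span0 : addspan G 0
| SpanD x y : addspan G x -> addspan G y -> addspan G (x + y)
| SpanG x : G x -> addspan G x.

Variable G : V -> Prop.

Lemma addspan_sum (J : Type) (r : seq J) (Pr : pred J) (F : J -> V) :
  (forall j, Pr j -> addspan G (F j)) -> addspan G (\sum_(j <- r | Pr j) F j).
Proof.
by move=> GF; elim/big_ind: _ => //; [exact: Span0 | move=> x y; exact: SpanD].
Qed.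

Lemma addspan_sub (H : V -> Prop) x :
  (forall y, G y -> addspan H y) -> addspan G x -> addspan H x.
Proof.
by move=> GH; elim=> [|y z _ Hy _ Hz|y /GH//]; [exact: Span0 | exact: SpanD].
Qed.

Lemma addspanN x : (forall y, G y -> G (- y)) -> addspan G x -> addspan G (- x).
Proof.
move=> GN; elim=> [|y z _ Hy _ Hz|y /GN]; rewrite ?oppr0 ?opprD.
- exact: Span0.
- exact: SpanD.
- exact: SpanG.
Qed.

End AdditiveSpan.

Lemma addspan_mull (K : comNzRingType) (A : algebra K) (G H : A -> Prop) (a z : A) :
  (forall y, G y -> addspan H (a * y)) -> addspan G z -> addspan H (a * z).
Proof.
move=> GH; elim=> [|y y' _ Hy _ Hy'|y /GH//]; rewrite ?mulr0 ?mulrDr.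
- exact: Span0.
- exact: SpanD.
Qed.

Lemma addspan_mulr (K : comNzRingType) (A : algebra K) (G H : A -> Prop) (a z : A) :
  (forall y, G y -> addspan H (y * a)) -> addspan G z -> addspan H (z * a).
Proof.
move=> GH; elim=> [|y y' _ Hy _ Hy'|y /GH//]; rewrite ?mul0r ?mulrDl.
- exact: Span0.
- exact: SpanD.
Qed.

Lemma mpoly_gen_ind (K : comNzRingType) n (Pf : {mpoly K[n]} -> Prop) :
  (forall c, Pf c%:MP) -> (forall i, Pf 'X_i) ->
  (forall f g, Pf f -> Pf g -> Pf (f + g)) ->
  (forall f g, Pf f -> Pf g -> Pf (f * g)) -> forall f, Pf f.
Proof.
move=> PC PX PD PM f; rewrite (mpolyE f).
elim/big_ind: _ => [||m _]; first by rewrite -mpolyC0; exact: PC.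
  by move=> x y; exact: PD.
rewrite -mul_mpolyC; apply: (PM _ _ (PC _)); rewrite mpolyXE_id.
elim/big_ind: _ => [||i _]; first by rewrite -mpolyC1; exact: PC.
  by move=> x y; exact: PM.
elim: (m i) => [|d IH]; first by rewrite expr0 -mpolyC1; exact: PC.
by rewrite exprS; exact: PM.
Qed.

Section AlgebraScale.
Variables (K : comNzRingType) (A : algebra K).
Implicit Types (c : K) (x y : A).

Lemma algebra_scaleAl c x y : c *: (x * y) = c *: x * y.
Proof. by rewrite !algebra_scaleE mulrA. Qed.

Lemma algebra_scaleAr c x y : c *: (x * y) = x * (c *: y).
Proof. by rewrite !algebra_scaleE mulrA algebra_mapC mulrA. Qed.
End AlgebraScale.

Section MpolyEval.
Variables (K : idomainType) (n : nat) (A : algebra K) (x : 'I_n -> A).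
Hypothesis xC : forall i j, x i * x j = x j * x i.
Implicit Types (f g : {mpoly K[n]}) (m : 'X_{1..n}).

Let xm m : A := \prod_(i < n) x i ^+ m i.

Lemma mpoly_evalwE d f : (msize f <= d)%N ->
  mpoly_eval x f = \sum_(m : 'X_{1..n < d}) f@_m *: xm m.
Proof.
move=> le_fd; rewrite /mpoly_eval (big_mksub 'X_{1..n < d}) ?msupp_uniq //=; last first.
  by move=> m /msize_mdeg_lt /leq_trans; apply.
by rewrite big_rmcond //= => j /memN_msupp_eq0 ->; rewrite scale0r.
Qed.

Lemma mpoly_evalD f g : mpoly_eval x (f + g) = mpoly_eval x f + mpoly_eval x g.
Proof.
pose d := maxn (maxn (msize f) (msize g)) (msize (f + g)).
rewrite !(@mpoly_evalwE d) ?leq_max ?leqnn ?orbT // -big_split /=.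
by apply: eq_bigr => m _; rewrite mcoeffD scalerDl.
Qed.

Lemma mpoly_evalZ c f : mpoly_eval x (c *: f) = c *: mpoly_eval x f.
Proof.
pose d := maxn (msize f) (msize (c *: f)).
rewrite !(@mpoly_evalwE d) ?leq_max ?leqnn ?orbT // scaler_sumr.
by apply: eq_bigr => m _; rewrite mcoeffZ scalerA.
Qed.

Lemma mpoly_eval0 : mpoly_eval x 0 = 0.
Proof. by rewrite -(scale0r 0) mpoly_evalZ scale0r. Qed.

Lemma mpoly_evalN f : mpoly_eval x (- f) = - mpoly_eval x f.
Proof. by rewrite -scaleN1r mpoly_evalZ scaleN1r. Qed.

Lemma mpoly_evalB f g : mpoly_eval x (f - g) = mpoly_eval x f - mpoly_eval x g.
Proof. by rewrite mpoly_evalD mpoly_evalN. Qed.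

Lemma mpoly_eval_sum (J : Type) (r : seq J) (Pr : pred J) F :
  mpoly_eval x (\sum_(j <- r | Pr j) F j) = \sum_(j <- r | Pr j) mpoly_eval x (F j).
Proof. exact: (big_morph _ mpoly_evalD mpoly_eval0). Qed.

Lemma mpoly_evalXm m : mpoly_eval x 'X_[m] = xm m.
Proof. by rewrite /mpoly_eval msuppX big_seq1 mcoeffX eqxx scale1r. Qed.

Lemma mpoly_evalXmD m m' : xm (m + m')%MM = xm m * xm m'.
Proof.
rewrite {1 3}/xm.
suff H (r : seq 'I_n) : \prod_(i <- r) x i ^+ (m + m')%MM i =
    (\prod_(i <- r) x i ^+ m i) * \prod_(i <- r) x i ^+ m' i by exact: H.
have C (s : seq 'I_n) i k : x i ^+ k * (\prod_(j <- s) x j ^+ m j) =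
    (\prod_(j <- s) x j ^+ m j) * x i ^+ k.
  elim/big_rec: _ => [|j y _ IH]; first by rewrite mulr1 mul1r.
  have -> : x i ^+ k * (x j ^+ m j * y) = x j ^+ m j * (x i ^+ k * y).
    rewrite !mulrA; congr (_ * _).
    by apply: commrX; apply: commr_sym; apply: commrX; exact: xC.
  by rewrite IH mulrA.
elim: r => [|i r IH]; first by rewrite !big_nil mulr1.
rewrite !big_cons IH mnmDE exprD -!mulrA; congr (_ * _).
by rewrite mulrA C -mulrA.
Qed.

Lemma mpoly_evalM f g : mpoly_eval x (f * g) = mpoly_eval x f * mpoly_eval x g.
Proof.
rewrite {1}(mpolyE f) mulr_suml mpoly_eval_sum {2}/mpoly_eval mulr_suml.
apply: eq_bigr => m _; rewrite -scalerAl mpoly_evalZ -algebra_scaleAl.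
congr (_ *: _); rewrite {1}(mpolyE g) mulr_sumr mpoly_eval_sum {2}/mpoly_eval mulr_sumr.
apply: eq_bigr => m' _; rewrite -scalerAr mpoly_evalZ -algebra_scaleAr.
by rewrite -mpolyXD mpoly_evalXm mpoly_evalXmD.
Qed.

Lemma mpoly_eval1 : mpoly_eval x 1 = 1.
Proof.
rewrite -mpolyX0 mpoly_evalXm /xm big1 // => i _.
by rewrite mnm0E expr0.
Qed.

Lemma mpoly_evalC c : mpoly_eval x c%:MP = c *: (1 : A).
Proof. by rewrite -[c%:MP]mulr1 mul_mpolyC mpoly_evalZ mpoly_eval1. Qed.

Lemma mpoly_evalX i : mpoly_eval x 'X_i = x i.
Proof.
rewrite mpoly_evalXm /xm -[RHS](big_pred1_eq *%R i) [RHS]big_mkcond /=.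
apply: eq_bigr => j _; rewrite mnm1E eq_sym.
by case: eqP => [->|_]; rewrite ?expr1 ?expr0.
Qed.

Lemma mpoly_eval_comm f g :
  mpoly_eval x f * mpoly_eval x g = mpoly_eval x g * mpoly_eval x f.
Proof. by rewrite -!mpoly_evalM mulrC. Qed.
End MpolyEval.

Section Transport.
Variables (K : idomainType) (A B : algebra K) (h : {rmorphism A -> B}).
Hypothesis hZ : forall (c : K) x, h (c *: x) = c *: h x.

Lemma mpoly_eval_map n (x : 'I_n -> A) f :
  h (mpoly_eval x f) = mpoly_eval (h \o x) f.
Proof.
rewrite /mpoly_eval raddf_sum; apply: eq_bigr => m _ /=.
by rewrite hZ rmorph_prod; congr (_ *: _); apply: eq_bigr => i _; rewrite rmorphXn.
Qed.

(** This is why elements that satisfy the relations in some algebra receive a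
    morphism from the presented algebra. *)
Lemma klr_relation_map (I : finType) (P : zmodType) (C : cartan_datum I P)
    (gr : grading K) (Q : klr_parameters C gr) n beta
    (e : weight_word C n.+1 beta -> A) (x : 'I_n.+1 -> A) (tau : 'I_n -> A) a b :
  klr_relation Q e x tau a b ->
  klr_relation Q (h \o e) (h \o x) (h \o tau) (h a) (h b).
Proof.
pose e' := h \o e; pose x' := h \o x; pose tau' := h \o tau.
case=> [nu nu'||k l|k nu|l nu|k l kl|k nu|k l nu|k l nu kl].
- by rewrite rmorphM (fun_if h) rmorph0; exact: (KLR_ee Q e' x' tau').
- by rewrite rmorph_sum rmorph1; exact: (KLR_sum_e Q e' x' tau').
- by rewrite !rmorphM; exact: (KLR_xx Q e' x' tau').
- by rewrite !rmorphM; exact: (KLR_xe Q e' x' tau').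
- by rewrite !rmorphM; exact: (KLR_te Q e' x' tau').
- by rewrite !rmorphM; exact: (KLR_tt Q e' x' tau' kl).
- by rewrite !rmorphM mpoly_eval_map; exact: (KLR_t2 Q e' x' tau').
- rewrite !(fun_if h) rmorphN rmorph0 rmorphM rmorphB !rmorphM.
  exact: (KLR_tx Q e' x' tau').
- rewrite !(fun_if h) rmorph0 !rmorphM mpoly_eval_map rmorphB !rmorphM.
  exact: (KLR_braid Q e' x' tau' nu kl).
Qed.

(** With the projection of the free algebra for [h], this gives the relations of
    the presented algebra. *)
Lemma klr_relation_push (I : finType) (P : zmodType) (C : cartan_datum I P)
    (gr : grading K) (Q : klr_parameters C gr) n beta
    (e : weight_word C n.+1 beta -> A) (x : 'I_n.+1 -> A) (tau : 'I_n -> A) :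
  (forall a b, klr_relation Q e x tau a b -> h a = h b) ->
  forall a b, klr_relation Q (h \o e) (h \o x) (h \o tau) a b -> a = b.
Proof.
move=> rel _ _ [nu nu'||k l|k nu|l nu|k l kl|k nu|k l nu|k l nu kl] /=.
- by have := rel _ _ (KLR_ee Q e x tau nu nu'); rewrite rmorphM (fun_if h) rmorph0.
- by have := rel _ _ (KLR_sum_e Q e x tau); rewrite rmorph_sum rmorph1.
- by have := rel _ _ (KLR_xx Q e x tau k l); rewrite !rmorphM.
- by have := rel _ _ (KLR_xe Q e x tau k nu); rewrite !rmorphM.
- by have := rel _ _ (KLR_te Q e x tau l nu); rewrite !rmorphM.
- by have := rel _ _ (KLR_tt Q e x tau kl); rewrite !rmorphM.
- by have := rel _ _ (KLR_t2 Q e x tau k nu); rewrite !rmorphM mpoly_eval_map.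
- have := rel _ _ (KLR_tx Q e x tau k l nu).
  by rewrite !(fun_if h) rmorphN rmorph0 rmorphM rmorphB !rmorphM.
- have := rel _ _ (KLR_braid Q e x tau nu kl).
  by rewrite !(fun_if h) rmorph0 !rmorphM mpoly_eval_map rmorphB !rmorphM.
Qed.
End Transport.

(** * The presented algebra *)

Section FreeAlgebraMorphism.
Variables (K : comNzRingType) (G : choiceType).
Import monalg finmap.

Lemma free_algebra_ind (Pz : free_algebra K G -> Prop) :
  Pz 0 -> Pz 1 -> (forall y z, Pz y -> Pz z -> Pz (y + z)) ->
  (forall c z, Pz z -> Pz (c *: z)) ->
  (forall g z, Pz z -> Pz (free_gen K g * z)) -> forall z, Pz z.
Proof.
move=> P0 P1 PD PZ PG z.
rewrite [z](monalgE (z : {malg K[{fmonom G}]})).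
elim/big_ind: _ => // w _.
have -> : << monalg.mcoeff w (z : {malg K[_]}) *g w >> = monalg.mcoeff w (z : {malg K[_]}) *: (<< w >> : free_algebra K G).
  by rewrite algebra_scaleE /= malgM_def fgmulUU mul1m mulr1.
apply: PZ; case: w => s; elim: s => [|g s IH].
  by rewrite -fmoneE.
have -> : << FMonom (g :: s) >> = free_gen K g * (<< FMonom s >> : free_algebra K G).
  by rewrite /free_gen malgM_def fgmulUU mulr1; congr << _ *g _ >>; apply/eqP; rewrite fmP fmM fmU.
exact: PG.
Qed.

Variables (B : algebra K) (b : G -> B).

Definition free_map (z : free_algebra K G) : B :=
  \sum_(w <- msupp (z : {malg K[{fmonom G}]}))
     monalg.mcoeff w (z : {malg K[{fmonom G}]}) *: \prod_(g <- (w : seq G)) b g.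

Lemma free_mapwE (d : {fset {fmonom G}}) (z : {malg K[{fmonom G}]}) :
  fsubset (msupp z) d ->
  free_map z = \sum_(w <- d) monalg.mcoeff w z *: \prod_(g <- (w : seq G)) b g.
Proof.
move=> le; rewrite /free_map [LHS](big_fset_incl _ le) => //= w _ /mcoeff_outdom ->.
by rewrite scale0r.
Qed.

Fact free_map_zmod : zmod_morphism free_map.
Proof.
move=> y z; pose d := fsetU (msupp (y : {malg K[{fmonom G}]}))
  (fsetU (msupp (z : {malg K[{fmonom G}]})) (msupp (y - z : {malg K[{fmonom G}]}))).
rewrite !(@free_mapwE d) ?fsubsetUl //; last 2 first.
- by apply/fsubsetP=> w; rewrite !inE => ->; rewrite orbT.
- by apply/fsubsetP=> w; rewrite !inE => ->; rewrite !orbT.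
by rewrite -sumrB; apply: eq_bigr => w _; rewrite mcoeffB scalerBl.
Qed.
HB.instance Definition _ :=
  GRing.isZmodMorphism.Build (free_algebra K G) B free_map free_map_zmod.

Lemma free_mapU c (w : {fmonom G}) :
  free_map << c *g w >> = c *: \prod_(g <- (w : seq G)) b g.
Proof. by rewrite (free_mapwE msuppU_le) big_seq_fset1 mcoeffUU. Qed.

Fact free_map_monoid : monoid_morphism free_map.
Proof.
split=> [|y z].
  by have := free_mapU 1 (mone : {fmonom G}); rewrite fm1 big_nil scale1r.
rewrite [y * z](malgME (y : {malg K[{fmonom G}]}) (z : {malg K[{fmonom G}]})).
rewrite raddf_sum /free_map mulr_suml /=; apply: eq_bigr => v _.
rewrite raddf_sum mulr_sumr /=; apply: eq_bigr => w _.
by rewrite free_mapU fmM big_cat /= -algebra_scaleAl -algebra_scaleAr scalerA.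
Qed.
HB.instance Definition _ :=
  GRing.isMonoidMorphism.Build (free_algebra K G) B free_map free_map_monoid.

Lemma free_mapC c : free_map (malgC c) = algebra_map B c.
Proof. by rewrite free_mapU fm1 big_nil algebra_scaleE mulr1. Qed.

Lemma free_mapZ c z : free_map (c *: z) = c *: free_map z.
Proof. by rewrite !algebra_scaleE rmorphM; congr (_ * _); exact: free_mapC. Qed.

Lemma free_map_gen g : free_map (free_gen K g) = b g.
Proof. by rewrite free_mapU scale1r fmU big_seq1. Qed.
End FreeAlgebraMorphism.

Section QuotientMorphism.
Variables (K : comNzRingType) (A B : algebra K) (S : A -> Prop).

Lemma quot_pi_surj_gen (u : quotient_algebra S) : exists x : A, canonical_image S x = u.
Proof. exact: quot_pi_surj. Qed.

Lemma canonical_imageZ c (x : A) :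
  canonical_image S (c *: x) = c *: canonical_image S x.
Proof. by rewrite !algebra_scaleE /canonical_image rmorphM. Qed.

Lemma ideal_kernel (h : {rmorphism A -> B}) :
  (forall s, S s -> h s = 0) -> forall z, two_sided_ideal S z -> h z = 0.
Proof.
move=> hS z; elim=> [|x y _ hx _ hy|a s b /hS hs]; first exact: rmorph0.
  by rewrite rmorphD hx hy addr0.
by rewrite !rmorphM hs mulr0 mul0r.
Qed.
End QuotientMorphism.

(** Generation, phrased as the induction principle that it is used for. *)
Definition klr_generated (K : comNzRingType) (A : algebra K) (J1 J2 J3 : Type)
    (e : J1 -> A) (x : J2 -> A) (tau : J3 -> A) : Prop :=
  forall Pz : A -> Prop,
  Pz 0 -> Pz 1 -> (forall y z, Pz y -> Pz z -> Pz (y + z)) ->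
  (forall c z, Pz z -> Pz (c *: z)) ->
  (forall nu z, Pz z -> Pz (e nu * z)) -> (forall k z, Pz z -> Pz (x k * z)) ->
  (forall l z, Pz z -> Pz (tau l * z)) -> forall z, Pz z.

Section KLRPresentation.
Variables (I : finType) (P : zmodType) (C : cartan_datum I P).
Variables (K : idomainType) (gr : grading K) (Q : klr_parameters C gr).
Variables (n : nat) (beta : P).
Local Notation R := (klr_algebra Q n beta).
Local Notation pi := (@quot_pi (free_algebra K (klr_generator C n beta))
  (fun z => exists x y, klr_free_relation Q x y /\ z = x - y)).


Local Notation e := (@klr_e _ _ _ _ _ Q n beta).
Local Notation x := (@klr_x _ _ _ _ _ Q n beta).
Local Notation tau := (@klr_tau _ _ _ _ _ Q n beta).
Local Notation Ibeta := (weight_word C n.+1 beta).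
Local Notation s_ k := (simple_transp n k).
Local Notation str k := (inord k : 'I_n.+1).
Implicit Types (nu : Ibeta).

Lemma klr_pi_eq a b : klr_free_relation Q a b -> pi a = pi b.
Proof.
move=> ab; apply/quot_pi_eq; rewrite -[_ - _]mulr1 -[_ - _]mul1r.
by apply: IdealM; exists a, b.
Qed.

Let piZ (c : K) z : pi (c *: z) = c *: (pi z : R).
Proof. exact: canonical_imageZ. Qed.

Lemma klr_relationE a b : klr_relation Q e x tau a b -> a = b.
Proof.
pose h : {rmorphism free_algebra K (klr_generator C n beta) -> R} := pi.
exact: (@klr_relation_push _ _ _ h piZ _ _ _ _ Q n beta _ _ _ klr_pi_eq).
Qed.

Lemma klr_algebra_generated : klr_generated e x tau.
Proof.
move=> Pz P0 P1 PD PZ Pe Px Pt z; have [y <-] := quot_pi_surj z.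
elim/free_algebra_ind: y => [||y1 y2|c y|g y].
- by rewrite rmorph0.
- by rewrite rmorph1.
- by rewrite rmorphD; exact: PD.
- by rewrite piZ; exact: PZ.
by rewrite rmorphM; case: g => [[nu|k]|l]; [exact: Pe|exact: Px|exact: Pt].
Qed.

Section Morphism.
Variables (B : algebra K) (E : Ibeta -> B) (X : 'I_n.+1 -> B) (T : 'I_n -> B).
Hypothesis rel : forall a b, klr_relation Q E X T a b -> a = b.

Let b (g : klr_generator C n beta) : B :=
  match g with inl (inl nu) => E nu | inl (inr k) => X k | inr l => T l end.

Lemma klr_morphism : exists h : {rmorphism R -> B},
  [/\ forall c z, h (c *: z) = c *: h z, forall nu, h (e nu) = E nu,
     forall k, h (x k) = X k & forall l, h (tau l) = T l].
Proof.
pose f := free_map b.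
have f_eq y z : pi y = pi z -> f y = f z.
  move/quot_pi_eq => Iyz; apply/eqP; rewrite -subr_eq0 -raddfB; apply/eqP.
  apply: (ideal_kernel _ Iyz) => _ [u [v [uv ->]]].
  rewrite raddfB; apply/eqP; rewrite subr_eq0; apply/eqP/rel.
  have := klr_relation_map (@free_mapZ _ _ _ b) uv; congr (klr_relation _ _ _ _ _ _).
  - by apply/funext => nu /=; rewrite free_map_gen.
  - by apply/funext => nu /=; rewrite free_map_gen.
  - by apply/funext => nu /=; rewrite free_map_gen.
pose h (z : R) := f (quot_repr z).
have hE z : h (pi z) = f z by apply: f_eq; rewrite quot_repr_pi.
have hB : zmod_morphism h.
  move=> u v; have [y <-] := quot_pi_surj u; have [z <-] := quot_pi_surj v.
  by rewrite -raddfB !hE /f raddfB.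
have hM : monoid_morphism h.
  split=> [|u v]; first by rewrite -(rmorph1 pi) hE /f rmorph1.
  have [y <-] := quot_pi_surj u; have [z <-] := quot_pi_surj v.
  by rewrite -rmorphM !hE /f rmorphM.
pose hz := GRing.isZmodMorphism.Build R B h hB.
pose hm := GRing.isMonoidMorphism.Build R B h hM.
pose hr : {rmorphism R -> B} := HB.pack h hz hm.
exists hr; split => [c u|nu|k|l].
- have [y <-] := quot_pi_surj u.
  by change (h (c *: (pi y : R)) = c *: h (pi y)); rewrite -piZ !hE /f free_mapZ.
- exact: etrans (hE (free_gen K _)) (free_map_gen b (inl (inl nu))).
- exact: etrans (hE (free_gen K _)) (free_map_gen b (inl (inr k))).
- exact: etrans (hE (free_gen K _)) (free_map_gen b (inr l)).
Qed.
End Morphism.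
End KLRPresentation.

(** * Division by a triangular family of polynomials *)

Section VariableDegree.
Variables (K : idomainType) (n : nat).
Implicit Types (f g h : {mpoly K[n]}) (m : 'X_{1..n}) (i j k : 'I_n) (N M d : nat).

Definition deg_lt i N f : Prop := forall m, m \in msupp f -> (m i < N)%N.

Lemma deg_lt_zero i N : deg_lt i N 0.
Proof. by move=> m; rewrite msupp0. Qed.

Lemma deg_lt_mono i N M f : (N <= M)%N -> deg_lt i N f -> deg_lt i M f.
Proof. by move=> le H m /H lt; exact: leq_trans lt le. Qed.

Lemma deg_ltD i N f g : deg_lt i N f -> deg_lt i N g -> deg_lt i N (f + g).
Proof. by move=> Hf Hg m /msuppD_le; rewrite mem_cat => /orP[/Hf|/Hg]. Qed.

Lemma deg_ltN i N f : deg_lt i N f -> deg_lt i N (- f).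
Proof. by move=> Hf m; rewrite (perm_mem (msuppN f)) => /Hf. Qed.

Lemma deg_ltB i N f g : deg_lt i N f -> deg_lt i N g -> deg_lt i N (f - g).
Proof. by move=> Hf Hg; apply: deg_ltD Hf (deg_ltN Hg). Qed.

Lemma deg_ltZ i N c f : deg_lt i N f -> deg_lt i N (c *: f).
Proof. by move=> Hf m /msuppZ_le/Hf. Qed.

Lemma deg_lt_sum i N (J : Type) (r : seq J) (Pr : pred J) (F : J -> {mpoly K[n]}) :
  (forall a, Pr a -> deg_lt i N (F a)) -> deg_lt i N (\sum_(a <- r | Pr a) F a).
Proof.
move=> HF; elim/big_ind: _ => //; [exact: deg_lt_zero | exact: deg_ltD].
Qed.

Lemma deg_ltM i N M f g :
  deg_lt i N.+1 f -> deg_lt i M g -> deg_lt i (N + M) (f * g).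
Proof.
move=> Hf Hg m /msuppM_le/allpairsP[[m1 m2] /= [/Hf lt1 /Hg lt2 ->]].
by rewrite mnmDE; lia.
Qed.

Lemma deg_lt_freeM i M f g : deg_lt i 1 f -> deg_lt i M g -> deg_lt i M (f * g).
Proof. exact: (@deg_ltM i 0). Qed.

Lemma deg_lt_X i N m : (m i < N)%N -> deg_lt i N 'X_[m].
Proof. by move=> lt m' /mem_msuppXP <-. Qed.

Lemma deg_lt_Xvar i N : deg_lt i N.+1 ('X_i ^+ N).
Proof. by rewrite mpolyXn; apply: deg_lt_X; rewrite mulmnE mnm1E eqxx mul1n. Qed.

Lemma deg_lt_Xother i j N : i != j -> deg_lt i 1 ('X_j ^+ N).
Proof.
move=> ij; rewrite mpolyXn; apply: deg_lt_X.
by rewrite mulmnE mnm1E eq_sym (negbTE ij).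
Qed.

Lemma deg_lt_C i c : deg_lt i 1 c%:MP.
Proof. by move=> m; rewrite msuppC; case: eqP => //= _; rewrite inE => /eqP->; rewrite mnm0E. Qed.

Lemma deg_lt0 i f : deg_lt i 0 f -> f = 0.
Proof.
move=> Hf; apply/eqP; rewrite -msupp_eq0; case E : (msupp f) => [//|m r].
by have := Hf m; rewrite E mem_head => /(_ isT).
Qed.

Lemma deg_lt_bound i f : exists d, deg_lt i d f.
Proof.
exists (msize f) => m /msize_mdeg_lt; apply: leq_ltn_trans.
by rewrite mdegE (bigD1 i) //= leq_addr.
Qed.

(** A unit times a power of one variable dominates: the shape that makes
    division by [f] with respect to that variable possible over any ring. *)
Definition unit_lead i N f : Prop :=
  exists u low, [/\ exists v, v * u = 1, f = u *: 'X_i ^+ N + low & deg_lt i N low].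

Lemma unit_lead_deg i N f : unit_lead i N f -> degree_in i f = N.
Proof.
move=> [u [low [[v vu] -> Hlow]]]; apply/eqP; rewrite eqn_leq; apply/andP; split.
  rewrite /degree_in; apply/bigmax_leqP_seq => m + _.
  suff H : deg_lt i N.+1 (u *: 'X_i ^+ N + low) by move/H; rewrite ltnS.
  apply: deg_ltD; last exact: deg_lt_mono Hlow.
  by apply: deg_ltZ; exact: deg_lt_Xvar.
pose mN := (U_(i) *+ N)%MM.
have mNi : mN i = N by rewrite /mN mulmnE mnm1E eqxx mul1n.
have lowN : low@_mN = 0.
  by apply/memN_msupp_eq0/negP => /Hlow; rewrite mNi ltnn.
have supp : mN \in msupp (u *: 'X_i ^+ N + low).
  rewrite mcoeff_msupp mcoeffD lowN addr0 mcoeffZ mpolyXn mcoeffX eqxx mulr1.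
  by apply/eqP=> u0; move/eqP: vu; rewrite u0 mulr0 eq_sym oner_eq0.
rewrite /degree_in -[X in (X <= _)%N]mNi.
by apply: (@leq_bigmax_seq _ _ xpredT (fun m : 'X_{1..n} => m i)).
Qed.

Lemma unit_leadM i N M f g :
  unit_lead i N f -> unit_lead i M g -> unit_lead i (N + M) (f * g).
Proof.
move=> [u [f' [[v vu] -> Hf]]] [u' [g' [[v' vu'] -> Hg]]].
exists (u * u'), (u *: 'X_i ^+ N * g' + f' * (u' *: 'X_i ^+ M + g')); split.
- by exists (v * v'); rewrite mulrACA vu vu' mulr1.
- rewrite mulrDl mulrDr -!addrA; congr (_ + _).
  by rewrite -scalerAl -scalerAr scalerA exprD.
apply: deg_ltD; first by apply: deg_ltM => //; apply: deg_ltZ; exact: deg_lt_Xvar.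
rewrite mulrC addnC; apply: deg_ltM => //; apply: deg_ltD.
  by apply: deg_ltZ; exact: deg_lt_Xvar.
exact: deg_lt_mono Hg.
Qed.

(** The last clause keeps the degree bounds already achieved in the variables
    that the divisor does not contain. *)
Lemma unit_lead_div k N g f : unit_lead k N g ->
  exists q r, [/\ f = q * g + r, deg_lt k N r &
    forall j M, j != k -> deg_lt j 1 g -> deg_lt j M f -> deg_lt j M r].
Proof.
move=> [u [low [[v vu] Eg Hlow]]].
have [d] := deg_lt_bound k f; elim: d f => [|d IH] f Hf.
  exists 0, f; split=> //; first by rewrite mul0r add0r.
  exact: deg_lt_mono Hf.
have [leN|ltN] := leqP d.+1 N.
  exists 0, f; split=> //; first by rewrite mul0r add0r.
  exact: deg_lt_mono Hf.
have {}leN : (N <= d)%N by [].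
(* [h * 'X_k ^+ N] is the part of degree [d] in ['X_k]. *)
pose h := \sum_(m <- msupp f | m k == d) f@_m *: 'X_[m - U_(k) *+ N].
pose f' := \sum_(m <- msupp f | m k != d) f@_m *: 'X_[m].
have Ef : f = h * 'X_k ^+ N + f'.
  rewrite {1}(mpolyE f) (bigID (fun m : 'X_{1..n} => m k == d)) /=; congr (_ + _).
  rewrite mulr_suml; apply: eq_bigr => m /eqP mk.
  rewrite -scalerAl mpolyXn -mpolyXD submK //; apply/mnm_lepP => i.
  by rewrite mulmnE mnm1E; case: eqP => [<-|_]; rewrite ?mk ?mul1n ?mul0n.
have hk : deg_lt k (d - N).+1 h.
  apply: deg_lt_sum => m /eqP mk; apply: deg_ltZ; apply: deg_lt_X.
  by rewrite mnmBE mulmnE mnm1E eqxx mul1n mk ltnS.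
pose r0 := f' - v *: (h * low).
have Er0 : f = v *: h * g + r0.
  rewrite Eg mulrDr -scalerAr /r0 Ef.
  rewrite -!scalerAl scalerA [u * v]mulrC vu scale1r addrACA addrA.
  by rewrite -addrA addrC; ring.
have Hr0 : deg_lt k d r0.
  apply: deg_ltB; last first.
    by apply: deg_ltZ; rewrite -(subnK leN); exact: deg_ltM.
  rewrite /f' big_seq_cond; apply: deg_lt_sum => m /andP[mf mk].
  apply: deg_ltZ; apply: deg_lt_X; have := Hf m mf.
  by rewrite ltnS leq_eqVlt (negbTE mk).
have [q [r [Er Hr Hj]]] := IH r0 Hr0.
exists (v *: h + q), r; split=> //.
  by rewrite {1}Er0 Er mulrDl addrA.
move=> j M jk gj fj; apply: Hj => //.
have lowj : deg_lt j 1 low.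
  have -> : low = g - u *: 'X_k ^+ N by rewrite Eg addrC addKr.
  by apply: deg_ltB => //; apply: deg_ltZ; exact: deg_lt_Xother.
apply: deg_ltB.
  rewrite /f' big_seq_cond; apply: deg_lt_sum => m /andP[mf _].
  by apply: deg_ltZ; apply: deg_lt_X; exact: fj.
apply: deg_ltZ; rewrite mulrC; apply: deg_lt_freeM => //.
rewrite /h big_seq_cond; apply: deg_lt_sum => m /andP[mf _].
apply: deg_ltZ; apply: deg_lt_X; rewrite mnmBE.
by apply: leq_ltn_trans (leq_subr _ _) _; exact: fj.
Qed.

(** The monomials of highest degree of [q] in the variable [k] cannot cancel
    in [q * g]. *)
Lemma unit_lead_mul_deg k N g q : unit_lead k N g -> deg_lt k N (q * g) -> q = 0.
Proof.
move=> [u [low [[v vu] -> Hlow]]] Hqg; apply: (@deg_lt0 k).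
have [d] := deg_lt_bound k q; elim: d => // d IH Hq; apply: IH => m mq.
have := Hq m mq; rewrite ltnS leq_eqVlt => /orP[/eqP mk|//].
pose m' := (m + U_(k) *+ N)%MM.
have m'k : m' k = (d + N)%N by rewrite /m' mnmDE mulmnE mnm1E eqxx mul1n mk.
have : (q * (u *: 'X_k ^+ N + low))@_m' = 0.
  by apply/memN_msupp_eq0/negP => /Hqg; rewrite m'k; lia.
have low0 : (q * low)@_m' = 0.
  by apply/memN_msupp_eq0/negP => /(deg_ltM Hq Hlow); rewrite m'k ltnn.
rewrite mulrDr mcoeffD low0 addr0 -scalerAr mcoeffZ mpolyXn /m' addmC mcoeffMX.
move=> /(congr1 ( *%R v)); rewrite mulrA vu mul1r mulr0 => q0.
by move: mq; rewrite mcoeff_msupp q0 eqxx.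
Qed.

Variables (g_ : 'I_n -> {mpoly K[n]}) (N_ : 'I_n -> nat).

Definition in_ideal f : Prop := exists c : 'I_n -> {mpoly K[n]}, f = \sum_k c k * g_ k.

Lemma in_ideal0 : in_ideal 0.
Proof. by exists (fun=> 0); rewrite big1 // => k _; rewrite mul0r. Qed.

Lemma in_idealD f g : in_ideal f -> in_ideal g -> in_ideal (f + g).
Proof.
move=> [c ->] [c' ->]; exists (fun k => c k + c' k).
by rewrite -big_split; apply: eq_bigr => k _; rewrite mulrDl.
Qed.

Lemma in_idealM f g : in_ideal g -> in_ideal (f * g).
Proof.
move=> [c ->]; exists (fun k => f * c k).
by rewrite mulr_sumr; apply: eq_bigr => k _; rewrite mulrA.
Qed.

Lemma in_ideal_gen k f : in_ideal (f * g_ k).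
Proof.
apply: in_idealM; exists (fun j => (j == k)%:R).
rewrite (bigD1 k) //= eqxx mul1r big1 ?addr0 // => j /negbTE->.
by rewrite mul0r.
Qed.

Hypothesis g_lead : forall k, unit_lead k (N_ k) (g_ k).
Hypothesis g_free : forall k j, (k < j)%N -> deg_lt j 1 (g_ k).

(** The divisors are taken in decreasing order of their main variable: a divisor
    is free of the later variables, so it does not spoil the bounds obtained
    before. *)
Lemma triangular_reduce f :
  exists f' r, [/\ in_ideal f', f = f' + r & forall k, deg_lt k (N_ k) r].
Proof.
suff H t : (t <= n)%N -> exists f' r, [/\ in_ideal f', f = f' + r &
    forall k : 'I_n, (n - t <= k)%N -> deg_lt k (N_ k) r].
  have [f' [r [If' Ef Hr]]] := H n (leqnn n); exists f', r; split=> // k.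
  by apply: Hr; rewrite subnn.
elim: t => [_|t IH ltn].
  exists 0, f; split; [exact: in_ideal0 | by rewrite add0r |].
  by move=> k; rewrite subn0 leqNgt ltn_ord.
have [f' [r [If' -> Hr]]] := IH (ltnW ltn).
have lek : (n - t.+1 < n)%N by lia.
pose k := Ordinal lek.
have [q [r' [Er Hk Hj]]] := unit_lead_div r (g_lead k).
exists (f' + q * g_ k), r'; split; last first.
- move=> j; rewrite leq_eqVlt => /orP[/eqP kj|kj].
    by have -> : j = k by apply/val_inj; rewrite /= kj.
  apply: Hj; first by rewrite -val_eqE /=; lia.
    by apply: g_free.
  by apply: Hr; lia.
- by rewrite Er addrA.
by apply: in_idealD => //; exact: in_ideal_gen.
Qed.

(** Dividing the other coefficients by the last divisor shows that the last
    coefficient may be taken to be zero, since its product with that divisor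
    has a degree too small for a multiple; then the number of divisors drops. *)
Lemma triangular_unique r :
  in_ideal r -> (forall k, deg_lt k (N_ k) r) -> r = 0.
Proof.
move=> [c Er] Hr.
suff H t : (t <= n)%N -> forall c : 'I_n -> {mpoly K[n]},
    r = \sum_(k < n | (k < t)%N) c k * g_ k -> r = 0.
  apply: (H n (leqnn n) c); rewrite Er; apply: eq_bigl => k; exact/esym/ltn_ord.
elim: t => [_ c' ->|t IH ltn c' Ec']; first by rewrite big_pred0.
pose k := Ordinal ltn.
have [q /fin_all_exists[r' Hr']] := fin_all_exists (fun j => unit_lead_div (c' j) (g_lead k)).
have Ec : r = (\sum_(j < n | (j < t)%N) r' j * g_ j) +
    (c' k + \sum_(j < n | (j < t)%N) q j * g_ j) * g_ k.
  rewrite Ec' (bigD1 k) //= mulrDl mulr_suml addrCA; congr (_ + _).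
  rewrite -big_split /=; apply: eq_big => [j|j _].
    by rewrite -val_eqE /= ltnS ltn_neqAle andbC.
  by have [-> _ _] := Hr' j; rewrite mulrDl addrC; congr (_ + _); rewrite mulrAC.
have D : deg_lt k (N_ k) (\sum_(j < n | (j < t)%N) r' j * g_ j).
  apply: deg_lt_sum => j jt; rewrite mulrC; apply: deg_lt_freeM.
    exact: g_free.
  by have [] := Hr' j.
have Z : c' k + \sum_(j < n | (j < t)%N) q j * g_ j = 0.
  apply: (unit_lead_mul_deg (g_lead k)).
  by move/eqP: Ec; rewrite addrC -subr_eq => /eqP <-; apply: deg_ltB.
by apply: (IH (ltnW ltn) r'); rewrite {1}Ec Z mul0r addr0.
Qed.
End VariableDegree.

(** * Divided differences and the polynomials g *)

Section DividedDifference.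
Variables (K : idomainType) (n : nat).
Implicit Types (f g : {mpoly K[n.+1]}) (k : 'I_n).

Local Notation s_ k := (simple_transp n k).
Local Notation str k := (inord k : 'I_n.+1).
Local Notation sym k := (msym (simple_transp n k)).
Local Notation dd := (@divided_difference K n).

Lemma msym_var (s : 'S_n.+1) i : msym s ('X_i : {mpoly K[n.+1]}) = 'X_(s i).
Proof. by rewrite /msym mmapX mmap1U. Qed.

Lemma msym_const (s : 'S_n.+1) c : msym s (c%:MP : {mpoly K[n.+1]}) = c%:MP.
Proof. by rewrite /msym mmapC. Qed.

Lemma symK k f : sym k (sym k f) = f.
Proof. by rewrite -msymMm transpM msym1m. Qed.

Lemma mpolyX_inj (i j : 'I_n.+1) : ('X_i == 'X_j :> {mpoly K[n.+1]}) = (i == j).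
Proof.
apply/eqP/eqP=> [/(congr1 (fun f => f@_(U_(i)%MM)))|->//].
by rewrite !mcoeffXU eqxx eq_sym; case: eqP => // _ /eqP; rewrite oner_eq0.
Qed.

Let den k : {mpoly K[n.+1]} := 'X_(str k.+1) - 'X_(str k).

Lemma dd_den_neq0 k : den k != 0.
Proof. by rewrite subr_eq0 mpolyX_inj eq_sym str_neqS. Qed.

Lemma dd_exists k f : exists h, h * den k = f - sym k f.
Proof.
elim/mpoly_gen_ind: f => [c|i|f g [h Eh] [h' Eh']|f g [h Eh] [h' Eh']].
- by exists 0; rewrite msym_const subrr mul0r.
- rewrite msym_var.
  have [->|ik] := eqVneq i (str k).
    by exists (-1); rewrite transpl mulN1r opprB.
  have [->|ikS] := eqVneq i (str k.+1).
    by exists 1; rewrite transpr mul1r.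
  by exists 0; rewrite /simple_transp tpermD ?subrr ?mul0r // eq_sym.
- by exists (h + h'); rewrite mulrDl Eh Eh' msymD; ring.
exists (h * g + sym k f * h').
rewrite mulrDl mulrAC Eh -mulrA Eh' msymM; ring.
Qed.

Lemma ddE k f : dd k f * den k = f - sym k f.
Proof.
have [h Eh] := dd_exists k f.
by rewrite /divided_difference (exquoP (dd_den_neq0 k) Eh).
Qed.

Lemma dd_unique k f h : h * den k = f - sym k f -> dd k f = h.
Proof. by rewrite -ddE => E; apply/esym/(mulIf (dd_den_neq0 k)). Qed.

Lemma ddD k f g : dd k (f + g) = dd k f + dd k g.
Proof. by apply: dd_unique; rewrite mulrDl !ddE msymD; ring. Qed.

Lemma ddM k f g : dd k (f * g) = dd k f * g + sym k f * dd k g.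
Proof.
by apply: dd_unique; rewrite mulrDl mulrAC ddE -mulrA ddE msymM; ring.
Qed.

Lemma dd_sym0 k f : sym k f = f -> dd k f = 0.
Proof. by move=> E; apply: dd_unique; rewrite E subrr mul0r. Qed.

Lemma dd0 k : dd k 0 = 0.
Proof. by apply: dd_sym0; rewrite msym0. Qed.

Lemma ddX k : dd k 'X_(str k) = -1.
Proof. by apply: dd_unique; rewrite msym_var transpl mulN1r opprB. Qed.

Lemma ddXS k : dd k 'X_(str k.+1) = 1.
Proof. by apply: dd_unique; rewrite msym_var transpr mul1r. Qed.

Lemma ddX_other k i : i != str k -> i != str k.+1 -> dd k 'X_i = 0.
Proof.
by move=> ? ?; apply: dd_sym0; rewrite msym_var /simple_transp tpermD // eq_sym.
Qed.

Lemma dd_symM k f g : sym k f = f -> dd k (f * g) = f * dd k g.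
Proof. by move=> E; rewrite ddM E dd_sym0 // mul0r add0r. Qed.

Lemma sym_ddE k f : sym k f = f - dd k f * ('X_(str k.+1) - 'X_(str k)).
Proof. by rewrite ddE; ring. Qed.

Lemma dd_sym k f : dd k (sym k f) = - dd k f.
Proof.
apply: dd_unique; rewrite mulNr ddE symK; ring.
Qed.

Lemma deg_lt_sym k (i : 'I_n.+1) N f : deg_lt i N f -> deg_lt (s_ k i) N (sym k f).
Proof.
move=> Hf m; rewrite mcoeff_msupp mcoeff_sym -mcoeff_msupp => /Hf.
by rewrite mnmE.
Qed.

Lemma unit_lead_sym k N f :
  unit_lead (str k) N f -> unit_lead (str k.+1) N (sym k f).
Proof.
move=> [u [low [vu -> Hlow]]]; exists u, (sym k low); split=> //.
  by rewrite msymD msymZ rmorphXn /= msym_var transpl.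
by have := @deg_lt_sym k _ _ _ Hlow; rewrite transpl.
Qed.

Lemma sym_free k f : deg_lt (str k) 1 f -> deg_lt (str k.+1) 1 f -> sym k f = f.
Proof.
move=> fk fkS.
suff H m : m \in msupp f -> [multinom m (s_ k i) | i < n.+1] = m.
  apply/mpolyP => m; rewrite mcoeff_sym.
  have [/H-> //|mf] := boolP (m \in msupp f).
  rewrite (memN_msupp_eq0 mf); apply/memN_msupp_eq0; apply: contra mf => mf'.
  suff <- : [multinom m (s_ k i) | i < n.+1] = m by [].
  rewrite -[LHS]H //; apply/mnmP => i; by rewrite !mnmE transpK.
move=> mf; apply/mnmP => i; rewrite mnmE.
have := fk m mf; have := fkS m mf; rewrite !ltnS !leqn0 => /eqP mS /eqP m0.
by rewrite /simple_transp; case: tpermP => [->|->|//]; rewrite mS m0.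
Qed.

Let ddp k d := dd k ('X_(str k) ^+ d).

Let ddpS k d : ddp k d.+1 = 'X_(str k.+1) * ddp k d - 'X_(str k) ^+ d.
Proof. by rewrite /ddp exprS ddM ddX msym_var transpl; ring. Qed.

Let ddp_deg k d : deg_lt (str k.+1) d (ddp k d).
Proof.
elim: d => [|d IH].
  by rewrite /ddp expr0 dd_sym0 ?msym1 //; exact: deg_lt_zero.
rewrite ddpS; apply: deg_ltB.
  by apply: (@deg_ltM _ _ _ 1) => //; exact: (@deg_lt_Xvar _ _ _ 1).
by apply: (@deg_lt_mono _ _ _ 1) => //; apply: deg_lt_Xother; rewrite eq_sym str_neqS.
Qed.

Let ddp_lead k d : unit_lead (str k.+1) d (ddp k d.+1).
Proof.
elim: d => [|d IH].
  exists (-1), 0; split; [by exists (-1); rewrite mulrNN mulr1| |exact: deg_lt_zero].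
  by rewrite expr0 /ddp expr1 ddX addr0 scaleN1r.
move: IH => [u [low [vu E Hlow]]].
exists u, ('X_(str k.+1) * low - 'X_(str k) ^+ d.+1); split=> //.
  by rewrite ddpS E mulrDr -scalerAr -exprS addrA.
apply: deg_ltB.
  by apply: (@deg_ltM _ _ _ 1) => //; exact: (@deg_lt_Xvar _ _ _ 1).
by apply: (@deg_lt_mono _ _ _ 1) => //; apply: deg_lt_Xother; rewrite eq_sym str_neqS.
Qed.

Let ddp_free k d i : i != str k -> i != str k.+1 -> deg_lt i 1 (ddp k d).
Proof.
move=> ik ikS; elim: d => [|d IH].
  by rewrite /ddp expr0 dd_sym0 ?msym1 //; exact: deg_lt_zero.
rewrite ddpS; apply: deg_ltB; last exact: deg_lt_Xother.
by apply: deg_lt_freeM => //; rewrite -['X__]expr1; exact: deg_lt_Xother.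
Qed.

(** A polynomial free of ['X_(k+1)] is a combination of powers of ['X_k] with
    symmetric coefficients, and the divided difference is linear over these. *)
Let dd_expand k f : deg_lt (str k.+1) 1 f ->
  exists c : 'X_{1..n.+1} -> {mpoly K[n.+1]},
    dd k f = \sum_(m <- msupp f) c m * ddp k (m (str k)) /\
    forall m i, m \in msupp f -> deg_lt i (m i).+1 (c m) /\ deg_lt (str k.+1) 1 (c m).
Proof.
move=> fk.
pose m' (m : 'X_{1..n.+1}) := [multinom if i == str k then 0%N else m i | i < n.+1].
exists (fun m => f@_m *: 'X_[m' m]); split; last first.
  move=> m i mf; split; apply: deg_ltZ; apply: deg_lt_X; rewrite mnmE; case: eqP => //.
  by move=> _; exact: fk.
rewrite {1}(mpolyE f) (big_morph (dd k) (ddD k) (dd0 k)) big_seq [RHS]big_seq.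
apply: eq_bigr => m mf.
have mS : m (str k.+1) = 0%N by apply/eqP; rewrite -leqn0 -ltnS; exact: fk.
have -> : f@_m *: 'X_[m] = (f@_m *: 'X_[m' m]) * 'X_(str k) ^+ m (str k).
  rewrite -scalerAl mpolyXn -mpolyXD; congr (_ *: 'X_[_]); apply/mnmP => i.
  rewrite mnmDE mnmE mulmnE mnm1E eq_sym.
  by case: eqP => [->|_]; rewrite ?mul1n ?add0n ?mul0n ?addn0.
rewrite dd_symM // msymZ; congr (_ *: _); apply: sym_free.
  by apply: deg_lt_X; rewrite mnmE eqxx.
by apply: deg_lt_X; rewrite mnmE mS; case: eqP.
Qed.

Lemma dd_free k i f : deg_lt (str k.+1) 1 f -> i != str k -> i != str k.+1 ->
  deg_lt i 1 f -> deg_lt i 1 (dd k f).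
Proof.
move=> fk ik ikS fi; have [c [-> Hc]] := dd_expand fk.
rewrite big_seq; apply: deg_lt_sum => m mf; apply: deg_lt_freeM; last exact: ddp_free.
have [+ _] := Hc m i mf; apply: deg_lt_mono; exact: fi.
Qed.

Lemma dd_deg k N f : deg_lt (str k.+1) 1 f -> deg_lt (str k) N f ->
  deg_lt (str k.+1) N.-1 (dd k f).
Proof.
move=> fkS fk; have [c [-> Hc]] := dd_expand fkS.
rewrite big_seq; apply: deg_lt_sum => m mf; apply: deg_lt_freeM.
  by have [_] := Hc m (str k) mf.
apply: (deg_lt_mono _ (@ddp_deg k (m (str k)))).
by have := fk m mf; case: N {fk}.
Qed.

Lemma unit_lead_dd k N f : deg_lt (str k.+1) 1 f ->
  unit_lead (str k) N.+1 f -> unit_lead (str k.+1) N (dd k f).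
Proof.
move=> fk [u [low [[v vu] E Hlow]]].
have lowS : deg_lt (str k.+1) 1 low.
  have -> : low = f - u *: 'X_(str k) ^+ N.+1 by rewrite E addrC addKr.
  by apply: deg_ltB => //; apply: deg_ltZ; apply: deg_lt_Xother; rewrite eq_sym str_neqS.
have [u' [low' [[v' vu'] E' Hlow']]] := ddp_lead k N.
exists (u * u'), (u *: low' + dd k low); split.
- by exists (v * v'); rewrite mulrACA vu vu' mulr1.
- rewrite E ddD -mul_mpolyC dd_symM ?msym_const // -/(ddp k N.+1) E' mul_mpolyC.
  by rewrite scalerDr scalerA addrA.
apply: deg_ltD; first exact: deg_ltZ.
exact: (dd_deg lowS Hlow).
Qed.
End DividedDifference.

Section CyclotomicPolynomials.
Variables (I : finType) (P : zmodType) (C : cartan_datum I P).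
Variables (K : idomainType) (gr : grading K) (Q : klr_parameters C gr).
Variables (Lam : P) (a : cyclotomic_parameters C gr Lam).
Variables (n : nat) (beta : P) (prec : rel I).
Local Notation Ibeta := (weight_word C n.+1 beta).
Local Notation s_ k := (simple_transp n k).
Local Notation str k := (inord k : 'I_n.+1).
Local Notation sym k := (msym (simple_transp n k)).
Local Notation g := (g_poly Q a prec).
Implicit Types (nu : Ibeta).

Lemma letter_perm (w : 'S_n.+1) nu i : letter (perm_word w nu) i = letter nu (w^-1%g i).
Proof. by rewrite /letter /= /perm_tuple tnth_mktuple. Qed.

Lemma letter_transp (k : 'I_n) nu i : letter (perm_word (s_ k) nu) i = letter nu (s_ k i).
Proof. by rewrite letter_perm transpV. Qed.

Lemma weight_word_eq nu nu' : (forall i, letter nu i = letter nu' i) -> nu = nu'.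
Proof. by move=> E; apply/val_inj/eq_from_tnth. Qed.

Lemma perm_wordM (v w : 'S_n.+1) nu :
  perm_word (v * w)%g nu = perm_word w (perm_word v nu).
Proof. by apply: weight_word_eq => i; rewrite !letter_perm invMg permM. Qed.

Lemma perm_word1 nu : perm_word 1%g nu = nu.
Proof. by apply: weight_word_eq => i; rewrite letter_perm invg1 perm1. Qed.

Lemma perm_wordK (k : 'I_n) nu : perm_word (s_ k) (perm_word (s_ k) nu) = nu.
Proof. by rewrite -perm_wordM transpM perm_word1. Qed.

Lemma perm_word_same (k : 'I_n) nu :
  letter nu (str k) = letter nu (str k.+1) -> perm_word (s_ k) nu = nu.
Proof.
move=> E; apply: weight_word_eq => i; rewrite letter_transp /simple_transp.
by case: tpermP => [->|->|].
Qed.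

Lemma subst2_free (Qp : {mpoly K[2]}) (i j l : 'I_n.+1) :
  l != i -> l != j -> deg_lt l 1 (subst2 Qp i j).
Proof.
move=> li lj; elim/mpoly_gen_ind: Qp => [c|z|f h|f h]; rewrite /subst2.
- by rewrite comp_mpolyC; exact: deg_lt_C.
- rewrite comp_mpolyXU.
  by case: z => [[|[|]]] //= ?; rewrite -['X__]expr1; exact: deg_lt_Xother.
- by rewrite comp_mpolyD; exact: deg_ltD.
- by rewrite rmorphM; exact: deg_lt_freeM.
Qed.

Lemma root_form_sym i j : root_form C i j = root_form C j i.
Proof. exact: cartan_symmetrizable. Qed.

(** The coefficient of [v ^ (- a_ji)] is a unit by the symmetry of [Q], and the
    grading confines the remaining monomials [u ^ p v ^ q] of [Q_ij] to
    [d_i p + d_j q <= - d_j a_ji]. *)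
Lemma subst2_lead i j (k l : 'I_n.+1) : i != j -> k != l ->
  unit_lead l `|cartan_matrix C j i| (subst2 (Q i j) k l).
Proof.
move=> ij kl; set N := `|_|%N.
pose mN : 'X_{1..2} := (U_(ord_max) *+ N)%MM.
have mon (m : 'X_{1..2}) : ('X_[m] : {mpoly K[2]}) \mPo [tuple 'X_k; 'X_l] =
    'X_k ^+ m ord0 * 'X_l ^+ m ord_max.
  rewrite comp_mpolyX big_ord_recl big_ord1; congr (_ * _).
  by rewrite (_ : lift _ _ = ord_max) //; apply/val_inj.
have supp m : m \in msupp (Q i j) -> m = mN \/ (m ord_max < N)%N.
  move=> mQ; have := klr_poly_homogeneous Q m ij.
  set e := (X in homogeneous _ X); case E : e => [d|d]; last first.
    by move: mQ; rewrite mcoeff_msupp /homogeneous => /eqP.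
  move=> _.
  have a_le : cartan_matrix C j i <= 0 by apply: cartan_offdiag; rewrite eq_sym.
  have EN : (N%:Z = - cartan_matrix C j i) by rewrite /N; lia.
  move: E; rewrite /e root_form_sym /root_form !cartan_diag.
  have := symmetrizer_gt0 C i; have := symmetrizer_gt0 C j.
  have -> : cartan_matrix C j i = - (N%:Z) by rewrite EN opprK.
  move: (symmetrizer C i) (symmetrizer C j) => di dj dj0 di0 E.
  have : (dj * m ord_max + di * m ord0 <= dj * N)%N by lia.
  have [lt|ge] := ltnP (m ord_max) N; first by right.
  move=> le; left.
  have le1 : (dj * N <= dj * m ord_max)%N by rewrite leq_mul2l ge orbT.
  have m0 : (di * m ord0 = 0)%N by lia.
  have m1 : (dj * m ord_max = dj * N)%N by lia.
  apply/mnmP => z; rewrite /mN mulmnE mnm1E.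
  case: z => [[|[|]]] //= ?.
    rewrite mul0n (_ : Ordinal _ = ord0); last exact/val_inj.
    by move/eqP: m0; rewrite muln_eq0 => /orP[|/eqP//]; rewrite (gtn_eqF di0).
  rewrite mul1n (_ : Ordinal _ = ord_max); last exact/val_inj.
  by move/eqP: m1; rewrite eqn_mul2l => /orP[|/eqP//]; rewrite (gtn_eqF dj0).
have [_ [v _ uv]] : degree0_unit gr (Q i j)@_mN.
  rewrite klr_poly_sym mcoeff_sym.
  have -> : [multinom mN (tperm ord0 ord_max z) | z < 2] = (U_(ord0) *+ N)%MM.
    apply/mnmP => z; rewrite mnmE !mulmnE !mnm1E; congr (nat_of_bool _ * _)%N.
    by rewrite -{1}(tpermL ord0 ord_max) (inj_eq perm_inj).
  by apply: klr_poly_unit; rewrite eq_sym.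
exists (Q i j)@_mN, (\sum_(m <- msupp (Q i j) | m != mN)
   (Q i j)@_m *: ('X_k ^+ m ord0 * 'X_l ^+ m ord_max)); split.
- by exists v; rewrite mulrC.
- rewrite /subst2 {1}(mpolyE (Q i j)) raddf_sum /=.
  rewrite (bigD1_seq mN) ?msupp_uniq //=; last first.
    rewrite mcoeff_msupp; apply/eqP => u0; move/eqP: uv.
    by rewrite u0 mul0r eq_sym oner_eq0.
  congr (_ + _); last by apply: eq_bigr => m _; rewrite comp_mpolyZ mon.
  rewrite comp_mpolyZ mon /mN !mulmnE !mnm1E eqxx mul1n.
  by rewrite (_ : (ord_max == ord0 :> 'I_2) = false) // mul0n expr0 mul1r.
rewrite big_seq_cond; apply: deg_lt_sum => m /andP[/supp[->|lt] mm]; first by rewrite eqxx in mm.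
apply: deg_ltZ; apply: deg_lt_freeM; first by apply: deg_lt_Xother; rewrite eq_sym.
by apply: (@deg_lt_mono _ _ _ (m ord_max).+1) => //; exact: deg_lt_Xvar.
Qed.

Lemma g_polyS (k : 'I_n) nu :
  g k.+1 nu =
    let i := letter nu (str k) in
    let j := letter nu (str k.+1) in
    if i == j then divided_difference k (g k nu)
    else
      let f := sym k (g k (perm_word (s_ k) nu)) in
      if prec j i then f else f * subst2 (Q i j) (str k) (str k.+1).
Proof. by []. Qed.

Lemma g_poly_ind (Pk : nat -> Prop) : Pk 0%N -> (forall k : 'I_n, Pk k -> Pk k.+1) ->
  forall k, (k <= n)%N -> Pk k.
Proof.
move=> P0 PS; elim=> // k IH lt_kn; apply: (PS (Ordinal lt_kn)).
by apply: IH; exact: ltnW.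
Qed.

Lemma g_poly_prefix k nu nu' : (k <= n)%N ->
  (forall i : 'I_n.+1, (i <= k)%N -> letter nu i = letter nu' i) -> g k nu = g k nu'.
Proof.
move=> le_kn; elim/g_poly_ind: le_kn nu nu' => [|{}k IH] nu nu' E.
  by rewrite /= E.
have Ek : letter nu (str k) = letter nu' (str k) by apply: E; rewrite str_val.
have EkS : letter nu (str k.+1) = letter nu' (str k.+1) by apply: E; rewrite strS_val.
rewrite !g_polyS /= Ek EkS; rewrite (IH nu nu'); last by move=> i /leqW/E.
rewrite (IH (perm_word (s_ k) nu) (perm_word (s_ k) nu')) // => i ik.
by rewrite !letter_transp; apply: E; have := transp_cases k i; lia.
Qed.

Lemma g_poly_transp (j : nat) (k : 'I_n) nu : (j < k)%N ->
  g j (perm_word (s_ k) nu) = g j nu.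
Proof.
move=> jk; apply: g_poly_prefix => [|i ij]; first by have := ltn_ord k; lia.
by rewrite letter_transp; congr letter; apply/val_inj => /=; have := transp_cases k i; lia.
Qed.

Lemma g_poly_free k nu (i : 'I_n.+1) : (k <= n)%N -> (k < i)%N -> deg_lt i 1 (g k nu).
Proof.
move=> le_kn; elim/g_poly_ind: le_kn nu i => [|{}k IH] nu i ki.
  rewrite /= -(mulr1n ord0) horner_coef; apply: deg_lt_sum => d _; rewrite coef_map /=.
  by apply: deg_lt_freeM; [exact: deg_lt_C | apply: deg_lt_Xother; rewrite -val_eqE /=; lia].
have ik : i != str k by rewrite -val_eqE /= str_val; lia.
have ikS : i != str k.+1 by rewrite -val_eqE /= strS_val; lia.
rewrite g_polyS /=; case: eqP => _.
  by apply: dd_free => //; apply: IH; rewrite ?strS_val //; exact: ltnW.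
have H : deg_lt i 1 (sym k (g k (perm_word (s_ k) nu))).
  have := @deg_lt_sym K n k i 1 _ (IH (perm_word (s_ k) nu) i (ltnW ki)).
  by rewrite /simple_transp tpermD // eq_sym.
by case: ifP => // _; apply: deg_lt_freeM => //; exact: subst2_free.
Qed.

Lemma g_poly_sym (j : nat) (k : 'I_n) nu : (j < k)%N -> sym k (g j nu) = g j nu.
Proof.
move=> jk; have jn : (j <= n)%N by have := ltn_ord k; lia.
by apply: sym_free; apply: g_poly_free => //; rewrite ?str_val ?strS_val //; lia.
Qed.

(** A divided difference lowers the degree in the last variable by one; it
    vanishes when that degree is zero, but then an earlier polynomial of the
    sequence is already a unit. *)
Lemma g_poly_lead k nu : (k <= n)%N ->
  (exists N, unit_lead (str k) N (g k nu)) \/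
  (exists2 j, (j < k)%N & unit_lead (str j) 0 (g j nu)).
Proof.
move=> le_kn; elim/g_poly_ind: le_kn nu => [|{}k IH] nu.
  left; have mon := cyclotomic_monic a (letter nu ord0).
  have size_gt0 : (0 < size (a (letter nu ord0)))%N by rewrite cyclotomic_size.
  exists (size (a (letter nu ord0))).-1.
  have -> : str 0 = ord0 by apply/val_inj; rewrite /= inordK.
  rewrite /= horner_coef size_map_poly_id0; last first.
    by rewrite (monicP mon) mpolyC1 oner_neq0.
  move: size_gt0 mon; rewrite monicE lead_coefE; move: (a (letter nu ord0)) => q.
  case: (size q) => // d _ /eqP /= qd.
  exists 1, (\sum_(i < d) (map_poly (@mpolyC n.+1 K) q)`_i * 'X_ord0 ^+ i); split.
  - by exists 1; rewrite mulr1.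
  - by rewrite big_ord_recr /= addrC coef_map /= qd mpolyC1 mul1r scale1r.
  apply: deg_lt_sum => i _; rewrite coef_map /=; apply: deg_lt_freeM; first exact: deg_lt_C.
  by apply: (@deg_lt_mono _ _ _ i.+1) => //; exact: deg_lt_Xvar.
have kn : (k <= n)%N := ltnW (ltn_ord k).
rewrite g_polyS /=; case: eqP => [_|/eqP ij].
  have [[[|N] HN]|[j jk Hj]] := IH nu; last by right; exists j => //; exact: ltnW.
    by right; exists k.
  left; exists N; apply: unit_lead_dd => //; apply: g_poly_free => //.
  by rewrite strS_val.
have [[N /unit_lead_sym HN]|[j jk]] := IH (perm_word (s_ k) nu); last first.
  by rewrite g_poly_transp // => Hj; right; exists j => //; exact: ltnW.
left; case: ifP => _; first by exists N.
eexists; apply: unit_leadM HN _; apply: subst2_lead => //; exact: str_neqS.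
Qed.
End CyclotomicPolynomials.

(** * Reduced words span *)

(** The arguments use a KLR algebra only through its relations and the fact that
    it is generated; [A] is any algebra with these two properties. *)
Section KLRSpanning.
Variables (I : finType) (P : zmodType) (C : cartan_datum I P).
Variables (K : idomainType) (gr : grading K) (Q : klr_parameters C gr).
Variables (n : nat) (beta : P).
Local Notation Ibeta := (weight_word C n.+1 beta).
Variables (A : algebra K) (e : Ibeta -> A) (x : 'I_n.+1 -> A) (tau : 'I_n -> A).
Hypothesis relE : forall a b, klr_relation Q e x tau a b -> a = b.
Hypothesis gen : klr_generated e x tau.
Definition tau_word (js : seq 'I_n) : A := \prod_(j <- js) tau j.
Local Notation T := tau_word.
Local Notation X := (mpoly_eval x).
Local Notation s_ k := (simple_transp n k).
Local Notation str k := (inord k : 'I_n.+1).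
Local Notation sym k := (msym (simple_transp n k)).
Local Notation dd := (@divided_difference K n).
Implicit Types (nu mu : Ibeta) (f g : {mpoly K[n.+1]}) (k l j : 'I_n)
  (js : seq 'I_n) (z : A).

Lemma klr_ee nu nu' : e nu * e nu' = if nu == nu' then e nu else 0.
Proof. exact: relE (KLR_ee _ _ _ _ _ _). Qed.

Lemma klr_sum_e : \sum_nu e nu = 1.
Proof. exact: relE (KLR_sum_e _ _ _ _). Qed.

Lemma klr_xx (k l : 'I_n.+1) : x k * x l = x l * x k.
Proof. exact: relE (KLR_xx _ _ _ _ _ _). Qed.

Lemma klr_xe (k : 'I_n.+1) nu : x k * e nu = e nu * x k.
Proof. exact: relE (KLR_xe _ _ _ _ _ _). Qed.

Lemma klr_te l nu : tau l * e nu = e (perm_word (s_ l) nu) * tau l.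
Proof. exact: relE (KLR_te _ _ _ _ _ _). Qed.

Lemma klr_tt (k l : 'I_n) : (k.+1 < l)%N \/ (l.+1 < k)%N ->
  tau k * tau l = tau l * tau k.
Proof. move=> kl; exact: relE (KLR_tt _ _ _ _ kl). Qed.

Lemma klr_t2 (k : 'I_n) nu : tau k * tau k * e nu =
  mpoly_eval x (subst2 (Q (letter nu (str k)) (letter nu (str k.+1)))
                            (str k) (str k.+1)) * e nu.
Proof. exact: relE (KLR_t2 _ _ _ _ _ _). Qed.

Lemma klr_tx (k : 'I_n) (l : 'I_n.+1) nu :
  (tau k * x l - x (s_ k l) * tau k) * e nu =
      (if letter nu (str k) == letter nu (str k.+1) then
         if l == str k then - e nu else if l == str k.+1 then e nu else 0
       else 0).
Proof. exact: relE (KLR_tx _ _ _ _ _ _ _). Qed.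

Lemma klr_braid (k l : 'I_n) nu : l = k.+1 :> nat ->
      (tau l * tau k * tau l - tau k * tau l * tau k) * e nu =
      (if letter nu (str k) == letter nu (str k.+2) then
         mpoly_eval x (exquo
           (subst2 (Q (letter nu (str k)) (letter nu (str k.+1)))
                   (str k) (str k.+1)
            - subst2 (Q (letter nu (str k.+2)) (letter nu (str k.+1)))
                     (str k.+2) (str k.+1))
           ('X_(str k) - 'X_(str k.+2))) * e nu
       else 0).
Proof. move=> kl; exact: relE (KLR_braid _ _ _ _ _ kl). Qed.

Let XD f g : X (f + g) = X f + X g := mpoly_evalD _ _ _.
Let XM f g : X (f * g) = X f * X g := mpoly_evalM klr_xx _ _.

Lemma klr_Xe f nu : X f * e nu = e nu * X f.
Proof.
elim/mpoly_gen_ind: f => [c|i|f g Ef Eg|f g Ef Eg].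
- by rewrite mpoly_evalC -algebra_scaleAl -algebra_scaleAr mul1r mulr1.
- by rewrite mpoly_evalX klr_xe.
- by rewrite XD mulrDl mulrDr Ef Eg.
- by rewrite XM -mulrA Eg mulrA Ef mulrA.
Qed.

Lemma klr_e1 z : z = \sum_nu e nu * z.
Proof. by rewrite -mulr_suml klr_sum_e mul1r. Qed.

Lemma klr_1e z : z = \sum_nu z * e nu.
Proof. by rewrite -mulr_sumr klr_sum_e mulr1. Qed.

Lemma klr_ee1 nu : e nu * e nu = e nu.
Proof. by rewrite klr_ee eqxx. Qed.

(** The divided difference enters the commutation of [tau_k] past polynomials
    only where the two strands have the same colour. *)
Definition colour_dd nu k f : {mpoly K[n.+1]} :=
  if letter nu (str k) == letter nu (str k.+1) then dd k f else 0.

Lemma klr_tauX k f nu :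
  tau k * X f * e nu = X (sym k f) * tau k * e nu + X (colour_dd nu k f) * e nu.
Proof.
elim/mpoly_gen_ind: f => [c|i|f g Ef Eg|f g Ef Eg].
- have -> : colour_dd nu k c%:MP = 0.
    by rewrite /colour_dd dd_sym0 ?msym_const // if_same.
  rewrite msym_const mpoly_eval0 mul0r addr0 !mpoly_evalC.
  by rewrite -algebra_scaleAl -algebra_scaleAr mul1r mulr1.
- rewrite msym_var !mpoly_evalX; apply/eqP; rewrite addrC -subr_eq -mulrBl klr_tx.
  rewrite /colour_dd; apply/eqP; case: eqP => _; last by rewrite mpoly_eval0 mul0r.
  case: eqP => [->|/eqP ik].
    by rewrite ddX mpoly_evalN mpoly_eval1 mulN1r.
  case: eqP => [->|/eqP ikS]; first by rewrite ddXS mpoly_eval1 mul1r.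
  by rewrite ddX_other // mpoly_eval0 mul0r.
- have -> : colour_dd nu k (f + g) = colour_dd nu k f + colour_dd nu k g.
    by rewrite /colour_dd ddD; case: ifP; rewrite ?addr0.
  rewrite !XD msymD XD mulrDr !mulrDl Ef Eg addrACA //.
have -> : colour_dd nu k (f * g) = colour_dd nu k f * g + sym k f * colour_dd nu k g.
  by rewrite /colour_dd ddM; case: ifP; rewrite ?mul0r ?mulr0 ?addr0.
rewrite msymM XD !XM mulrDl !mulrA -[tau k * X f * X g * _]mulrA klr_Xe mulrA Ef.
rewrite mulrDl -[_ * e nu * X g]mulrA -klr_Xe -[_ * e nu * X g]mulrA -klr_Xe.
rewrite !mulrA -[X (sym k f) * tau k * _ * _]mulrA -[X (sym k f) * tau k * _]mulrA.
rewrite [tau k * (_ * _)]mulrA Eg mulrDr !mulrA -!addrA; congr (_ + _).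
by rewrite addrC.
Qed.

Lemma klr_Xtau k f nu : X f * tau k * e nu =
  tau k * X (sym k f) * e nu - X (colour_dd nu k (sym k f)) * e nu.
Proof. by rewrite klr_tauX symK addrK. Qed.

Lemma tau_word_cons j js : T (j :: js) = tau j * T js.
Proof. by rewrite /tau_word big_cons. Qed.

Lemma tau_word_nil : T [::] = 1.
Proof. by rewrite /tau_word big_nil. Qed.

Lemma tau_word_cat js js' : T (js ++ js') = T js * T js'.
Proof. by rewrite /tau_word big_cat. Qed.

Lemma tau_word_rcons j js : T (rcons js j) = T js * tau j.
Proof. by rewrite -cats1 tau_word_cat tau_word_cons tau_word_nil mulr1. Qed.

Lemma tau_word_e js nu : T js * e nu = e (perm_word (word_perm js) nu) * T js.
Proof.
elim: js => [|j js IH]; first by rewrite tau_word_nil word_perm_nil perm_word1 mul1r mulr1.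
by rewrite tau_word_cons -mulrA IH mulrA klr_te -mulrA word_perm_cons perm_wordM.
Qed.

Lemma e_tau_word js nu : e nu * T js = T js * e (perm_word (word_perm js)^-1 nu)%g.
Proof. by rewrite tau_word_e -perm_wordM mulVg perm_word1. Qed.

(** The filtration by the number of letters [tau]. *)
Definition short_gen m z : Prop :=
  exists js f nu, (size js < m)%N /\ z = T js * X f * e nu.
Definition short m : A -> Prop := addspan (short_gen m).

Lemma short_mono m m' z : (m <= m')%N -> short m z -> short m' z.
Proof.
move=> le; apply: addspan_sub => _ [js [f [nu [lt ->]]]].
by apply: SpanG; exists js, f, nu; split=> //; apply: leq_trans le.
Qed.

Lemma short_sub m y z : short m y -> short m z -> short m (y - z).
Proof.
move=> Hy Hz; apply: SpanD => //; apply: addspanN Hz => _ [js [f [nu [lt ->]]]].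
by exists js, (- f), nu; split=> //; rewrite mpoly_evalN mulrN mulNr.
Qed.

Lemma short_subK m b a c : short m (a - b) -> short m (b - c) -> short m (a - c).
Proof. by move=> Hab Hbc; rewrite -(subrKA b); apply: SpanD. Qed.

Lemma short_e m nu z : short m z -> short m (e nu * z).
Proof.
apply: addspan_mull => _ [js [f [mu [lt ->]]]] /=.
rewrite !mulrA e_tau_word -mulrA -[_ * e _ * _]mulrA [e _ * (_ * _)]mulrA -klr_Xe -mulrA klr_ee.
case: eqP => _; last by rewrite !mulr0; exact: Span0.
by rewrite mulrA; apply: SpanG; exists js, f; eexists; split; [exact: lt|].
Qed.

Lemma short_tau m l z : short m z -> short m.+1 (tau l * z).
Proof.
apply: addspan_mull => _ [js [f [mu [lt ->]]]] /=.
apply: SpanG; exists (l :: js), f, mu; split=> //.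
by rewrite tau_word_cons !mulrA.
Qed.

Lemma short_word m js : (size js < m)%N -> short m (T js).
Proof.
move=> lt; rewrite (klr_1e (T js)); apply: addspan_sum => nu _; apply: SpanG.
by exists js, 1, nu; split=> //; rewrite mpoly_eval1 mulr1.
Qed.

Lemma short0 z : short 0 z -> z = 0.
Proof. by elim=> // [y y' _ -> _ ->|_ [js [f [nu [//]]]]]; rewrite addr0. Qed.

(** Moving a polynomial to the right past a letter [tau] produces an error term
    with one letter less. *)
Lemma short_X m g z : short m z -> short m (X g * z).
Proof.
elim: m g z => [|m IH] g z.
  by move/short0 ->; rewrite mulr0; exact: Span0.
apply: addspan_mull => _ [[|j js] [f [nu [lt ->]]]] /=.
  apply: SpanG; exists [::], (g * f), nu; split=> //.
  by rewrite tau_word_nil !mul1r XM !mulrA.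
set y := T js * X f * e nu.
have Hy : short m y by apply: SpanG; exists js, f, nu.
have -> : X g * (T (j :: js) * X f * e nu) = X g * tau j * y.
  by rewrite tau_word_cons /y !mulrA.
rewrite (klr_e1 y) mulr_sumr; apply: addspan_sum => mu _.
rewrite mulrA klr_Xtau mulrBl; apply: short_sub.
  by rewrite -!mulrA; apply: short_tau; apply: IH; exact: short_e.
by rewrite -mulrA; apply: short_mono (leqnSn m) _; apply: IH; exact: short_e.
Qed.

Lemma shortr_X m g z : short m z -> short m (z * X g).
Proof.
apply: addspan_mulr => _ [js [f [nu [lt ->]]]] /=.
apply: SpanG; exists js, (f * g), nu; split=> //.
by rewrite XM -!mulrA klr_Xe.
Qed.

Lemma shortr_e m mu z : short m z -> short m (z * e mu).
Proof.
apply: addspan_mulr => _ [js [f [nu [lt ->]]]] /=.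
rewrite -mulrA klr_ee; case: eqP => _; last by rewrite mulr0; exact: Span0.
by apply: SpanG; exists js, f, nu.
Qed.

Lemma short_total z : exists m, short m z.
Proof.
elim/gen: z => [||y z [m Hy] [m' Hz]|c z [m Hz]|nu z [m Hz]|k z [m Hz]|l z [m Hz]].
- by exists 0%N; exact: Span0.
- by exists 1%N; rewrite -tau_word_nil; exact: short_word.
- exists (maxn m m'); apply: SpanD; apply: short_mono; [|exact: Hy| |exact: Hz];
    by rewrite leq_max leqnn ?orbT.
- exists m; rewrite -[z]mul1r algebra_scaleAl -(mpoly_evalC x); exact: short_X.
- by exists m; exact: short_e.
- by exists m; rewrite -(mpoly_evalX x k); exact: short_X.
- by exists m.+1; exact: short_tau.
Qed.

Lemma short_braid m (k l : 'I_n) js : l = k.+1 :> nat -> (size js < m)%N ->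
  short m (T [:: l, k, l & js] - T [:: k, l, k & js]).
Proof.
move=> kl lt; rewrite !tau_word_cons !mulrA -mulrBl (klr_e1 (T js)) mulr_sumr.
apply: addspan_sum => nu _; rewrite mulrA klr_braid //.
case: eqP => _; last by rewrite mul0r; exact: Span0.
by rewrite -mulrA; apply/short_X/short_e/short_word.
Qed.

(** Matsumoto's theorem up to lower terms. Reduced words of one permutation with
    different first letters are compared through words that begin with the two
    sides of a commutation or braid relation, and in the algebra these relations
    hold up to shorter words. *)
Lemma reduced_words_agree js js' : reduced js -> reduced js' ->
  word_perm js = word_perm js' -> short (size js) (T js - T js').
Proof.
have [m le_m] := ubnP (size js); elim: m js js' le_m => // m IH js js' + rjs rjs' E.
have Es : size js = size js' by rewrite rjs rjs' E.
case: js js' rjs rjs' E Es => [|i r] [|j r'] // ri rj E Es le_m.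
  by rewrite subrr; exact: Span0.
rewrite /= in Es le_m *; case: Es => Es.
set w := word_perm (i :: r) in E *.
have step k js1 js2 : reduced (k :: js1) -> reduced (k :: js2) ->
    word_perm (k :: js1) = w -> word_perm (k :: js2) = w ->
    short (size r).+1 (T (k :: js1) - T (k :: js2)).
  move=> r1 r2 E1 E2; rewrite !tau_word_cons -mulrBr.
  have w12 : word_perm js1 = word_perm js2.
    by move: E1; rewrite -E2 !word_perm_cons => /mulIg.
  have size1 : size js1 = size r.
    by apply/eqP; rewrite -eqSS -[(size js1).+1]/(size (k :: js1)) r1 E1 -ri.
  have lt1 : (size js1 < m)%N by rewrite size1.
  rewrite -size1; apply: short_tau.
  exact: (IH js1 js2 lt1 (reduced_tail r1) (reduced_tail r2) w12).
have wi := reduced_head ri; have := reduced_head rj; rewrite -/w -E => wj.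
have [ij|ij] := eqVneq i j; first by rewrite -ij in rj E *; exact: step.
have [far|near] := boolP ((i.+1 < j)%N || (j.+1 < i)%N).
  have {}far := orP far.
  have [r0 [E1 r1 E2 r2]] := reduced_far far wi wj.
  apply: (@short_subK _ (T [:: i, j & r0])); first exact: step.
  have -> : T [:: i, j & r0] = T [:: j, i & r0].
    by rewrite !tau_word_cons !mulrA (klr_tt far).
  exact: step.
have {near} : (j = i.+1 :> nat) \/ (i = j.+1 :> nat).
  have : (i : nat) <> j by apply/eqP.
  by move: near; rewrite negb_or -!leqNgt => /andP[]; lia.
have size0 k l r0 : reduced [:: k, l, k & r0] -> word_perm [:: k, l, k & r0] = w ->
    (size r0 < (size r).+1)%N.
  move=> r1 E1; have : (size [:: k, l, k & r0] = size (i :: r))%N by rewrite r1 E1 ri.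
  by rewrite /= => -[<-]; lia.
case=> [ji|ji].
  have [r0 [E1 r1 E2 r2]] := reduced_braid ji wi wj.
  apply: (@short_subK _ (T [:: i, j, i & r0])); first exact: step.
  apply: (@short_subK _ (T [:: j, i, j & r0])); last exact: step.
  rewrite -opprB -[- _]add0r; apply: short_sub; first exact: Span0.
  by apply: short_braid => //; apply: size0 r1 E1.
have [r0 [E1 r1 E2 r2]] := reduced_braid ji wj wi.
apply: (@short_subK _ (T [:: i, j, i & r0])); first exact: step.
apply: (@short_subK _ (T [:: j, i, j & r0])); last exact: step.
by apply: short_braid => //; apply: size0 r1 E1.
Qed.

(** A word that is not reduced contains, up to shorter words, the square of a
    letter, which is a polynomial. *)
Lemma not_reduced_short js : ~ reduced js -> short (size js) (T js).
Proof.
elim: js => [|i r IH] nr.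
  by case: nr; rewrite /reduced word_perm_nil inv_num1.
have [rr|nrr] := pselect (reduced r); last first.
  by rewrite tau_word_cons; apply/short_tau/IH.
have wi := not_reduced_cons rr nr.
have [r0 [E0 r0r]] := reduced_exists (word_perm r * s_ i)%g.
have [E1 r1] := reduced_consP E0 r0r wi.
rewrite tau_word_cons -[T r](subrK (T (i :: r0))) mulrDr; apply: SpanD.
  by apply: short_tau; apply: reduced_words_agree.
rewrite tau_word_cons mulrA (klr_e1 (T r0)) mulr_sumr; apply: addspan_sum => nu _.
rewrite mulrA klr_t2 -mulrA; apply/short_X/short_e/short_word => /=.
have : size (i :: r0) = size r by rewrite r1 rr E1.
by move=> <- /=.
Qed.

Definition normal_gen (red : 'S_n.+1 -> seq 'I_n) z : Prop :=
  exists w f nu, z = T (red w) * X f * e nu.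

Lemma klr_spanning (red : 'S_n.+1 -> seq 'I_n) :
  (forall w, word_perm (red w) = w /\ reduced (red w)) ->
  forall z, addspan (normal_gen red) z.
Proof.
move=> redP z; have [m] := short_total z; elim: m z => [|m IH] z.
  by move/short0 ->; exact: Span0.
apply: addspan_sub => _ [js [f [nu [lt ->]]]].
have [lt'|ge] := ltnP (size js) m.
  by apply: IH; apply: SpanG; exists js, f, nu.
have {ge lt} size_js : size js = m by lia.
have [r|nr] := pselect (reduced js); last first.
  by apply: IH; apply: shortr_e; apply: shortr_X; rewrite -size_js; exact: not_reduced_short.
have [Ew rw] := redP (word_perm js).
rewrite -[T js](subrK (T (red (word_perm js)))) 2!mulrDl; apply: SpanD.
  apply: IH; apply: shortr_e; apply: shortr_X; rewrite -size_js.
  exact: reduced_words_agree.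
by apply: SpanG; exists (word_perm js), f, nu.
Qed.
End KLRSpanning.

(** * A faithful representation *)

Section LinearOperators.
Variables (K : comNzRingType) (F : comNzRingType) (S : Type) (iota : {rmorphism K -> F}).

Record linop := LinOp {
  linop_fun :> (S -> F) -> S -> F;
  linopP : forall c phi psi v,
    linop_fun (fun u => c * phi u + psi u) v = c * linop_fun phi v + linop_fun psi v
}.

Lemma linop_eq (A B : linop) : (forall phi v, A phi v = B phi v) -> A = B.
Proof.
case: A B => [A hA] [B hB] /= AB.
have E : A = B by apply/funext => phi; apply/funext => v; exact: AB.
by subst B; congr LinOp; exact: Prop_irrelevance.
Qed.

HB.instance Definition _ := gen_eqMixin linop.
HB.instance Definition _ := gen_choiceMixin linop.

Implicit Types (A B D : linop).

Program Definition linop0 := @LinOp (fun _ _ => 0) _.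
Next Obligation. by rewrite mulr0 addr0. Qed.
Program Definition linop_opp A := @LinOp (fun phi v => - A phi v) _.
Next Obligation. by rewrite linopP opprD mulrN. Qed.
Program Definition linop_add A B := @LinOp (fun phi v => A phi v + B phi v) _.
Next Obligation. by rewrite !linopP mulrDr addrACA. Qed.

Fact linop_addA : associative linop_add.
Proof. by move=> A B D; apply: linop_eq => phi v /=; rewrite addrA. Qed.
Fact linop_addC : commutative linop_add.
Proof. by move=> A B; apply: linop_eq => phi v /=; rewrite addrC. Qed.
Fact linop_add0 : left_id linop0 linop_add.
Proof. by move=> A; apply: linop_eq => phi v /=; rewrite add0r. Qed.
Fact linop_addN : left_inverse linop0 linop_opp linop_add.
Proof. by move=> A; apply: linop_eq => phi v /=; rewrite addNr. Qed.

HB.instance Definition _ := GRing.isZmodule.Build linop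
  linop_addA linop_addC linop_add0 linop_addN.

Program Definition linop_one := @LinOp (fun phi => phi) _.
Program Definition linop_mul A B := @LinOp (fun phi => A (B phi)) _.
Next Obligation.
rewrite -linopP; congr (linop_fun A _ v).
by apply/funext => u; exact: linopP.
Qed.

Fact linop_mulA : associative linop_mul.
Proof. by move=> A B D; exact: linop_eq. Qed.
Fact linop_mul1 : left_id linop_one linop_mul.
Proof. by move=> A; exact: linop_eq. Qed.
Fact linop_mulr1 : right_id linop_one linop_mul.
Proof. by move=> A; exact: linop_eq. Qed.
Fact linop_mulDl : left_distributive linop_mul linop_add.
Proof. by move=> A B D; exact: linop_eq. Qed.
Fact linop_mulDr : right_distributive linop_mul linop_add.
Proof.
move=> A B D; apply: linop_eq => phi v /=.
rewrite -[X in _ = X + _]mul1r -linopP; congr (linop_fun A _ v).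
by apply/funext => u; rewrite mul1r.
Qed.

HB.instance Definition _ := GRing.Zmodule_isPzRing.Build linop
  linop_mulA linop_mul1 linop_mulr1 linop_mulDl linop_mulDr.

Program Definition linop_scalar (c : F) := @LinOp (fun phi v => c * phi v) _.
Next Obligation. ring. Qed.

Definition linop_map (c : K) : linop := linop_scalar (iota c).

Fact linop_map_zmod : zmod_morphism linop_map.
Proof. by move=> c d; apply: linop_eq => phi v /=; rewrite rmorphB mulrBl. Qed.
Fact linop_map_monoid : monoid_morphism linop_map.
Proof.
split=> [|c d]; apply: linop_eq => phi v /=; first by rewrite rmorph1 mul1r.
by rewrite rmorphM mulrA.
Qed.
HB.instance Definition _ := GRing.isZmodMorphism.Build K linop linop_map linop_map_zmod.
HB.instance Definition _ := GRing.isMonoidMorphism.Build K linop linop_map linop_map_monoid.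

Fact linop_mapC c A : linop_map c * A = A * linop_map c.
Proof.
apply: linop_eq => phi v /=; have A0 : A (fun=> 0) v = 0.
  have := linopP A 0 phi (fun=> 0) v; have := linopP A (-1) (fun=> 0) (fun=> 0) v.
  have -> : (fun _ : S => -1 * 0 + 0) = (fun=> 0 : F) by apply/funext => u; rewrite mulr0 addr0.
  by rewrite mulN1r addNr.
rewrite -[LHS]addr0 -[X in _ + X]A0 -linopP; congr (linop_fun A _ v).
by apply/funext => u; rewrite addr0.
Qed.

Definition linop_algebra : algebra K := Algebra linop_mapC.

Lemma linop_sumE (J : Type) (r : seq J) (G : J -> linop) phi v :
  (\sum_(j <- r) G j) phi v = \sum_(j <- r) G j phi v.
Proof. by elim: r => [|j r IH]; rewrite ?big_nil // !big_cons /= IH. Qed.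

End LinearOperators.

(** The quotient in the braid relation is a polynomial. *)
Lemma subst2_diff (K : idomainType) n (Qp : {mpoly K[2]}) (i j l : 'I_n) :
  exists h, h * ('X_i - 'X_j) = subst2 Qp i l - subst2 Qp j l.
Proof.
elim/mpoly_gen_ind: Qp => [c|z|f g [h Eh] [h' Eh']|f g [h Eh] [h' Eh']].
- by exists 0; rewrite /subst2 !comp_mpolyC subrr mul0r.
- case: z => [[|[|]]] //= ?; rewrite /subst2 !comp_mpolyXU /=.
    by exists 1; rewrite mul1r.
  by exists 0; rewrite subrr mul0r.
- by exists (h + h'); rewrite mulrDl Eh Eh' /subst2 !comp_mpolyD opprD addrACA.
exists (h * subst2 g i l + subst2 f j l * h').
rewrite mulrDl mulrAC Eh -mulrA Eh' /subst2 !rmorphM /=.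
by rewrite mulrBl mulrBr addrA subrK.
Qed.

(** The functions on the arrangements [v] of the strands carry the KLR algebra:
    in the arrangement [v], position [i] is occupied by strand [v^-1 i], which has
    a colour and a scalar [y]. Thus [x_i] is diagonal, and [tau_k] combines the
    values at [v] and at the arrangement with positions [k], [k+1] exchanged. For
    different colours only the product [cross b c * cross c b = Q_bc] matters; the
    orientation by strand number makes the coefficients along reduced words
    nonzero. *)
Section Representation.
Variables (I : finType) (P : zmodType) (C : cartan_datum I P).
Variables (K : idomainType) (gr : grading K) (Q : klr_parameters C gr).
Variables (n : nat) (beta : P).
Local Notation Ibeta := (weight_word C n.+1 beta).
Local Notation s_ k := (simple_transp n k).
Local Notation str k := (inord k : 'I_n.+1).
Variables (F : fieldType) (iota : {rmorphism K -> F}) (y : 'I_n.+1 -> F).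
Hypothesis y_inj : injective y.
Variable nu0 : Ibeta.
Local Notation Op := (linop_algebra 'S_n.+1 iota).
Implicit Types (v w : 'S_n.+1) (k l : 'I_n) (phi psi : 'S_n.+1 -> F) (b c d : 'I_n.+1).

Local Notation colour b := (letter nu0 b).

Definition ev2 (Qp : {mpoly K[2]}) (s t : F) : F :=
  mmap iota (fun z : 'I_2 => if z == ord0 then s else t) Qp.
Definition ev v (f : {mpoly K[n.+1]}) : F := mmap iota (fun i => y (v^-1%g i)) f.

Definition strand_Q b c : F := ev2 (Q (colour b) (colour c)) (y b) (y c).
Definition stay b c : F := if colour b == colour c then (y c - y b)^-1 else 0.
Definition cross b c : F :=
  if colour b == colour c then - (y c - y b)^-1
  else if (b < c)%N then strand_Q b c else 1.

Program Definition op_e (mu : Ibeta) : Op :=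
  @LinOp _ _ (fun phi v => (perm_word v nu0 == mu)%:R * phi v) _.
Next Obligation. ring. Qed.
Program Definition op_x (i : 'I_n.+1) : Op :=
  @LinOp _ _ (fun phi v => y (v^-1%g i) * phi v) _.
Next Obligation. ring. Qed.
Program Definition op_tau k : Op := @LinOp _ _ (fun phi v =>
  stay (v^-1%g (str k)) (v^-1%g (str k.+1)) * phi v +
  cross (v^-1%g (str k)) (v^-1%g (str k.+1)) * phi (v * s_ k)%g) _.
Next Obligation. ring. Qed.

Lemma ev_subst2 Qp v i j : ev v (subst2 Qp i j) = ev2 Qp (y (v^-1%g i)) (y (v^-1%g j)).
Proof.
elim/mpoly_gen_ind: Qp => [c|z|f g|f g]; rewrite /ev /subst2 /ev2.
- by rewrite comp_mpolyC !mmapC.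
- rewrite comp_mpolyXU mmapX mmap1U.
  by case: z => [[|[|]]] //= ?; rewrite mmapX mmap1U.
- by rewrite comp_mpolyD !mmapD => -> ->.
- by rewrite !rmorphM /= => -> ->.
Qed.

Lemma ev2_sym Qp s t : ev2 (msym (tperm ord0 ord_max) Qp) s t = ev2 Qp t s.
Proof.
elim/mpoly_gen_ind: Qp => [c|z|f g|f g]; rewrite /ev2.
- by rewrite /msym !mmapC.
- rewrite msym_var !mmapX !mmap1U.
  case: z => [[|[|]]] //= ?.
    by rewrite (_ : Ordinal _ = ord0) ?tpermL //; exact/val_inj.
  by rewrite (_ : Ordinal _ = ord_max) ?tpermR //; exact/val_inj.
- by rewrite msymD !mmapD => -> ->.
- by rewrite !rmorphM /= => -> ->.
Qed.

Lemma strand_QC b c : strand_Q b c = strand_Q c b.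
Proof. by rewrite /strand_Q klr_poly_sym ev2_sym. Qed.

Lemma cross_cross b c : colour b != colour c -> cross b c * cross c b = strand_Q b c.
Proof.
rewrite /cross => bc; rewrite [colour c == _]eq_sym (negbTE bc).
have : b != c by apply: contra bc => /eqP->.
rewrite -val_eqE /=; case: (ssrnat.ltngtP b c) => // lt _; rewrite ?mulr1 ?mul1r //.
exact: strand_QC.
Qed.

Lemma stay_same b c : colour b = colour c -> stay b c = (y c - y b)^-1.
Proof. by rewrite /stay => ->; rewrite eqxx. Qed.

Lemma stay_diff b c : colour b <> colour c -> stay b c = 0.
Proof. by rewrite /stay; case: eqP. Qed.

Lemma cross_same b c : colour b = colour c -> cross b c = - (y c - y b)^-1.
Proof. by rewrite /cross => ->; rewrite eqxx. Qed.

Lemma strand_Q_same b c : colour b = colour c -> strand_Q b c = 0.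
Proof. by rewrite /strand_Q => ->; rewrite klr_poly_diag /ev2 mmap0. Qed.

Lemma y_neq b c : b != c -> y c - y b != 0.
Proof. by rewrite subr_eq0 eq_sym (inj_eq y_inj). Qed.

Lemma transp_inv v k i : ((v * s_ k)^-1)%g i = v^-1%g (s_ k i).
Proof. by rewrite invMg permM transpV. Qed.

Lemma op_tauE k phi v : op_tau k phi v =
  stay (v^-1%g (str k)) (v^-1%g (str k.+1)) * phi v +
  cross (v^-1%g (str k)) (v^-1%g (str k.+1)) * phi (v * s_ k)%g.
Proof. by []. Qed.

Lemma op_tau_tau k phi v :
  op_tau k (op_tau k phi) v =
  (if colour (v^-1%g (str k)) == colour (v^-1%g (str k.+1)) then 0
   else strand_Q (v^-1%g (str k)) (v^-1%g (str k.+1))) * phi v.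
Proof.
rewrite !op_tauE !transp_inv transpl transpr transpMwr.
have : v^-1%g (str k) != v^-1%g (str k.+1) by rewrite (inj_eq perm_inj) str_neqS.
move: (v^-1%g (str k)) (v^-1%g (str k.+1)) => b c bc.
have ybc := y_neq bc; have ycb : y b - y c != 0 by rewrite -opprB oppr_eq0.
have [E|/negP/negP N] := boolP (colour b == colour c); last first.
  rewrite -(cross_cross N) /stay [colour c == _]eq_sym (negbTE N); ring.
rewrite /stay /cross [colour c == _]eq_sym E; field.
by rewrite ybc ycb.
Qed.

Lemma op_tau_x k (l : 'I_n.+1) phi v :
  op_tau k (op_x l phi) v - op_x (s_ k l) (op_tau k phi) v =
  (if colour (v^-1%g (str k)) == colour (v^-1%g (str k.+1)) then
     if l == str k then -1 else if l == str k.+1 then 1 else 0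
   else 0) * phi v.
Proof.
rewrite /= transp_inv.
have : v^-1%g (str k) != v^-1%g (str k.+1) by rewrite (inj_eq perm_inj) str_neqS.
have [->|lk] := eqVneq l (str k).
  rewrite transpl; move: (v^-1%g (str k)) (v^-1%g (str k.+1)) => b c /y_neq bc.
  rewrite /stay; case: eqP => _; [by field | ring].
have [->|lkS] := eqVneq l (str k.+1).
  rewrite transpr; move: (v^-1%g (str k)) (v^-1%g (str k.+1)) => b c /y_neq bc.
  rewrite /stay; case: eqP => _; [by field | ring].
have -> : s_ k l = l by rewrite /simple_transp tpermD // eq_sym.
by rewrite if_same mul0r => _; ring.
Qed.

Lemma op_tau_far k l phi v : (k.+1 < l)%N \/ (l.+1 < k)%N ->
  op_tau k (op_tau l phi) v = op_tau l (op_tau k phi) v.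
Proof.
move=> kl; have lk : (l.+1 < k)%N \/ (k.+1 < l)%N by case: kl; [right|left].
rewrite !op_tauE !transp_inv.
have [-> ->] := transp_far kl; have [-> ->] := transp_far lk.
rewrite -!mulgA (transp_comm kl); ring.
Qed.

(** Written out over the arrangements of three strands, the braid relation is an
    identity of rational functions of the scalars [y], one for each pattern of
    equal colours. *)
Lemma op_braid k l phi v (b := v^-1%g (str k)) (c := v^-1%g (str k.+1))
    (d := v^-1%g (str k.+2)) : l = k.+1 :> nat ->
  op_tau l (op_tau k (op_tau l phi)) v - op_tau k (op_tau l (op_tau k phi)) v =
  (if colour b == colour d then
     (strand_Q b c - ev2 (Q (colour d) (colour c)) (y d) (y c)) / (y b - y d)
   else 0) * phi v.
Proof.
move=> kl; rewrite !op_tauE !transp_inv.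
have Ek : str k.+1 = str l by rewrite kl.
have El : str k.+2 = str l.+1 by rewrite kl.
rewrite {}/c {}/d Ek El.
have kl1 : s_ k (str l) = str k by rewrite -Ek transpr.
have kl2 : s_ k (str k) = str l by rewrite -Ek transpl.
rewrite !(transp_next1 kl, transp_next2 kl, kl1, kl2, transpl, transpr).
rewrite -!mulgA (mulgA (s_ k) (s_ l) (s_ k)) transp_braid // !mulgA !transpMwr.
set vk := (v * s_ k)%g; set vl := (v * s_ l)%g.
have neq (i j : 'I_n.+1) : i != j -> v^-1%g i != v^-1%g j by rewrite (inj_eq perm_inj).
have bc : b != v^-1%g (str l) by apply: neq; rewrite -Ek str_neqS.
have cd : v^-1%g (str l) != v^-1%g (str l.+1) by apply: neq; rewrite str_neqS.
have bd : b != v^-1%g (str l.+1).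
  by apply: neq; rewrite -val_eqE /= str_val strS_val kl; lia.
move: bc cd bd; rewrite -/b; move: (v^-1%g (str l)) (v^-1%g (str l.+1)) => c d bc cd bd.
have neg_neq (s t : F) : s - t != 0 -> t - s != 0 by rewrite -(opprB t s) oppr_eq0.
have [y1 y2 y3] := And3 (y_neq bc) (y_neq cd) (y_neq bd).
have [y1' y2' y3'] := And3 (neg_neq _ _ y1) (neg_neq _ _ y2) (neg_neq _ _ y3).
rewrite -/(strand_Q d c).
move: (phi v) (phi vk) (phi vl) (phi (vk * s_ l)%g) (phi (vl * s_ k)%g)
  (phi (vl * s_ k * s_ l)%g) => p1 p2 p3 p4 p5 p6.
case: (colour b =P colour c) => Ebc.
  case: (colour c =P colour d) => Ecd.
    have Ebd := etrans Ebc Ecd.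
    rewrite Ebd eqxx !stay_same // !cross_same // !strand_Q_same //.
    field; rewrite y1 y2 y3 y1' y2' y3'.
    by [].
  have nbd : colour b <> colour d by rewrite Ebc.
  have nE : (colour b == colour d) = false by apply/eqP.
  rewrite nE (stay_diff Ecd) (stay_diff nbd) (stay_diff (not_eq_sym Ecd)).
  rewrite (stay_same Ebc) (cross_same Ebc); field.
  by rewrite y1.
case: (colour b =P colour d) => Ebd.
  have Ecd : colour c <> colour d by rewrite -Ebd => E; apply: Ebc.
  rewrite (strand_QC d c) -!cross_cross; try by apply/eqP.
  rewrite (stay_diff Ebc) (stay_diff (not_eq_sym Ebc)) (stay_diff Ecd) (stay_diff (not_eq_sym Ecd)).
  rewrite (stay_same Ebd) (cross_same Ebd); field.
  by rewrite y3 y3'.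
case: (colour c =P colour d) => Ecd.
  rewrite (stay_diff Ebc) (stay_diff (not_eq_sym Ebc)) (stay_diff Ebd).
  rewrite (stay_same Ecd) (stay_same (esym Ecd)) (cross_same Ecd); field.
  by rewrite y2.
rewrite (stay_diff Ebc) (stay_diff (not_eq_sym Ebc)) (stay_diff Ebd).
rewrite (stay_diff Ecd) (stay_diff (not_eq_sym Ecd)); ring.
Qed.
Lemma op_xx i j : op_x i * op_x j = op_x j * op_x i.
Proof. by apply: linop_eq => phi v /=; rewrite mulrCA. Qed.

Lemma op_evalE f phi v : mpoly_eval op_x f phi v = ev v f * phi v.
Proof.
elim/mpoly_gen_ind: f phi v => [c|i|f g Ef Eg|f g Ef Eg] phi v; rewrite /ev.
- by rewrite mpoly_evalC mmapC algebra_scaleE mulr1.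
- by rewrite mpoly_evalX mmapX mmap1U.
- by rewrite mpoly_evalD mmapD mulrDl -Ef -Eg.
- rewrite (mpoly_evalM op_xx) rmorphM /= -mulrA -Eg; exact: Ef.
Qed.

Lemma perm_word_transp v k mu :
  (perm_word (v * s_ k)%g nu0 == mu) = (perm_word v nu0 == perm_word (s_ k) mu).
Proof.
rewrite perm_wordM; apply/eqP/eqP=> [<-|->]; exact/esym/perm_wordK || by rewrite perm_wordK.
Qed.

Lemma letter_start v mu i : perm_word v nu0 = mu -> letter mu i = colour (v^-1%g i).
Proof. by move=> <-; rewrite letter_perm. Qed.

Lemma op_eE mu phi v : op_e mu phi v = if perm_word v nu0 == mu then phi v else 0.
Proof. by rewrite /=; case: eqP => _; rewrite /= ?mul1r ?mul0r. Qed.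

Lemma op_e_in mu phi v : perm_word v nu0 = mu -> op_e mu phi v = phi v.
Proof. by move=> E; rewrite op_eE E eqxx. Qed.

Lemma op_e_out mu phi v : perm_word v nu0 <> mu -> op_e mu phi v = 0.
Proof. by move=> N; rewrite op_eE; case: eqP. Qed.

Lemma op_relE (A B : Op) : klr_relation Q op_e op_x op_tau A B -> A = B.
Proof.
case=> [nu nu'||k l|k nu|l nu|k l kl|k nu|k l nu|k l nu kl].
- apply: linop_eq => phi v; rewrite [LHS]op_eE.
  case: (perm_word v nu0 =P nu) => [<-|N].
    by case: eqP => [<-//|N']; rewrite op_e_out.
  by case: ifP => _ //; rewrite op_e_out.
- apply: linop_eq => phi v; rewrite linop_sumE (bigD1 (perm_word v nu0)) //=.
  rewrite [X in X + _]op_e_in // big1 ?addr0 // => mu /eqP N.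
  by apply: op_e_out => E; apply: N.
- exact: op_xx.
- by apply: linop_eq => phi v /=; rewrite mulrCA.
- apply: linop_eq => phi v; rewrite [LHS]op_tauE [RHS]op_eE !op_eE perm_word_transp.
  rewrite op_tauE; case: (colour (v^-1%g (str l)) =P colour (v^-1%g (str l.+1))) => E.
    have Es : perm_word (s_ l) (perm_word v nu0) = perm_word v nu0.
      by apply: perm_word_same; rewrite !letter_perm.
    rewrite -[X in _ = if X == _ then _ else _]Es (can_eq (@perm_wordK _ _ _ _ _ l)).
    rewrite -[X in if X == perm_word _ _ then _ else _]Es (can_eq (@perm_wordK _ _ _ _ _ l)).
    by case: ifP => _ //; rewrite !mulr0 addr0.
  rewrite (stay_diff E) !mul0r !add0r.
  by case: ifP => _ //; rewrite mulr0.
- by apply: linop_eq => phi v; exact: op_tau_far.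
- apply: linop_eq => phi v; rewrite [LHS](op_tau_tau k (op_e nu phi) v) [RHS]op_evalE.
  case: (perm_word v nu0 =P nu) => [E|N]; last by rewrite op_e_out ?mulr0.
  congr (_ * _); rewrite ev_subst2 !(letter_start _ E); case: eqP => // E'.
  by rewrite E' klr_poly_diag /ev2 mmap0.
- apply: linop_eq => phi v; rewrite [LHS](op_tau_x k l (op_e nu phi) v).
  case: (perm_word v nu0 =P nu) => [E|N].
    rewrite !(letter_start _ E); do 3?case: ifP => _; rewrite ?mulN1r ?mul1r ?mul0r //.
  rewrite op_e_out // mulr0; do 3?case: ifP => _ //.
    by rewrite -[RHS]/(- (op_e nu phi v)) op_e_out ?oppr0.
  by rewrite op_e_out.
apply: linop_eq => phi v; rewrite [LHS](op_braid (op_e nu phi) v kl).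
case: (perm_word v nu0 =P nu) => [E|N]; last first.
  rewrite op_e_out // mulr0; case: ifP => _ //.
  by rewrite [RHS]op_evalE op_e_out ?mulr0.
rewrite !(letter_start _ E); case: eqP => [E'|_]; last by rewrite mul0r.
rewrite [RHS]op_evalE; congr (_ * _); rewrite -E'.
set N := (_ - _ : {mpoly K[n.+1]}).
have [h Eh] := subst2_diff (Q (colour (v^-1%g (str k))) (colour (v^-1%g (str k.+1))))
  (str k) (str k.+2) (str k.+1).
have dN : ('X_(str k) - 'X_(str k.+2) : {mpoly K[n.+1]}) != 0.
  by rewrite subr_eq0 mpolyX_inj -val_eqE /= str_val; have := strS_val l; rewrite kl => ->; lia.
have -> : exquo N ('X_(str k) - 'X_(str k.+2)) = h by apply: exquoP.
have yne : y (v^-1%g (str k)) - y (v^-1%g (str k.+2)) != 0.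
  apply: y_neq; rewrite (inj_eq perm_inj) -val_eqE /= str_val.
  by have := strS_val l; rewrite kl => ->; lia.
apply: (mulIf yne); rewrite mulfVK //.
have := congr1 (ev v) Eh; rewrite {1}/ev rmorphM /= -/(ev v h) mmapB !mmapX !mmap1U => ->.
by rewrite /ev mmapB -/(ev v _) -/(ev v _) !ev_subst2.
Qed.
Definition op_word (js : seq 'I_n) : Op := \prod_(j <- js) op_tau j.

Lemma op_word_cons j js phi v : op_word (j :: js) phi v = op_tau j (op_word js phi) v.
Proof. by rewrite /op_word big_cons. Qed.

(** A word moves the support by at most its length, and only a reduced word of
    [v] reaches [v] without spare letters. *)
Lemma op_word_far js phi v : (forall u, u <> 1%g -> phi u = 0) ->
  (size js <= inv_num v)%N -> v <> word_perm js -> op_word js phi v = 0.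
Proof.
move=> phi1; elim: js v => [|j js IH] v /=.
  by rewrite word_perm_nil /op_word big_nil => _ /phi1.
rewrite word_perm_cons => lt vj; rewrite op_word_cons op_tauE !IH ?mulr0 ?addr0 //.
- by have [[_ ->]|[_ E]] := inv_numL_cases j v; lia.
- by move=> E; apply: vj; rewrite -E transpMwr.
- exact: ltnW.
- by move=> E; move: lt; rewrite E ltnNge inv_num_word.
Qed.

Lemma op_word_lead js phi : (forall u, u <> 1%g -> phi u = 0) -> phi 1%g != 0 ->
  reduced js -> op_word js phi (word_perm js) != 0.
Proof.
move=> phi_supp phi1; elim: js => [|j js IH] r.
  by rewrite word_perm_nil /op_word big_nil.
rewrite op_word_cons op_tauE; have lt := reduced_head r; have rjs := reduced_tail r.
have Ew : (word_perm (j :: js) * s_ j)%g = word_perm js.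
  by rewrite word_perm_cons transpMwr.
have inv_w : inv_num (word_perm (j :: js)) = (size js).+1 by rewrite -r.
rewrite Ew (@op_word_far js) ?inv_w // ?mulr0 ?add0r; last first.
  by move=> E; move: inv_w; rewrite E -rjs; lia.
rewrite mulf_neq0 ?IH // /cross; case: ifP => _.
  by rewrite oppr_eq0 invr_eq0 y_neq // (inj_eq perm_inj) str_neqS.
by rewrite ltnNge (ltnW lt) oner_neq0.
Qed.
End Representation.

Section Independence.
Variables (I : finType) (P : zmodType) (C : cartan_datum I P).
Variables (K : idomainType) (gr : grading K) (Q : klr_parameters C gr).
Variables (n : nat) (beta : P).
Local Notation Ibeta := (weight_word C n.+1 beta).
Local Notation X := (mpoly_eval (@klr_x _ _ _ _ _ Q n beta)).

Local Notation F := {fraction {mpoly K[n.+1]}}.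

Let iota : {rmorphism K -> F} := @tofrac _ \o @mpolyC n.+1 K.
Let y (i : 'I_n.+1) : F := tofrac 'X_i.

Lemma ev1E f : ev iota y 1%g f = tofrac f.
Proof.
elim/mpoly_gen_ind: f => [c|i|f g Ef Eg|f g Ef Eg]; rewrite /ev.
- by rewrite mmapC.
- by rewrite mmapX mmap1U invg1 perm1.
- by rewrite mmapD -/(ev _ _ _ f) -/(ev _ _ _ g) Ef Eg rmorphD.
- by rewrite rmorphM /= -/(ev _ _ _ f) -/(ev _ _ _ g) Ef Eg rmorphM.
Qed.

(** With indeterminates for the scalars [y], the combination is applied to the
    indicator of the identity and evaluated at a permutation [w] of maximal length
    among those that occur: only the term of [w] contributes. *)
Lemma klr_independent (nu : Ibeta) (red : 'S_n.+1 -> seq 'I_n)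
    (f : 'S_n.+1 -> {mpoly K[n.+1]}) :
  (forall w, word_perm (red w) = w /\ reduced (red w)) ->
  \sum_w klr_tau_word Q beta (red w) * X (f w) * klr_e Q nu = 0 ->
  forall w, f w = 0.
Proof.
move=> redP sum0 w1; apply/eqP; apply: contraT => fw1.
have y_inj : injective y.
  by move=> i j /eqP; rewrite /y tofrac_eq mpolyX_inj => /eqP.
have [h [hZ hE hX hT]] := klr_morphism (@op_relE _ _ _ _ _ Q n beta F iota y y_inj nu).
have hXf g : h (X g) = mpoly_eval (op_x iota y) g.
  rewrite (mpoly_eval_map hZ); congr (mpoly_eval _ g); apply/funext => i; exact: hX.
have hw js : h (klr_tau_word Q beta js) = op_word Q iota y nu js.
  by rewrite /klr_tau_word rmorph_prod; apply: eq_bigr => j _; exact: hT.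
pose delta (v : 'S_n.+1) : F := (v == 1%g)%:R.
pose w := [arg max_(v > w1 | f v != 0) inv_num v].
have [fw wmax] : f w != 0 /\ forall v, f v != 0 -> (inv_num v <= inv_num w)%N.
  by rewrite /w; case: arg_maxnP.
have := congr1 (fun z => h z delta w) sum0.
rewrite rmorph_sum rmorph0 linop_sumE (bigD1 w) //= => Z.
have term v : h (klr_tau_word Q beta (red v) * X (f v) * klr_e Q nu) delta w =
    op_word Q iota y nu (red v)
      (fun u => ev iota y u (f v) * delta u) w.
  rewrite !rmorphM hw hXf hE.
  have -> : (op_word Q iota y nu (red v) * mpoly_eval (op_x iota y) (f v) *
      op_e iota nu nu) delta w =
    op_word Q iota y nu (red v) (mpoly_eval (op_x iota y) (f v) (op_e iota nu nu delta)) w by [].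
  congr (linop_fun _ _ w); apply/funext => u.
  rewrite [LHS]op_evalE op_eE /delta; congr (_ * _).
  by case: eqP => // N; case: eqP => // E; case: N; rewrite E perm_word1.
have supp v u : u <> 1%g -> ev iota y u (f v) * delta u = 0.
  by rewrite /delta => /eqP/negbTE->; rewrite mulr0.
move/eqP: Z; rewrite big1 ?addr0 => [|v vw].
  rewrite term => /eqP Z0; have [Ew rw] := redP w.
  have := @op_word_lead _ _ _ _ _ Q n beta F iota y y_inj nu (red w) _ (supp w).
  rewrite Ew Z0 eqxx => /(_ _ rw) absurd; apply: absurd.
  by rewrite /delta eqxx mulr1 ev1E tofrac_eq0.
rewrite term; have [fv0|fv] := eqVneq (f v) 0.
  have := linopP (op_word Q iota y nu (red v)) (-1) delta delta w.
  rewrite mulN1r addNr => Z0; rewrite -[RHS]Z0; congr (linop_fun _ _ w).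
  by apply/funext => u; rewrite fv0 /ev mmap0 mul0r mulN1r addNr.
have [Ev rv] := redP v; apply: op_word_far; first exact: supp.
  by rewrite rv Ev; exact: wmax.
by rewrite Ev => E; rewrite E eqxx in vw.
Qed.
End Independence.

(** * The cyclotomic ideal *)

Section CyclotomicIdeal.
Variables (I : finType) (P : zmodType) (C : cartan_datum I P).
Variables (K : idomainType) (gr : grading K) (Q : klr_parameters C gr).
Variables (n : nat) (beta : P).
Local Notation Ibeta := (weight_word C n.+1 beta).
Variables (A : algebra K) (e : Ibeta -> A) (x : 'I_n.+1 -> A) (tau : 'I_n -> A).
Hypothesis relE : forall a b, klr_relation Q e x tau a b -> a = b.
Hypothesis gen : klr_generated e x tau.
Variables (Lam : P) (a : cyclotomic_parameters C gr Lam) (prec : rel I).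
Variable nut : Ibeta.
Local Notation T := (tau_word tau).
Local Notation X := (mpoly_eval x).
Local Notation s_ k := (simple_transp n k).
Local Notation str k := (inord k : 'I_n.+1).
Local Notation sym k := (msym (simple_transp n k)).
Local Notation dd := (@divided_difference K n).
Local Notation g := (g_poly Q a prec).
Implicit Types (nu mu : Ibeta) (f h : {mpoly K[n.+1]}) (k l j : 'I_n)
  (js : seq 'I_n) (u z : A) (w : 'S_n.+1).

Hypothesis nut_sorted : forall b c, prec (letter nut b) (letter nut c) -> (b < c)%N.
Hypothesis prec_total : forall nu b c, letter nu b != letter nu c ->
  ~~ prec (letter nu c) (letter nu b) -> prec (letter nu b) (letter nu c).

Let Xe := klr_Xe relE.
Let te := klr_te relE.
Let tauX := klr_tauX relE.
Let Xtau := klr_Xtau relE.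
Let XM f h : X (f * h) = X f * X h := mpoly_evalM (klr_xx relE) _ _.
Let XC f h : X f * X h = X h * X f := mpoly_eval_comm (klr_xx relE) _ _.

Lemma letter_image w nu b : letter (perm_word w nu) (w b) = letter nu b.
Proof. by rewrite letter_perm permK. Qed.

Definition from_to nu w : Prop := perm_word w nu = nut.

Lemma corner_spanning red nu u :
  (forall w, word_perm (red w) = w /\ reduced (red w)) ->
  addspan (fun z => exists w f, from_to nu w /\ z = T (red w) * X f * e nu)
    (e nut * u * e nu).
Proof.
move=> redP; have := klr_spanning relE gen redP u.
elim=> [|y y' _ Hy _ Hy'|_ [w [f [mu ->]]]].
- by rewrite mulr0 mul0r; exact: Span0.
- by rewrite mulrDr mulrDl; exact: SpanD.
have [Ew _] := redP w.
rewrite !mulrA -[_ * e mu * _]mulrA (klr_ee relE); case: eqP => [->|_]; last first.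
  by rewrite mulr0; exact: Span0.
rewrite (e_tau_word relE) Ew -[T _ * _ * _]mulrA -Xe mulrA -mulrA (klr_ee relE).
case: eqP => [E|_]; last by rewrite mulr0; exact: Span0.
apply: SpanG; exists w, f; rewrite E; split=> //.
by rewrite /from_to -E -perm_wordM mulVg perm_word1.
Qed.

(** The strands at [k] and [k+1] are in the wrong order, so every permutation that
    sorts [nu] crosses them, and its reduced word may be chosen to begin, on the
    right, with this crossing. *)
Lemma corner_crossing (k : 'I_n) nu u :
  prec (letter nu (str k.+1)) (letter nu (str k)) ->
  addspan (fun z => exists u', z = e nut * u' * tau k * e nu) (e nut * u * e nu).
Proof.
move=> pk.
have /choice[red redP] : forall w, exists js, (word_perm js = w /\ reduced js) /\
    ((w (str k.+1) < w (str k))%N -> exists js', js = rcons js' k).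
  move=> w; have [lt|ge] := ltnP (w (str k.+1)) (w (str k)).
    by have [js H] := reduced_exists_last lt; exists (rcons js k); split=> // _; exists js.
  by have [js H] := reduced_exists w; exists js.
have redP' w : word_perm (red w) = w /\ reduced (red w) by have [] := redP w.
have H : e nut * u * e nu = e nut * (e nut * u * e nu).
  by rewrite !mulrA (klr_ee1 relE).
rewrite H; apply: addspan_mull (corner_spanning nu u redP') => _ [w [f [wnu ->]]].
have [_ /(_ _)[|js ->]] := redP w.
  by apply: nut_sorted; rewrite -wnu !letter_image.
have N : (letter nu (str k) == letter nu (str k.+1)) = false.
  apply/eqP => E; have := nut_sorted (b := w (str k.+1)) (c := w (str k.+1)).
  by rewrite -wnu letter_image -{2}E => /(_ pk); rewrite ltnn.
apply: SpanG; exists (T js * X (sym k f)).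
rewrite tau_word_rcons -!mulrA; congr (_ * (_ * _)).
by rewrite !mulrA tauX /colour_dd N mpoly_eval0 mul0r addr0.
Qed.

Definition cyclotomic_sum : A :=
  \sum_(nu : Ibeta) poly_eval (x ord0) (a (letter nu ord0)) * e nu.

Definition cyclotomic_ideal z : Prop := two_sided_ideal (fun y : A => y = cyclotomic_sum) z.

Lemma cyc_ideal0 : cyclotomic_ideal 0.
Proof. exact: Ideal0. Qed.

Lemma cyc_idealD y z : cyclotomic_ideal y -> cyclotomic_ideal z -> cyclotomic_ideal (y + z).
Proof. exact: IdealD. Qed.

Lemma cyc_idealMl u z : cyclotomic_ideal z -> cyclotomic_ideal (u * z).
Proof. exact: Defs.idealMl. Qed.

Lemma cyc_idealMr u z : cyclotomic_ideal z -> cyclotomic_ideal (z * u).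
Proof. exact: Defs.idealMr. Qed.

Lemma cyc_idealB y z : cyclotomic_ideal y -> cyclotomic_ideal z -> cyclotomic_ideal (y - z).
Proof.
by move=> Hy Hz; apply: cyc_idealD => //; rewrite -mulN1r; exact: cyc_idealMl.
Qed.

Lemma cyc_ideal_span (G : A -> Prop) z :
  (forall y, G y -> cyclotomic_ideal y) -> addspan G z -> cyclotomic_ideal z.
Proof.
by move=> GI; elim=> [|y y' _ Hy _ Hy'|y /GI//]; [exact: cyc_ideal0|exact: cyc_idealD].
Qed.

Lemma cyclotomic_sum_e nu : cyclotomic_sum * e nu = X (g 0 nu) * e nu.
Proof.
rewrite /cyclotomic_sum mulr_suml (bigD1 nu) //= -mulrA (klr_ee1 relE) big1 ?addr0.
  congr (_ * _); rewrite horner_coef mpoly_eval_sum /poly_eval.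
  rewrite size_map_inj_poly ?mpolyC0 //; last by move=> c d /eqP; rewrite mpolyC_eq => /eqP.
  apply: eq_bigr => i _; rewrite coef_map /= mul_mpolyC mpoly_evalZ; congr (_ *: _).
  elim: (i : nat) => [|d IH]; first by rewrite !expr0 mpoly_eval1.
  by rewrite !exprS XM (mpoly_evalX) IH.
by move=> mu /negbTE mn; rewrite -mulrA (klr_ee relE) mn mulr0.
Qed.

(** The letters [tau_j] with [j > 0] fix the first strand, where the cyclotomic
    polynomials live. *)
Lemma cyclotomic_sum_tau (j : 'I_n) : (0 < j)%N ->
  cyclotomic_sum * tau j = tau j * cyclotomic_sum.
Proof.
move=> j0; rewrite [LHS](klr_1e relE) [RHS](klr_1e relE); apply: eq_bigr => nu _.
rewrite -!mulrA te cyclotomic_sum_e !mulrA cyclotomic_sum_e -mulrA -te mulrA Xtau.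
rewrite g_poly_transp // g_poly_sym // /colour_dd dd_sym0 ?g_poly_sym //.
by rewrite if_same mpoly_eval0 mul0r subr0.
Qed.

(** By induction along the recursion for [g], with [g] the polynomial of index [k].
    For equal colours, [tau_k g tau_k = d_k(g) tau_k] puts [d_k(g) tau_k] in the
    ideal, and [1 = tau_k x_{k+1} - x_k tau_k] recovers [d_k(g)]. For colours in
    increasing order [tau_k g tau_k] is [s_k(g) Q]. For colours in decreasing order
    the factor [Q] is avoided, because every element of [e(nut) R e(nu)] already
    ends with [tau_k]. *)
Lemma g_poly_in_ideal (k : nat) nu u : (k <= n)%N ->
  cyclotomic_ideal (e nut * u * X (g k nu) * e nu).
Proof.
move=> le_kn; elim/g_poly_ind: le_kn nu u => [|{}k IH] nu u.
  by rewrite -mulrA -cyclotomic_sum_e mulrA; apply: IdealM.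
rewrite g_polyS /=; case: eqP => [E|/eqP N].
  set d := dd k _.
  have nuk := perm_word_same E.
  have comm : tau k * e nu = e nu * tau k by rewrite te nuk.
  have tt0 : tau k * tau k * e nu = 0.
    by rewrite (klr_t2 relE) E klr_poly_diag /subst2 comp_mpoly0 mpoly_eval0 mul0r.
  have dtau : X d * tau k * e nu = tau k * X (g k nu) * tau k * e nu.
    rewrite -[RHS]mulrA comm mulrA tauX /colour_dd E eqxx mulrDl.
    rewrite -!mulrA -comm [tau k * (tau k * _)]mulrA tt0 mulr0 add0r.
    by [].
  have I1 u' : cyclotomic_ideal (e nut * u' * X d * tau k * e nu).
    have -> : e nut * u' * X d * tau k * e nu =
        (e nut * (u' * tau k) * X (g k nu) * e nu) * tau k.
      by rewrite -!mulrA [X d * _]mulrA dtau -!mulrA comm.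
    by apply: cyc_idealMr; exact: IH.
  have unit : e nu = tau k * X ('X_(str k.+1)) * e nu - X ('X_(str k)) * tau k * e nu.
    by rewrite tauX /colour_dd E eqxx msym_var transpr ddXS mpoly_eval1 mul1r addrC addKr.
  have -> : e nut * u * X d * e nu =
      (e nut * u * X d * tau k * e nu) * X ('X_(str k.+1)) -
      e nut * (u * X ('X_(str k))) * X d * tau k * e nu.
    rewrite {1}unit mulrBr; congr (_ - _).
      by rewrite -!mulrA Xe.
    rewrite -!mulrA; congr (_ * (_ * _)).
    by rewrite !mulrA XC.
  by apply: cyc_idealB; [apply: cyc_idealMr|]; exact: I1.
have Nf : (letter nu (str k) == letter nu (str k.+1)) = false by apply/negbTE.
set g' := g k (perm_word (s_ k) nu).
case: ifP => [pk|_].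
  rewrite -mulrA Xe mulrA; apply: cyc_ideal_span (addspan_mulr _ (corner_crossing u pk)).
    by move=> y; exact.
  move=> _ [u' ->]; apply: SpanG.
  have -> : e nut * u' * tau k * e nu * X (sym k g') =
      (e nut * u' * X g' * e (perm_word (s_ k) nu)) * tau k.
    rewrite -!mulrA -te -Xe; congr (_ * (_ * _)).
    by rewrite [LHS]mulrA tauX /colour_dd Nf mpoly_eval0 mul0r addr0 symK mulrA.
  by apply: cyc_idealMr; exact: IH.
have E1 : tau k * X g' * e (perm_word (s_ k) nu) * tau k =
    X (sym k g') * (tau k * tau k * e nu).
  rewrite tauX /colour_dd !letter_transp transpl transpr eq_sym Nf.
  by rewrite mpoly_eval0 mul0r addr0 -!mulrA te.
have -> : e nut * u * X (sym k g' * subst2 (Q (letter nu (str k)) (letter nu (str k.+1)))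
      (str k) (str k.+1)) * e nu =
    (e nut * (u * tau k) * X g' * e (perm_word (s_ k) nu)) * tau k.
  rewrite XM -!mulrA -(klr_t2 relE) -E1 -!mulrA.
  by [].
by apply: cyc_idealMr; exact: IH.
Qed.
Definition g_span (k : nat) nu : A -> Prop := addspan (fun z =>
  exists (j : nat) u, (j <= k)%N /\ z = e nut * u * X (g j nu) * e nu).

Lemma g_spanG (k j : nat) nu u : (j <= k)%N -> g_span k nu (e nut * u * X (g j nu) * e nu).
Proof. by move=> jk; apply: SpanG; exists j, u. Qed.

Lemma g_spanB (k : nat) nu y z : g_span k nu y -> g_span k nu z -> g_span k nu (y - z).
Proof.
move=> Hy Hz; apply: SpanD => //; apply: addspanN Hz => _ [j [u [jk ->]]].
by exists j, (- u); split=> //; rewrite mulrN !mulNr.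
Qed.

Lemma g_span_X (k : nat) nu f z : g_span k nu z -> g_span k nu (z * X f).
Proof.
apply: addspan_mulr => _ [j [u [jk ->]]]; apply: SpanG.
by exists j, (u * X f); split=> //; rewrite -!mulrA -Xe ![X _ * (X _ * _)]mulrA XC.
Qed.

(** Crossing the strands [k] and [k+1] carries the polynomials of [s_k nu] into
    the ideal of those of [nu]; for equal colours this is
    [s_k(g) = g - d_k(g) (x_{k+1} - x_k)], and for colours in increasing order a
    second crossing is split off to produce the factor [Q]. *)
Lemma g_span_tau (k : 'I_n) nu z : g_span k (perm_word (s_ k) nu) z ->
  g_span k.+1 nu (z * tau k * e nu).
Proof.
rewrite -mulrA; apply: addspan_mulr => _ [j [u [jk ->]]].
set mu := perm_word (s_ k) nu.
have -> : e nut * u * X (g j mu) * e mu * (tau k * e nu) =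
    e nut * u * (X (g j mu) * tau k * e nu).
  rewrite (te k nu) -/mu -[_ * e mu * _]mulrA [e mu * (_ * _)]mulrA (klr_ee1 relE).
  by rewrite -te -!mulrA.
rewrite Xtau; case: (ltnP j k) => [lt|ge].
  have gE : g j mu = g j nu by exact: g_poly_transp.
  rewrite gE g_poly_sym // /colour_dd dd_sym0 ?g_poly_sym // if_same mpoly_eval0 mul0r subr0.
  by rewrite !mulrA -[e nut * u * tau k]mulrA; apply: g_spanG; exact: leqW.
have -> : j = k by apply/eqP; rewrite eqn_leq jk ge.
have G_span u' : g_span k.+1 nu (e nut * u' * X (g k.+1 nu) * e nu) by exact: g_spanG.
have := g_polyS Q a prec k nu; move: (g k.+1 nu) G_span => G G_span.
rewrite /= /colour_dd -/mu.
case: eqP => [E|/eqP N] gS.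
  have nuk : mu = nu := perm_word_same E.
  rewrite nuk dd_sym mpoly_evalN mulNr opprK sym_ddE; set d := dd k (g k nu).
  have Gd u' : g_span k.+1 nu (e nut * u' * X d * e nu).
    by rewrite /d -gS; exact: G_span.
  rewrite mpoly_evalB XM XC mulrBr mulrBl mulrDr mulrBr.
  apply: SpanD; first apply: g_spanB.
  - by rewrite !mulrA -[e nut * u * tau k]mulrA; apply: g_spanG.
  - rewrite !mulrA -[e nut * u * tau k]mulrA -[e nut * (u * tau k) * X _]mulrA.
    exact: Gd.
  - by rewrite !mulrA; exact: Gd.
rewrite mpoly_eval0 mul0r subr0.
case: ifP gS => [pk|/negbT pk] gS.
  by rewrite -gS !mulrA -[e nut * u * tau k]mulrA; exact: G_span.
have pk' : prec (letter mu (str k.+1)) (letter mu (str k)).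
  by rewrite /mu !letter_transp transpl transpr; exact: prec_total.
have -> : e nut * u * (tau k * X (sym k (g k mu)) * e nu) =
    e nut * u * e mu * (tau k * X (sym k (g k mu)) * e nu).
  rewrite -!mulrA [X (sym _ _) * _]Xe; congr (_ * (_ * _)).
  by rewrite [tau k * (_ * _)]mulrA te !mulrA (klr_ee1 relE).
apply: addspan_mulr (corner_crossing u pk') => _ [u' ->].
have E2 : tau k * e mu * (tau k * X (sym k (g k mu)) * e nu) = X G * e nu.
  rewrite gS mulrC XM -[tau k * X _ * e nu]mulrA Xe [tau k * (e nu * _)]mulrA (te k nu) -/mu.
  rewrite !mulrA -[tau k * e mu * e mu]mulrA (klr_ee1 relE) -[tau k * e mu * tau k]mulrA.
  by rewrite -(te k nu) mulrA (klr_t2 relE) -!mulrA -Xe.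
have -> : e nut * u' * tau k * e mu * (tau k * X (sym k (g k mu)) * e nu) =
    e nut * u' * X G * e nu by rewrite -[LHS]mulrA -[LHS]mulrA [tau k * (_ * _)]mulrA E2 !mulrA.
exact: G_span.
Qed.

Lemma cyclotomic_sum_word_span (k : nat) nu u : (k <= n)%N ->
  g_span k nu (e nut * u * cyclotomic_sum * T (first_letters n k) * e nu).
Proof.
move=> le_kn; elim/g_poly_ind: le_kn nu u => [|{}k IH] nu u.
  rewrite /first_letters take0 tau_word_nil mulr1 -mulrA cyclotomic_sum_e mulrA.
  exact: g_spanG.
rewrite first_lettersS tau_word_rcons !mulrA -mulrA te.
rewrite -(klr_ee1 relE (perm_word _ _)) -[e _ * e _ * tau k]mulrA -te !mulrA.
exact: g_span_tau.
Qed.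

(** Writing the right factor of an element of the ideal in words
    [js ++ first_letters], the letters of [js] commute with the generator of the
    ideal and are absorbed on the left. *)
Lemma cyclotomic_ideal_span nu z :
  cyclotomic_ideal z -> g_span n nu (e nut * z * e nu).
Proof.
elim=> [|y y' _ Hy _ Hy'|u s b ->{s}].
- by rewrite mulr0 mul0r; exact: Span0.
- by rewrite mulrDr mulrDl; exact: SpanD.
have /choice[red redP] := @reduced_coset n.
have redP' w : word_perm (red w ++ first_letters n (w^-1 ord0)%g) = w /\
    reduced (red w ++ first_letters n (w^-1 ord0)%g) by have [] := redP w.
have sT js : (forall j, j \in js -> (0 < j)%N) ->
    cyclotomic_sum * T js = T js * cyclotomic_sum.
  elim: js => [_|j js IHjs Hj]; first by rewrite tau_word_nil mul1r mulr1.
  rewrite tau_word_cons mulrA cyclotomic_sum_tau ?Hj ?mem_head // -!mulrA IHjs //.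
  by move=> i ijs; apply: Hj; rewrite inE ijs orbT.
have -> : e nut * (u * cyclotomic_sum * b) * e nu = (e nut * u * cyclotomic_sum) * (b * e nu).
  by rewrite !mulrA.
elim: (klr_spanning relE gen redP' b) => [|y y' _ Hy _ Hy'|_ [w [f [mu ->]]]].
- by rewrite mul0r mulr0; exact: Span0.
- by rewrite mulrDl mulrDr; exact: SpanD.
rewrite -[_ * e mu * e nu]mulrA (klr_ee relE); case: eqP => [->|_]; last first.
  by rewrite !mulr0; exact: Span0.
have [js0 _ _] := redP w.
have -> : e nut * u * cyclotomic_sum *
    (T (red w ++ first_letters n (w^-1 ord0)%g) * X f * e nu) =
  (e nut * (u * T (red w)) * cyclotomic_sum * T (first_letters n (w^-1 ord0)%g) * e nu) * X f.
  rewrite tau_word_cat -!mulrA -Xe; congr (_ * (_ * _)); rewrite !mulrA.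
  by rewrite sT.
apply: g_span_X; have le_n : (w^-1%g ord0 <= n)%N by rewrite -ltnS ltn_ord.
apply: addspan_sub (cyclotomic_sum_word_span nu (u * T (red w)) le_n).
by move=> _ [j [u' [jk ->]]]; apply: g_spanG; exact: leq_trans le_n.
Qed.

(** Since [e(nut) R e(nu)] is spanned over the polynomials by the reduced words
    sorting [nu], so is its intersection with the ideal, over the ideal of the
    polynomials [g]. *)
Lemma cyclotomic_ideal_normal red nu z :
  (forall w, word_perm (red w) = w /\ reduced (red w)) -> cyclotomic_ideal z ->
  addspan (fun y => exists w f, [/\ from_to nu w,
      in_ideal (fun k : 'I_n.+1 => g k nu) f & y = T (red w) * X f * e nu])
    (e nut * z * e nu).
Proof.
move=> redP Hz; apply: addspan_sub (cyclotomic_ideal_span nu Hz) => _ [j [u [jn ->]]].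
rewrite -mulrA Xe mulrA.
apply: addspan_mulr (corner_spanning nu u redP) => _ [w [f [wnu ->]]].
apply: SpanG; exists w, (f * g j nu); split=> //.
  have -> : j = (str j : nat) by rewrite inordK.
  exact: (@in_ideal_gen _ _ (fun k : 'I_n.+1 => g k nu) (str j)).
by rewrite -!mulrA -Xe XM !mulrA.
Qed.

Lemma normal_in_ideal w js f nu : word_perm js = w -> from_to nu w ->
  in_ideal (fun k : 'I_n.+1 => g k nu) f -> cyclotomic_ideal (T js * X f * e nu).
Proof.
move=> Ew wnu [c ->].
have corner f' : e nut * (T js * X f' * e nu) = T js * X f' * e nu.
  rewrite !mulrA (e_tau_word relE) Ew -wnu -perm_wordM mulgV perm_word1.
  by rewrite -[T js * e nu * X f']mulrA -Xe mulrA -mulrA (klr_ee1 relE).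
rewrite mpoly_eval_sum mulr_sumr mulr_suml.
elim/big_ind: _ => [||k _]; [exact: cyc_ideal0|exact: cyc_idealD|].
rewrite -corner XM !mulrA -[e nut * T js * X (c k)]mulrA.
by apply: g_poly_in_ideal; rewrite -ltnS.
Qed.

Lemma collect_normal red nu (Pf : {mpoly K[n.+1]} -> Prop) z :
  Pf 0 -> (forall f h, Pf f -> Pf h -> Pf (f + h)) ->
  addspan (fun y => exists w f, [/\ from_to nu w, Pf f & y = T (red w) * X f * e nu]) z ->
  exists F : 'S_n.+1 -> {mpoly K[n.+1]}, [/\ forall w, Pf (F w),
    forall w, ~ from_to nu w -> F w = 0 & z = \sum_w T (red w) * X (F w) * e nu].
Proof.
move=> P0 PD; elim=> [|y y' _ [F [PF F0 ->]] _ [F' [PF' F0' ->]]|_ [w [f [wnu Pf' ->]]]].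
- exists (fun=> 0); split=> //; rewrite big1 // => w _.
  by rewrite mpoly_eval0 mulr0 mul0r.
- exists (fun w => F w + F' w); split=> [w|w wnu|]; first exact: PD.
    by rewrite F0 // F0' // addr0.
  rewrite -big_split; apply: eq_bigr => w _.
  by rewrite mpoly_evalD mulrDr mulrDl.
exists (fun v => if v == w then f else 0); split=> [v|v vnu|]; first by case: ifP.
  by case: eqP => // E; case: vnu; rewrite E.
rewrite (bigD1 w) //= eqxx big1 ?addr0 // => v /negbTE->.
by rewrite mpoly_eval0 mulr0 mul0r.
Qed.
End CyclotomicIdeal.

(** * The basis *)

Section CyclotomicBasis.
Variables (I : finType) (P : zmodType) (C : cartan_datum I P).
Variables (K : idomainType) (gr : grading K) (Q : klr_parameters C gr).
Variables (n : nat) (beta : P).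
Local Notation Ibeta := (weight_word C n.+1 beta).
Variables (A : algebra K) (e : Ibeta -> A) (x : 'I_n.+1 -> A) (tau : 'I_n -> A).
Hypothesis relE : forall a b, klr_relation Q e x tau a b -> a = b.
Hypothesis gen : klr_generated e x tau.
Variables (Lam : P) (a : cyclotomic_parameters C gr Lam) (prec : rel I).
Variables (nut nu : Ibeta).
Local Notation T := (tau_word tau).
Local Notation X := (mpoly_eval x).
Local Notation g := (g_poly Q a prec).
Hypothesis nut_sorted : forall b c, prec (letter nut b) (letter nut c) -> (b < c)%N.
Hypothesis prec_total : forall (nu : Ibeta) b c, letter nu b != letter nu c ->
  ~~ prec (letter nu c) (letter nu b) -> prec (letter nu b) (letter nu c).
Variable red : 'S_n.+1 -> seq 'I_n.
Hypothesis redP : forall w, word_perm (red w) = w /\ reduced (red w).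
Hypothesis independent : forall f : 'S_n.+1 -> {mpoly K[n.+1]},
  \sum_w T (red w) * X (f w) * e nu = 0 -> forall w, f w = 0.

Local Notation S := (fun z : A => z = cyclotomic_sum e x a).
Local Notation proj := (canonical_image S).
Local Notation N_ := (leading_degree Q a prec nu).
Local Notation from_to w := (perm_word w nu = nut).
Local Notation ideal := (cyclotomic_ideal e x a).

Let xmon (m : 'X_{1..n.+1}) : A := \prod_(k < n.+1) x k ^+ m k.

Lemma proj_eq0 z : proj z = 0 <-> ideal z.
Proof.
have := @quot_pi_eq _ S z 0; rewrite subr0 -/(proj z).
by have -> : quot_pi S 0 = 0 by exact: raddf0.
Qed.

Lemma e_sorting w f : from_to w -> e nut * (T (red w) * X f * e nu) = T (red w) * X f * e nu.
Proof.
move=> wnu; have [Ew _] := redP w.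
rewrite !mulrA (e_tau_word relE) Ew -wnu -perm_wordM mulgV perm_word1.
by rewrite -[T _ * e nu * X f]mulrA -(klr_Xe relE) mulrA -mulrA (klr_ee1 relE).
Qed.

(** In the first case some [g] is a unit, there is no admissible exponent and the
    corner of the quotient vanishes. *)
Lemma g_poly_lead_all :
  (exists k : 'I_n.+1, N_ k = 0%N /\ forall z, ideal (e nut * z * e nu)) \/
  (forall k : 'I_n.+1, unit_lead k (N_ k) (g k nu)).
Proof.
have leadN (k : 'I_n.+1) N : unit_lead k N (g k nu) -> N_ k = N.
  by move=> H; rewrite /leading_degree (unit_lead_deg H).
have [[k H]|no] := pselect (exists k : 'I_n.+1, unit_lead k 0 (g k nu)).
  left; exists k; split=> [|z]; first exact: leadN.
  have [u [low [[v vu] Eg /deg_lt0 low0]]] := H.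
  have gE : g k nu = u%:MP by rewrite Eg low0 addr0 expr0 -mul_mpolyC mulr1.
  have := g_poly_in_ideal relE gen a nut_sorted nu (v *: z) (ltn_ord k : (k <= n)%N).
  rewrite gE mpoly_evalC -algebra_scaleAr mulr1 -algebra_scaleAr.
  by rewrite scalerA [u * v]mulrC vu scale1r.
right=> k; have [[N H]|[j jk H]] := g_poly_lead Q a prec nu (ltn_ord k : (k <= n)%N).
  by rewrite inord_val in H; rewrite (leadN _ _ H).
case: no; exists (inord j); rewrite inordK //.
exact: ltn_trans jk (ltn_ord k).
Qed.

Lemma cyclotomic_basis :
  is_basis
    (fun wm : 'S_n.+1 * 'X_{1..n.+1} =>
       from_to wm.1 /\ forall k : 'I_n.+1, (wm.2 k < N_ k)%N)
    (fun wm => proj (T (red wm.1) * xmon wm.2 * e nu))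
    (corner (proj (e nut)) (proj (e nu))).
Proof.
have xmonE m : xmon m = X 'X_[m] by rewrite mpoly_evalXm.
have g_free (k j : 'I_n.+1) : (k < j)%N -> deg_lt j 1 (g k nu).
  by apply: g_poly_free; rewrite -ltnS ltn_ord.
have projM y z t : proj y * proj z * proj t = proj (y * z * t).
  by rewrite /canonical_image; apply/esym; rewrite [LHS]rmorphM; congr (_ * _); exact: rmorphM.
split.
- move=> [w m] [/= wnu _]; exists (proj (T (red w) * xmon m * e nu)).
  by rewrite projM /= xmonE e_sorting // -[in RHS]mulrA (klr_ee1 relE).
- move=> s c uniq_s sD sum0 [w m] wms.
  have [[k [Nk0 _]]|lead] := g_poly_lead_all.
    by have [_ /(_ k)] := sD _ wms; rewrite Nk0.
  pose G v := \sum_(wm <- s | wm.1 == v) c wm *: ('X_[wm.2] : {mpoly K[n.+1]}).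
  pose z := \sum_v T (red v) * X (G v) * e nu.
  have zE : z = \sum_(wm <- s) c wm *: (T (red wm.1) * xmon wm.2 * e nu).
    rewrite [RHS](partition_big (fun wm => wm.1) predT) //=; apply: eq_bigr => v _.
    rewrite mpoly_eval_sum mulr_sumr mulr_suml; apply: eq_bigr => wm /eqP <-.
    by rewrite mpoly_evalZ -algebra_scaleAr -algebra_scaleAl xmonE.
  have Iz : ideal z.
    apply/proj_eq0; rewrite zE -sum0 /canonical_image raddf_sum.
    by apply: eq_bigr => wm _; rewrite -canonical_imageZ.
  have ez : e nut * z * e nu = z.
    rewrite -mulrA mulr_suml mulr_sumr; apply: eq_bigr => v _.
    rewrite -[_ * e nu * e nu]mulrA (klr_ee1 relE).
    have [vnu|vnu] := pselect (from_to v); first exact: e_sorting.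
    have -> : G v = 0.
      rewrite /G big_seq_cond big1 // => wm /andP[/sD[+ _] /eqP E].
      by rewrite E.
    by rewrite mpoly_eval0 mulr0 mul0r mulr0.
  have Hz := cyclotomic_ideal_normal relE gen nut_sorted prec_total nu redP Iz.
  rewrite ez in Hz.
  have [F [FI _ zF]] := collect_normal (@in_ideal0 _ _ _) (@in_idealD _ _ _) Hz.
  have GF v : G v = F v.
    apply/eqP; rewrite -subr_eq0; apply/eqP.
    apply: (independent (f := fun v => G v - F v)); rewrite -[RHS](subrr z) {2}zF -sumrB.
    by apply: eq_bigr => u _; rewrite mpoly_evalB mulrBr mulrBl.
  have Gw : G w = 0.
    apply: (triangular_unique lead g_free); first by rewrite GF; exact: FI.
    move=> k; rewrite /G big_seq_cond; apply: deg_lt_sum => wm /andP[/sD[_ Hk] _].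
    by apply: deg_ltZ; apply: deg_lt_X.
  have := congr1 (fun f => f@_m) Gw; rewrite mcoeff0 => <-.
  rewrite /G raddf_sum /= big_mkcond (bigD1_seq (w, m)) //= eqxx mcoeffZ mcoeffX eqxx mulr1.
  rewrite big1 ?addr0 // => -[w' m'] /= ne; case: eqP => // Ew.
  rewrite mcoeffZ mcoeffX; case: eqP => [Em|_]; last by rewrite mulr0.
  by rewrite Ew Em eqxx in ne.
move=> _ [r ->]; have [z <-] := quot_pi_surj_gen r.
rewrite projM; have [[k [_ all0]]|lead] := g_poly_lead_all.
  by exists [::], (fun=> 0); split=> //; rewrite big_nil; apply/proj_eq0/all0.
have := corner_spanning relE gen nut nu z redP.
have -> : (fun z => exists w f, Defs.perm_word w nu = nut /\ z = T (red w) * X f * e nu) =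
  (fun z => exists w f, [/\ from_to w, True & z = T (red w) * X f * e nu]).
  apply/funext => y; apply/propext; split=> [[w [f [? ?]]]|[w [f [? _ ?]]]]; by exists w, f.
move=> Hz.
have [G [_ G0 ->]] := collect_normal (Pf := fun=> True) Logic.I (fun _ _ _ _ => Logic.I) Hz.
have /fin_all_exists[r_ rP] : forall w, exists f, (~ from_to w -> f = 0) /\
    (forall k, deg_lt k (N_ k) f) /\ ideal (T (red w) * X (G w) * e nu - T (red w) * X f * e nu).
  move=> w; have [wnu|wnu] := pselect (from_to w); last first.
    exists 0; split=> //; split=> [k|]; first exact: deg_lt_zero.
    by rewrite G0 // subrr; exact: cyc_ideal0.
  have [f' [f [If' -> Hf]]] := triangular_reduce lead g_free (G w).
  exists f; split=> //; split=> //; rewrite mpoly_evalD mulrDr mulrDl addrK.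
  have [Ew _] := redP w.
  exact: (normal_in_ideal relE gen nut_sorted Ew wnu If').
exists [seq (w, m) | w <- enum 'S_n.+1, m <- msupp (r_ w)], (fun wm => (r_ wm.1)@_wm.2).
split=> [wm /allpairsPdep[w [m [_ mr ->]]] /=|].
  have [r0 [Hk _]] := rP w; split; last by move=> k; exact: Hk.
  by apply: contrapT => /r0 E; rewrite E msupp0 in mr.
rewrite big_allpairs_dep /= big_enum.
have projD y y' : ideal (y - y') -> proj y = proj y'.
  by move=> /proj_eq0; rewrite /canonical_image raddfB => /eqP; rewrite subr_eq0 => /eqP.
rewrite (projD _ (\sum_w T (red w) * X (r_ w) * e nu)); last first.
  rewrite -sumrB; elim/big_ind: _ => [||w _]; [exact: cyc_ideal0|exact: cyc_idealD|].
  by have [_ []] := rP w.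
rewrite /canonical_image raddf_sum; apply: eq_bigr => w _.
rewrite /mpoly_eval mulr_sumr mulr_suml raddf_sum; apply: eq_bigr => m _.
by rewrite -algebra_scaleAr -algebra_scaleAl -canonical_imageZ.
Qed.
End CyclotomicBasis.

Section WeightWords.
Variables (I : finType) (P : zmodType) (C : cartan_datum I P).

(** The simple roots are independent, so the weight determines the
    multiplicities of the letters. *)
Lemma weight_word_perm n beta (nu nu' : weight_word C n beta) :
  perm_eq (val nu) (val nu').
Proof.
have sumE (t : n.-tuple I) : \sum_(k < n) simple_root C (tnth t k) =
    \sum_i simple_root C i *~ (count_mem i t)%:Z.
  rewrite -(big_tuple _ _ t predT (simple_root C)).
  rewrite (eq_bigr (fun j => \sum_i simple_root C i *+ (i == j))); last first.
    move=> j _; rewrite (bigD1 j) //= eqxx big1 ?addr0 // => i /negbTE-> //.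
  rewrite exchange_big; apply: eq_bigr => i _ /=.
  rewrite sumrMnr -sum1_count [in RHS]big_mkcond /=; congr (_ *+ _).
  by apply: eq_bigr => j _; rewrite eq_sym; case: eqP.
have H : \sum_i simple_root C i *~
    ((count_mem i (val nu))%:Z - (count_mem i (val nu'))%:Z) = 0.
  under eq_bigr do rewrite mulrzBr.
  rewrite sumrB -!sumE; case: nu nu' => [nu /= /eqP ->] [nu' /= /eqP ->].
  exact: subrr.
apply/allP => i _ /=; have := simple_root_free H i.
by move/eqP; rewrite subr_eq0 eqz_nat.
Qed.

Lemma listing_order_irrefl p (i_ : 'I_p -> I) i :
  injective i_ -> ~~ listing_order i_ i i.
Proof.
move=> i_inj; apply/existsP => -[s /existsP[t /and3P[st /eqP <- /eqP/i_inj ts]]].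
by rewrite ts ltnn in st.
Qed.

Lemma listed_word_sorted p (i_ : 'I_p -> I) (k_ : 'I_p -> nat) :
  injective i_ ->
  pairwise (fun i j => ~~ listing_order i_ j i)
    (flatten [seq nseq (k_ j) (i_ j) | j <- enum 'I_p]).
Proof.
move=> i_inj.
have : pairwise (fun s t : 'I_p => (s < t)%N) (enum 'I_p).
  rewrite -(pairwise_map (fun s : 'I_p => val s) ltn) val_enum_ord.
  by rewrite -(sorted_pairwise ltn_trans) iota_ltn_sorted.
elim: (enum 'I_p) => //= s r IH /andP[/allP sr /IH Hr].
rewrite pairwise_cat Hr andbT; apply/andP; split; last first.
  by apply/(pairwiseP (i_ s)) => b c; rewrite !inE !size_nseq => bs cs _;
    rewrite !nth_nseq bs cs; exact: listing_order_irrefl.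
apply/allrelP => i j /nseqP[-> _] /flatten_mapP[t tr /nseqP[-> _]].
apply/existsP => -[t' /existsP[s' /and3P[ts /eqP/i_inj Et /eqP/i_inj Es]]].
by have := sr t tr; rewrite -Et -Es => /(ltn_trans ts); rewrite ltnn.
Qed.
End WeightWords.

Theorem corollary3p10
  (I : finType) (P : zmodType) (C : cartan_datum I P)
  (K : idomainType) (gr : grading K) (Q : klr_parameters C gr)
  (Lam : P) (Lam_dominant : dominant C Lam)
  (a : cyclotomic_parameters C gr Lam)
  (n : nat) (red : 'S_n.+1 -> seq 'I_n)
  (red_reduced : forall w, reduced_expression w (red w))
  (p : nat) (i_ : 'I_p -> I) (i_inj : injective i_) (k_ : 'I_p -> nat)
  (k_sum : (\sum_j k_ j)%N = n.+1)
  (beta : P) (beta_def : beta = \sum_j simple_root C (i_ j) *+ k_ j)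
  (nut nu : weight_word C n.+1 beta)
  (nut_def : val nut = flatten [seq nseq (k_ j) (i_ j) | j <- enum 'I_p] :> seq I) :
  is_basis
    (fun wa : 'S_n.+1 * 'X_{1..n.+1} =>
       perm_word wa.1 nu = nut /\
       forall k : 'I_n.+1,
         (wa.2 k < leading_degree Q a (listing_order i_) nu k)%N)
    (fun wa =>
       to_cyclotomic a
         (klr_tau_word Q beta (red wa.1) * klr_xmon Q beta wa.2 * klr_e Q nu))
    (corner (to_cyclotomic a (klr_e Q nut)) (to_cyclotomic a (klr_e Q nu))).
Proof.
have redP w : word_perm (red w) = w /\ reduced (red w).
  exact/reduced_expressionP.
have nut_sorted b c : listing_order i_ (letter nut b) (letter nut c) -> (b < c)%N.
  have letterE d : letter nut d = nth (letter nut b) (val nut) d.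
    by rewrite /letter (tnth_nth (letter nut b)).
  have [//|cb|/val_inj->] := ssrnat.ltngtP b c; last first.
    by rewrite (negbTE (listing_order_irrefl _ i_inj)).
  have /(pairwiseP (letter nut b)) H := listed_word_sorted k_ i_inj.
  rewrite -nut_def in H; have := H c b; rewrite !inE size_tuple !ltn_ord.
  by rewrite -!letterE => /(_ isT isT cb) /negbTE->.
have letter_listed (mu : weight_word C n.+1 beta) b : exists j, letter mu b = i_ j.
  have : letter mu b \in val mu by exact: mem_tnth.
  rewrite (perm_mem (weight_word_perm mu nut)) nut_def.
  by case/flatten_mapP => j _ /nseqP[-> _]; exists j.
have prec_total (mu : weight_word C n.+1 beta) b c : letter mu b != letter mu c ->
    ~~ listing_order i_ (letter mu c) (letter mu b) ->
    listing_order i_ (letter mu b) (letter mu c).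
  have [s ->] := letter_listed mu b; have [t ->] := letter_listed mu c.
  rewrite (inj_eq i_inj) => st; have [lt _|lt /existsP[]|/val_inj E] := ssrnat.ltngtP s t.
  - by apply/existsP; exists s; apply/existsP; exists t; rewrite lt !eqxx.
  - by exists t; apply/existsP; exists s; rewrite lt !eqxx.
  by rewrite E eqxx in st.
exact: (cyclotomic_basis (@klr_relationE _ _ _ _ _ Q n beta)
  (@klr_algebra_generated _ _ _ _ _ Q n beta) a nut_sorted prec_total redP
  (fun f => klr_independent redP)).
Qed.
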